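(* For $a\in\mathbb R$ set $H_a:=\{z\in\mathbb C:\mathrm{Re}\,z\ge a\}$. For any $\varepsilon>0$ there exist constants $C_1,C_2>0$ such that every $\lambda\in H_{-\frac32+\varepsilon}$ with $|\lambda|\ge C_1$ belongs to the resolvent set of $\mathbf L$ and $$\|\mathbf R_{\mathbf L}(\lambda)\|\le C_2$$ for all such $\lambda$, where $\mathbf R_{\mathbf L}(\lambda)=(\lambda-\mathbf L)^{-1}$. In particular, $\mathbf L$ does not have unstable eigenvalues (eigenvalues with $\mathrm{Re}\,\lambda\ge0$) far away from the real axis.
   Context: Put $Df(\rho):=\frac1\rho f'(\rho)$, $D^2=D\circ D$, $Kf(\rho):=\int_0^\rho sf(s)\,ds$, $K^2=K\circ K$. Let $\mathcal H$ be the (complex) Hilbert space completion of $$\tilde{\mathcal H}:=\{(u_1,u_2)\in C^4[0,1]\times C^1[0,1]: u_1^{(k)}(0)=u_2(0)=0,\ k=0,1,2,3\}$$ with respect to the inner product $(\mathbf u|\mathbf v)=\int_0^1D^2u_1\overline{D^2v_1}\,d\rho+\int_0^1u_2'\overline{v_2'}\,d\rho$. Let $\mathbf L_0$ be the closure in $\mathcal H$ of the (closable) operator $$\tilde{\mathbf L}_0\mathbf u(\rho)=\left(-\rho u_1'(\rho)+2u_1(\rho)+\rho^2u_2(\rho)-3Ku_2(\rho),\ D^2u_1(\rho)-\rho u_2'(\rho)-u_2(\rho)\right)$$ with domain $\{(u_1,u_2)\in C^\infty[0,1]\times C^\infty[0,1]: u_1^{(k)}(0)=u_2(0)=0,\ k=0,1,2,3,4\}$.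 Let $\mathbf L'\in\mathcal B(\mathcal H)$ be $\mathbf L'\mathbf u:=(-VK^2u_2,0)$ with $V(\rho)=-144\frac{5-\rho^2}{(5+3\rho^2)^2}$, and $\mathbf L:=\mathbf L_0+\mathbf L'$ with domain $\mathcal D(\mathbf L_0)$. *)

(* Defs.v *)
From Stdlib Require Export Reals.
From Coquelicot Require Export Coquelicot.
Open Scope R_scope.

(* A function [0,1] -> C is represented by a function [R -> C]; its values
   off [0,1] are never used.  Derivatives are relative to [0,1], hence
   one-sided at the endpoints. *)

Definition cfun := R -> C.
Definition cfun2 := (cfun * cfun)%type.

Definition I01 (x : R) : Prop := 0 <= x <= 1.

(* Coquelicot's [is_derive], with [locally x] cut down to [0,1]. *)
Definition is_derive01 (f : cfun) (x : R) (l : C) : Prop :=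
  filterdiff (U := R_NormedModule) (V := C_R_NormedModule)
    f (within I01 (locally x)) (fun y : R => scal y l).

Definition Derive01 (f : cfun) : cfun :=
  fun x => iota (T := C_R_CompleteNormedModule) (is_derive01 f x).

Fixpoint Derive01_n (k : nat) (f : cfun) : cfun :=
  match k with
  | O => f
  | S m => Derive01 (Derive01_n m f)
  end.

Definition Ck01 (k : nat) (f : cfun) : Prop :=
  (forall i x, (i < k)%nat -> I01 x ->
     exists l, is_derive01 (Derive01_n i f) x l) /\
  continuous_on (T := R_UniformSpace) (U := C_UniformSpace)
    I01 (Derive01_n k f).

Definition Cinfty01 (f : cfun) : Prop := forall k, Ck01 k f.

(* The value at rho = 0 is junk; it is never relied upon below. *)
Definition Dop (f : cfun) : cfun :=
  fun rho => (/ RtoC rho * Derive01 f rho)%C.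

Definition Kop (f : cfun) : cfun :=
  fun rho => RInt (V := C_R_CompleteNormedModule)
               (fun s => (RtoC s * f s)%C) 0 rho.

Definition potential (rho : R) : R :=
  - 144 * ((5 - rho ^ 2) / (5 + 3 * rho ^ 2) ^ 2).

Definition add2 (u v : cfun2) : cfun2 :=
  (fun rho => (fst u rho + fst v rho)%C, fun rho => (snd u rho + snd v rho)%C).

Definition scal2 (c : C) (u : cfun2) : cfun2 :=
  (fun rho => (c * fst u rho)%C, fun rho => (c * snd u rho)%C).

Definition tildeH (u : cfun2) : Prop :=
  Ck01 4 (fst u) /\ Ck01 1 (snd u) /\
  (forall k, (k <= 3)%nat -> Derive01_n k (fst u) 0 = RtoC 0) /\
  snd u 0 = RtoC 0.

Definition tildeH_inner (u v : cfun2) : C :=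
  (RInt (V := C_R_CompleteNormedModule)
     (fun rho => Dop (Dop (fst u)) rho * Cconj (Dop (Dop (fst v)) rho)) 0 1 +
   RInt (V := C_R_CompleteNormedModule)
     (fun rho => Derive01 (snd u) rho * Cconj (Derive01 (snd v) rho)) 0 1)%C.

(* The norm of the complete space H is the one of the inner product [ip]. *)
Record is_Hilbert (H : CompleteNormedModule C_AbsRing) (ip : H -> H -> C)
    : Prop := {
  ip_plus : forall x y z, ip (plus x y) z = (ip x z + ip y z)%C;
  ip_scal : forall (c : C) x y, ip (scal c x) y = (c * ip x y)%C;
  ip_conj : forall x y, ip y x = Cconj (ip x y);
  ip_norm : forall x, ip x x = RtoC (norm x ^ 2)
}.

(* [j] is the canonical map of [tilde H] into its completion; only its values
   on [tildeH] matter.  It identifies two pairs exactly when they agree on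
   [0,1], since their difference then has norm 0. *)
Record is_completion (H : CompleteNormedModule C_AbsRing) (ip : H -> H -> C)
    (j : cfun2 -> H) : Prop := {
  cpl_Hilbert : is_Hilbert H ip;
  cpl_add : forall u v, tildeH u -> tildeH v ->
    j (add2 u v) = plus (j u) (j v);
  cpl_scal : forall c u, tildeH u -> j (scal2 c u) = scal c (j u);
  cpl_inner : forall u v, tildeH u -> tildeH v ->
    ip (j u) (j v) = tildeH_inner u v;
  cpl_dense : forall (x : H) (eps : R), 0 < eps ->
    exists u, tildeH u /\ norm (minus x (j u)) < eps
}.

Section Operators.
Context {H : CompleteNormedModule C_AbsRing}.

(* A possibly unbounded operator is represented by its graph. *)
Definition operator := H -> H -> Prop.

Definition op_closure (A : operator) : operator :=
  fun x y => forall eps : R, 0 < eps ->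
    exists x' y', A x' y' /\ norm (minus x x') < eps /\ norm (minus y y') < eps.

(* [T = (lam - A)^-1], a bounded operator on H ([is_linear] includes
   boundedness). *)
Definition is_resolvent (A : operator) (lam : C) (T : H -> H) : Prop :=
  is_linear T /\
  (forall f, A (T f) (minus (scal lam (T f)) f)) /\
  (forall u y, A u y -> T (minus (scal lam u) y) = u).

Definition is_eigenvalue (A : operator) (lam : C) : Prop :=
  exists u, u <> zero /\ A u (scal lam u).

Definition op_norm (T : H -> H) : Rbar :=
  Lub_Rbar (fun r => exists x, norm x <= 1 /\ r = norm (T x)).

(* The operator in H induced, through [j], by a map [T] on pairs of functions
   with domain [dom], where the formula for [T] may be singular at rho = 0:
   [T u] is understood as its continuous extension [w] to [0,1]. *)
Definition induced (j : cfun2 -> H) (dom : cfun2 -> Prop) (T : cfun2 -> cfun2)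
    : operator :=
  fun x y => exists u w, dom u /\ tildeH w /\
    (forall rho, 0 < rho <= 1 ->
       fst w rho = fst (T u) rho /\ snd w rho = snd (T u) rho) /\
    x = j u /\ y = j w.

End Operators.

Arguments operator H : clear implicits.

Definition tildeL0 (u : cfun2) : cfun2 :=
  ((fun rho : R => - RtoC rho * Derive01 (fst u) rho + RtoC 2 * fst u rho
      + RtoC (rho ^ 2) * snd u rho - RtoC 3 * Kop (snd u) rho)%C,
   (fun rho : R => Dop (Dop (fst u)) rho - RtoC rho * Derive01 (snd u) rho
      - snd u rho)%C).

Definition dom_tildeL0 (u : cfun2) : Prop :=
  Cinfty01 (fst u) /\ Cinfty01 (snd u) /\
  (forall k, (k <= 4)%nat -> Derive01_n k (fst u) 0 = RtoC 0) /\
  snd u 0 = RtoC 0.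

Definition tildeL' (u : cfun2) : cfun2 :=
  ((fun rho : R => - RtoC (potential rho) * Kop (Kop (snd u)) rho)%C,
   (fun _ : R => RtoC 0)).

Section Problem.
Context {H : CompleteNormedModule C_AbsRing} (j : cfun2 -> H).

(* [tildeL0] is closable, so this is again the graph of an operator. *)
Definition L0 : operator H := op_closure (induced j dom_tildeL0 tildeL0).

(* The bounded operator u |-> (- V K^2 u_2, 0) on the completion is the
   continuous extension of its restriction to the dense subspace of those u
   in [tilde H] whose image is again in [tilde H] (K^2 u_2 is only C^3 when
   u_2 is C^1); it sends x to the unique y with (x, y) in the closure of the
   graph of that restriction. *)
Definition L' (x : H) : H :=
  iota (op_closure (induced j tildeH tildeL') x).

Definition L : operator H :=
  fun x y => exists y0, L0 x y0 /\ y = plus y0 (L' x).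

End Problem.

Definition half_plane (a : R) (z : C) : Prop := a <= Re z.

(* Main.v *)
(* In the variables [(D^2 u_1, u_2')] the space is L^2 x L^2, and if these are the odd
   and even parts of a function [W] on [-1,1], then [L_0] becomes
   [W |-> (1 - x) W' - 2 W].  Integrating by parts gives
   [Re (L_0 u | u) <= -3/2 |u|^2], and on monomials
   [(lam - L_0) x^n = (lam + n + 2) x^n - n x^(n-1)], so that the range of [lam - L_0]
   contains all polynomials, which are dense (Bernstein).  The perturbation satisfies
   [|L' u| <= C |u_2|_(L^2)], while the second row of [(lam - L_0) u = f], namely
   [lam u_2 = D^2 u_1 - rho u_2' - u_2 + f_2], yields
   [|lam| |u_2|_(L^2) <= C (|u| + |f|)].  Hence [L' R_{L_0}(lam) = O(1 / |lam|)]
   uniformly on the half plane, and a Neumann series argument inverts [lam - L]. *)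

(* Elements of the completion are not functions, so pointwise arguments are confined to pairs in
   [tildeH]. Each estimate is therefore brought into a form that survives the closure of a graph: an
   inequality between quantities that are Lipschitz in the norm of H. This is why the gain in |lam|
   is stated for [L' j x], which makes sense on all of H, and not for u_2.

   In the energy estimate -2 is the zeroth-order term and +1/2 comes from differentiating the weight
   1 - x. The weight vanishes at x = 1, and the boundary term at x = -1 has the favourable sign.

   [L'] itself is not small. It is controlled by u_2 in L^2 because [D] undoes [K], so that D^2 (V
   K^2 u_2) contains no derivative of u_2. With |u| <= |f| / eps from the energy estimate, this
   gives |L' R_{L_0}(lam)| <= 8 KV (1 + 1/eps) / |lam|; the threshold 32 KV (1 + 1/eps) for |lam|
   makes it 1/4.

   The Neumann series is run as an iteration on residuals. It yields a dense range, and a lower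
   bound for lam - L together with closedness turns this into surjectivity. *)
From Stdlib Require Import Arith Lra Lia Psatz.
Require Import Defs.

(** * Complex functions of a real variable and derivatives relative to [0,1] *)

(** Calculus is done with two-sided derivatives of functions on the whole line;
    [is_derive01_of_cdiff] and its variant on (0,1] carry the results back to [Derive01]. *)
Definition cdiff (f : R -> C) (x : R) (l : C) : Prop :=
  is_derive (K := R_AbsRing) (V := C_R_NormedModule) f x l.
Notation ccont := (continuous (T := R_UniformSpace) (U := C_UniformSpace)).

Lemma C_eq (z w : C) : fst z = fst w -> snd z = snd w -> z = w.
Proof. destruct z, w; simpl; intros; subst; reflexivity. Qed.

Lemma cdiff_fst (f : R -> C) x l :
  cdiff f x l -> is_derive (fun y => fst (f y)) x (fst l).
Proof.
intros H.
exact (filterdiff_comp f (fst : C_R_NormedModule -> R_NormedModule) _ _ H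
  (filterdiff_linear _ is_linear_fst)).
Qed.

Lemma cdiff_snd (f : R -> C) x l :
  cdiff f x l -> is_derive (fun y => snd (f y)) x (snd l).
Proof.
intros H.
exact (filterdiff_comp f (snd : C_R_NormedModule -> R_NormedModule) _ _ H
  (filterdiff_linear _ is_linear_snd)).
Qed.

Lemma cdiff_pair (f : R -> C) x l :
  is_derive (fun y => fst (f y)) x (fst l) ->
  is_derive (fun y => snd (f y)) x (snd l) -> cdiff f x l.
Proof.
intros H1 H2.
apply (is_derive_ext (V := C_R_NormedModule)
  (fun y => plus (scal (fst (f y)) ((1, 0) : C_R_NormedModule))
                 (scal (snd (f y)) ((0, 1) : C_R_NormedModule)))).
- intros t; apply C_eq; unfold plus, scal; simpl;
    unfold prod_plus, prod_scal; simpl;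
    unfold plus, scal, mult; simpl; unfold mult; simpl; ring.
- replace l with (plus (scal (fst l) ((1, 0) : C_R_NormedModule))
                 (scal (snd l) ((0, 1) : C_R_NormedModule))).
  + apply (is_derive_plus (V := C_R_NormedModule));
      apply (is_derive_scal_l (V := C_R_NormedModule)); assumption.
  + apply C_eq; unfold plus, scal; simpl;
    unfold prod_plus, prod_scal; simpl;
    unfold plus, scal, mult; simpl; unfold mult; simpl; ring.
Qed.

Lemma ccont_fst (f : R -> C) x :
  ccont f x -> continuous (fun y => fst (f y)) x.
Proof.
intros H; apply (continuous_comp f fst x H); apply continuous_fst.
Qed.

Lemma ccont_snd (f : R -> C) x :
  ccont f x -> continuous (fun y => snd (f y)) x.
Proof.
intros H; apply (continuous_comp f snd x H); apply continuous_snd.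
Qed.

Lemma ccont_pair (f : R -> C) x :
  continuous (fun y => fst (f y)) x -> continuous (fun y => snd (f y)) x ->
  ccont f x.
Proof.
intros H1 H2.
apply (continuous_ext (fun y => (fst (f y), snd (f y)))).
- intros y; symmetry; apply surjective_pairing.
- apply (continuous_comp_2 (fun y => fst (f y)) (fun y => snd (f y))
    (fun a b => (a, b)) x H1 H2).
  apply (continuous_ext (fun z : R * R => z)).
  + intros z; apply surjective_pairing.
  + apply continuous_id.
Qed.

Lemma cdiff_cont (f : R -> C) x l : cdiff f x l -> ccont f x.
Proof.
intros H; apply (ex_derive_continuous (V := C_R_NormedModule)).
now exists l.
Qed.

Lemma cdiff_eq (f : R -> C) x l l' : cdiff f x l -> l = l' -> cdiff f x l'.
Proof. now intros H <-. Qed.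

Lemma cdiff_const c x : cdiff (fun _ => c) x (RtoC 0).
Proof. apply (is_derive_const (V := C_R_NormedModule)). Qed.

Lemma cdiff_RtoC (r : R -> R) x l :
  is_derive r x l -> cdiff (fun y => RtoC (r y)) x (RtoC l).
Proof.
intros H; apply cdiff_pair; [exact H|].
exact (is_derive_const (V := R_NormedModule) (0 : R_NormedModule) x).
Qed.

Lemma cdiff_plus (f g : R -> C) x l m :
  cdiff f x l -> cdiff g x m -> cdiff (fun y => (f y + g y)%C) x (l + m)%C.
Proof. exact (is_derive_plus (V := C_R_NormedModule) f g x l m). Qed.

Lemma cdiff_mult (f g : R -> C) x l m :
  cdiff f x l -> cdiff g x m ->
  cdiff (fun y => (f y * g y)%C) x (l * g x + f x * m)%C.
Proof.
intros Hf Hg.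
pose proof (cdiff_fst _ _ _ Hf) as F1; pose proof (cdiff_snd _ _ _ Hf) as F2.
pose proof (cdiff_fst _ _ _ Hg) as G1; pose proof (cdiff_snd _ _ _ Hg) as G2.
apply cdiff_pair; simpl.
- refine (eq_ind _ (fun d => is_derive _ x d)
    (is_derive_minus _ _ _ _ _ (is_derive_mult _ _ _ _ _ F1 G1 Rmult_comm)
      (is_derive_mult _ _ _ _ _ F2 G2 Rmult_comm)) _ _).
  match goal with |- @eq _ ?a ?b => change (@eq R a b) end.
  unfold minus, plus, opp, mult; simpl; ring.
- refine (eq_ind _ (fun d => is_derive _ x d)
    (is_derive_plus _ _ _ _ _ (is_derive_mult _ _ _ _ _ F1 G2 Rmult_comm)
      (is_derive_mult _ _ _ _ _ F2 G1 Rmult_comm)) _ _).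
  match goal with |- @eq _ ?a ?b => change (@eq R a b) end.
  unfold minus, plus, opp, mult; simpl; ring.
Qed.

Lemma cdiff_scal c (f : R -> C) x l :
  cdiff f x l -> cdiff (fun y => (c * f y)%C) x (c * l)%C.
Proof.
intros H; eapply cdiff_eq.
- exact (cdiff_mult _ _ _ _ _ (cdiff_const c x) H).
- cbv beta; ring.
Qed.

Lemma cdiff_ext_loc (f g : R -> C) x l :
  locally x (fun y => f y = g y) -> cdiff f x l -> cdiff g x l.
Proof. exact (is_derive_ext_loc (V := C_R_NormedModule) f g x l). Qed.

Lemma ccont_plus (f g : R -> C) x :
  ccont f x -> ccont g x -> ccont (fun y => (f y + g y)%C) x.
Proof. exact (continuous_plus (V := C_R_NormedModule) f g x). Qed.

Lemma ccont_mult (f g : R -> C) x :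
  ccont f x -> ccont g x -> ccont (fun y => (f y * g y)%C) x.
Proof.
intros Hf Hg; apply ccont_pair; simpl.
- apply (continuous_minus (V := R_NormedModule));
    apply (continuous_mult (K := R_AbsRing));
    (apply ccont_fst || apply ccont_snd); assumption.
- apply (continuous_plus (V := R_NormedModule));
    apply (continuous_mult (K := R_AbsRing));
    (apply ccont_fst || apply ccont_snd); assumption.
Qed.

Lemma ccont_const c x : ccont (fun _ => c) x.
Proof. apply continuous_const. Qed.

Lemma ccont_RtoC (r : R -> R) x :
  continuous r x -> ccont (fun y => RtoC (r y)) x.
Proof. intros H; apply ccont_pair; [exact H | apply continuous_const]. Qed.

Lemma ccont_conj (f : R -> C) x :
  ccont f x -> ccont (fun y => Cconj (f y)) x.
Proof.
intros H; apply ccont_pair; simpl; [now apply ccont_fst|].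
apply (continuous_opp (V := R_NormedModule)); now apply ccont_snd.
Qed.

Lemma Cmod2_eq z : Cmod z ^ 2 = fst z * fst z + snd z * snd z.
Proof. unfold Cmod; rewrite pow2_sqrt; [ring|nra]. Qed.

Lemma continuous_Cmod2 (f : R -> C) x :
  ccont f x -> continuous (fun y => (Cmod (f y) ^ 2)) x.
Proof.
intros H.
apply (continuous_ext (fun y => fst (f y) * fst (f y) + snd (f y) * snd (f y))).
- intros y; rewrite Cmod2_eq; reflexivity.
- apply (continuous_plus (V := R_NormedModule));
    apply (continuous_mult (K := R_AbsRing));
    (apply ccont_fst || apply ccont_snd); assumption.
Qed.

Lemma remainder_eq (f : R -> C) x y (l : C) :
  minus (G := C_R_NormedModule) (minus (f y) (f x))
     (scal (minus y x) (l : C_R_NormedModule)) =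
  (f y - f x - RtoC (y - x) * l)%C.
Proof.
apply C_eq; unfold minus, plus, opp, scal; simpl;
  unfold prod_plus, prod_opp, prod_scal; simpl;
  unfold plus, opp, scal, mult; simpl; unfold plus, opp, mult; simpl; ring.
Qed.

Lemma is_derive01_eps (f : R -> C) x l : I01 x ->
  is_derive01 f x l <->
  (forall eps, 0 < eps -> exists del, 0 < del /\ forall y, I01 y ->
     Rabs (y - x) < del ->
     Cmod (f y - f x - RtoC (y - x) * l) <= eps * Rabs (y - x)).
Proof.
intros Hx.
pose proof (fun y => remainder_eq f x y l) as E.
assert (FL : is_filter_lim (within I01 (locally x)) x).
{ intros P HP; unfold within; apply filter_imp with (2 := HP); auto. }
split.
- intros [_ H] eps He.
  destruct (H x FL (mkposreal eps He)) as [d Hd].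
  exists d; split; [apply cond_pos|].
  intros y Hy Hyx.
  rewrite Cmod_norm, <- E; exact (Hd y Hyx Hy).
- intros H; split.
  + apply (is_linear_scal_l (V := C_R_NormedModule)).
  + intros z Hz.
    (* [filterdiff] speaks of every limit [z] of the filter. Since [x] itself lies in [0,1], it
       belongs to every set of the filter, which forces [z = x]. *)
    assert (z = x) as ->.
    { destruct (Req_dec z x) as [->|Hne]; auto; exfalso.
      assert (Hp : 0 < Rabs (z - x) / 2).
      { apply Rdiv_lt_0_compat; [apply Rabs_pos_lt|]; lra. }
      assert (L : locally z (fun y => Rabs (y - z) < Rabs (z - x) / 2)).
      { exists (mkposreal _ Hp); intros y Hy; exact Hy. }
      destruct (Hz _ L) as [d Hd].
      specialize (Hd x (ball_center x d) Hx); simpl in Hd.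
      rewrite Rabs_minus_sym in Hd; lra. }
    intros eps.
    destruct (H eps (cond_pos eps)) as [d [Hd Hdd]].
    exists (mkposreal d Hd); intros y Hy HIy.
    specialize (Hdd y HIy Hy); rewrite Cmod_norm, <- E in Hdd; exact Hdd.
Qed.

Lemma cdiff_eps (f : R -> C) x l : cdiff f x l ->
  (forall eps, 0 < eps -> exists del, 0 < del /\ forall y,
     Rabs (y - x) < del ->
     Cmod (f y - f x - RtoC (y - x) * l) <= eps * Rabs (y - x)).
Proof.
intros [_ H] eps He.
pose proof (fun y => remainder_eq f x y l) as E.
destruct (H x (fun P HP => HP) (mkposreal eps He)) as [d Hd].
exists d; split; [apply cond_pos|].
intros y Hyx; rewrite Cmod_norm, <- E; exact (Hd y Hyx).
Qed.

Lemma is_derive01_inj (f : R -> C) x (l m : C) : I01 x ->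
  is_derive01 f x l -> is_derive01 f x m -> m = l.
Proof.
intros Hx Hl Hm.
cut (Cmod (m - l) <= 0).
{ intros H; replace m with (m - l + l)%C by ring.
  rewrite (Cmod_eq_0 (m - l)); [ring|].
  apply Rle_antisym; [exact H | apply Cmod_ge_0]. }
apply le_epsilon; intros eps He; rewrite Rplus_0_l.
destruct (proj1 (is_derive01_eps f x l Hx) Hl (eps / 2)) as [d1 [D1 K1]]; [lra|].
destruct (proj1 (is_derive01_eps f x m Hx) Hm (eps / 2)) as [d2 [D2 K2]]; [lra|].
assert (Hy : exists y, I01 y /\ Rabs (y - x) < d1 /\ Rabs (y - x) < d2 /\
   0 < Rabs (y - x)).
(* A step of length at most 1/2 stays inside [0,1] on at least one side of [x], whichever half [x]
   lies in. *)
{ pose (t := Rmin (1 / 2) (Rmin d1 d2 / 2)).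
  assert (T : 0 < t /\ t <= 1 / 2 /\ t < d1 /\ t < d2).
  { unfold t, Rmin; repeat destruct Rle_dec; lra. }
  unfold I01 in *; destruct (Rle_dec x (1 / 2)).
  - exists (x + t); replace (x + t - x) with t by ring.
    rewrite Rabs_pos_eq; lra.
  - exists (x - t); replace (x - t - x) with (- t) by ring.
    rewrite Rabs_Ropp, Rabs_pos_eq; lra. }
destruct Hy as [y [Iy [Y1 [Y2 Y3]]]].
specialize (K1 y Iy Y1); specialize (K2 y Iy Y2).
apply (Rmult_le_reg_r (Rabs (y - x))); [exact Y3|].
assert (E : (RtoC (y - x) * (m - l))%C =
   ((f y - f x - RtoC (y - x) * l) + - (f y - f x - RtoC (y - x) * m))%C) by ring.
assert (M : Cmod (RtoC (y - x) * (m - l)) = Cmod (m - l) * Rabs (y - x)).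
{ rewrite Cmod_mult, Cmod_R; ring. }
rewrite <- M, E.
eapply Rle_trans; [apply Cmod_triangle|]; rewrite Cmod_opp; lra.
Qed.

Lemma is_derive01_unique (f : R -> C) x (l : C) : I01 x ->
  is_derive01 f x l -> Derive01 f x = l.
Proof.
intros Hx Hl; apply (iota_unique (V := C_R_CompleteNormedModule)); [|exact Hl].
intros m Hm; now apply is_derive01_inj with f x.
Qed.

Lemma is_derive01_of_cdiff (f g : R -> C) x l : I01 x ->
  (forall y, I01 y -> f y = g y) -> cdiff g x l -> is_derive01 f x l.
Proof.
intros Hx E H; apply is_derive01_eps; auto; intros eps He.
destruct (cdiff_eps g x l H eps He) as [d [D K]].
exists d; split; auto; intros y Hy Hd; rewrite !E; auto.
Qed.

(** The ball of radius [x] around [x] misses 0, so agreement on (0,1] is enough. This keeps the junk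
    value of [Dop] at 0 out of every computation. *)
Lemma is_derive01_of_cdiff_pos (f g : R -> C) x l : 0 < x <= 1 ->
  (forall y, 0 < y <= 1 -> f y = g y) -> cdiff g x l -> is_derive01 f x l.
Proof.
intros Hx E H; apply is_derive01_eps; [unfold I01; lra|]; intros eps He.
destruct (cdiff_eps g x l H eps He) as [d [D K]].
exists (Rmin d x); split; [apply Rmin_glb_lt; lra|]; intros y Hy Hd.
assert (Rabs (y - x) < d /\ Rabs (y - x) < x) as [A B].
{ split; (eapply Rlt_le_trans; [exact Hd|]); [apply Rmin_l|apply Rmin_r]. }
apply Rabs_def2 in B; unfold I01 in Hy.
rewrite !E by lra; auto.
Qed.

Lemma Derive01_of_cdiff (f g : R -> C) x l : I01 x ->
  (forall y, I01 y -> f y = g y) -> cdiff g x l -> Derive01 f x = l.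
Proof.
intros Hx E H; apply is_derive01_unique; auto.
now apply is_derive01_of_cdiff with g.
Qed.

Lemma Derive01_of_cdiff_pos (f g : R -> C) x l : 0 < x <= 1 ->
  (forall y, 0 < y <= 1 -> f y = g y) -> cdiff g x l -> Derive01 f x = l.
Proof.
intros Hx E H; apply is_derive01_unique; [unfold I01; lra|].
now apply is_derive01_of_cdiff_pos with g.
Qed.

(** * Extension of functions from [0,1] to the whole line *)

Definition clamp (x : R) : R := Rmax 0 (Rmin 1 x).

Lemma clamp_I01 x : I01 (clamp x).
Proof. unfold I01, clamp, Rmax, Rmin; repeat destruct Rle_dec; lra. Qed.

Lemma clamp_id x : I01 x -> clamp x = x.
Proof. unfold I01, clamp, Rmax, Rmin; repeat destruct Rle_dec; lra. Qed.

Lemma clamp_lip x y : Rabs (clamp y - clamp x) <= Rabs (y - x).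
Proof.
unfold clamp, Rmax, Rmin, Rabs; repeat destruct Rle_dec;
  repeat destruct Rcase_abs; lra.
Qed.

(** Composing with the retraction extends continuous functions but loses differentiability at the
    endpoints; differentiable extensions are obtained by integration in [primitive01]. *)
Lemma continuous_clamp (f : R -> C) :
  continuous_on (T := R_UniformSpace) (U := C_UniformSpace) I01 f ->
  forall x, ccont (fun y => f (clamp y)) x.
Proof.
intros H x P HP.
destruct (H (clamp x) (clamp_I01 x) P HP) as [d Hd].
exists d; intros y Hy; apply Hd; [|apply clamp_I01].
eapply Rle_lt_trans; [apply clamp_lip | exact Hy].
Qed.

Lemma continuous_on_ccont (f g : R -> C) :
  (forall x, ccont g x) -> (forall x, I01 x -> f x = g x) ->
  continuous_on (T := R_UniformSpace) (U := C_UniformSpace) I01 f.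
Proof.
intros Hg E x Hx P HP.
rewrite (E x Hx) in HP.
destruct (Hg x P HP) as [d Hd].
exists d; intros y Hy Iy; rewrite (E y Iy); auto.
Qed.

Lemma is_derive01_continuous_on (f h : R -> C) :
  (forall x, I01 x -> is_derive01 f x (h x)) ->
  continuous_on (T := R_UniformSpace) (U := C_UniformSpace) I01 f.
Proof.
intros H x Hx P [e He].
destruct (proj1 (is_derive01_eps f x (h x) Hx) (H x Hx) 1 Rlt_0_1) as [d [D K]].
pose (M := Cmod (h x) + 1).
assert (HM : 0 < M) by (unfold M; generalize (Cmod_ge_0 (h x)); lra).
assert (Hd : 0 < Rmin d (e / M)).
{ apply Rmin_glb_lt; auto; apply Rdiv_lt_0_compat; auto; apply cond_pos. }
exists (mkposreal _ Hd); intros y Hy Iy; apply He.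
change (Rabs (y - x) < Rmin d (e / M)) in Hy.
assert (Rabs (y - x) < d /\ Rabs (y - x) < e / M) as [A B].
{ split; (eapply Rlt_le_trans; [exact Hy|]); [apply Rmin_l|apply Rmin_r]. }
specialize (K y Iy A).
apply (norm_compat1 (V := C_R_NormedModule)).
change (@norm R_AbsRing C_R_NormedModule (f y - f x)%C < e).
rewrite <- Cmod_norm.
replace (f y - f x)%C with
  ((f y - f x - RtoC (y - x) * h x) + RtoC (y - x) * h x)%C by ring.
eapply Rle_lt_trans; [apply Cmod_triangle|].
rewrite Cmod_mult, Cmod_R.
apply Rle_lt_trans with (Rabs (y - x) * M); [unfold M; lra|].
apply Rmult_lt_compat_r with (r := M) in B; auto.
unfold Rdiv in B; rewrite Rmult_assoc, Rinv_l in B; lra.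
Qed.

Lemma continuity_pt_clamp_component (f h : R -> C) (pr : C -> R) :
  (forall z, continuous (T := C_UniformSpace) (U := R_UniformSpace) pr z) ->
  (forall x, I01 x -> is_derive01 f x (h x)) ->
  forall x, continuity_pt (fun y => pr (f (clamp y))) x.
Proof.
intros Hpr H x; apply continuity_pt_filterlim.
apply (continuous_comp (fun y => f (clamp y)) pr).
- apply continuous_clamp; now apply is_derive01_continuous_on with h.
- apply Hpr.
Qed.

Lemma is_derive01_interior (f : R -> C) x l : 0 < x < 1 ->
  is_derive01 f x l -> cdiff (fun y => f (clamp y)) x l.
Proof.
intros Hx H; split; [apply (is_linear_scal_l (V := C_R_NormedModule))|].
intros z Hz.
assert (z = x) as ->.
{ symmetry; exact (is_filter_lim_locally_unique (V := R_NormedModule) x z Hz). }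
intros eps.
destruct (proj1 (is_derive01_eps f x l ltac:(unfold I01; lra)) H eps (cond_pos eps))
  as [d [D K]].
assert (Hd : 0 < Rmin d (Rmin x (1 - x))) by (repeat apply Rmin_glb_lt; lra).
exists (mkposreal _ Hd); intros y Hy.
change (Rabs (y - x) < Rmin d (Rmin x (1 - x))) in Hy.
assert (A : Rabs (y - x) < d) by (eapply Rlt_le_trans; [exact Hy|apply Rmin_l]).
assert (B : Rabs (y - x) < Rmin x (1 - x))
  by (eapply Rlt_le_trans; [exact Hy|apply Rmin_r]).
assert (I01 y) as Iy.
{ apply Rabs_def2 in B; unfold I01.
  generalize (Rmin_l x (1 - x)) (Rmin_r x (1 - x)); lra. }
specialize (K y Iy A).
rewrite !clamp_id by (auto; unfold I01; lra).
pose proof (remainder_eq f x y l) as E.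
rewrite Cmod_norm, <- E in K; exact K.
Qed.

(** The mean value theorem for the real and imaginary parts of [f (clamp _)], which are continuous
    on the line and differentiable inside [0,1]. *)
Lemma is_derive01_zero (f : R -> C) :
  (forall x, I01 x -> is_derive01 f x (RtoC 0)) -> forall x, I01 x -> f x = f 0.
Proof.
intros H x Hx.
assert (G : forall pr : C -> R,
  (forall z, continuous (T := C_UniformSpace) (U := R_UniformSpace) pr z) ->
  (forall y, 0 < y < 1 -> is_derive (fun t => pr (f (clamp t))) y 0) ->
  pr (f x) = pr (f 0)).
{ intros pr Hc Hd.
  destruct (MVT_gen (fun y => pr (f (clamp y))) 0 x (fun _ => 0)) as [c [_ Hc']].
  - unfold I01 in Hx; rewrite Rmin_left, Rmax_right by lra.
    intros y Hy; apply Hd; lra.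
  - intros y _; now apply continuity_pt_clamp_component with (fun _ => RtoC 0).
  - rewrite !clamp_id in Hc' by (auto; unfold I01; lra); lra. }
apply C_eq; apply G.
- intros [a b]; apply continuous_fst.
- intros y Hy.
  apply (cdiff_fst (fun t => f (clamp t)) y (RtoC 0)).
  apply is_derive01_interior; auto; apply H; unfold I01; lra.
- intros [a b]; apply continuous_snd.
- intros y Hy.
  apply (cdiff_snd (fun t => f (clamp t)) y (RtoC 0)).
  apply is_derive01_interior; auto; apply H; unfold I01; lra.
Qed.

Notation CInt := (RInt (V := C_R_CompleteNormedModule)).
Notation is_CInt := (is_RInt (V := C_R_NormedModule)).

Lemma ex_CInt (h : R -> C) a b :
  (forall x, ccont h x) -> ex_RInt (V := C_R_NormedModule) h a b.
Proof.
intros H; apply (ex_RInt_continuous (V := C_R_CompleteNormedModule)).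
intros z _; apply H.
Qed.

Lemma is_CInt_cont (h : R -> C) a b :
  (forall x, ccont h x) -> is_CInt h a b (CInt h a b).
Proof.
intros H; apply (RInt_correct (V := C_R_CompleteNormedModule)).
now apply ex_CInt.
Qed.

Lemma cdiff_CInt (h : R -> C) a x :
  (forall x, ccont h x) -> cdiff (fun y => CInt h a y) x (h x).
Proof.
intros H; apply (is_derive_RInt (V := C_R_NormedModule)) with a; [|apply H].
apply filter_forall; intros y; now apply is_CInt_cont.
Qed.

Lemma is_derive01_minus (f g : R -> C) x l m : I01 x ->
  is_derive01 f x l -> is_derive01 g x m ->
  is_derive01 (fun y => (f y - g y)%C) x (l - m)%C.
Proof.
intros Hx Hf Hg; apply is_derive01_eps; auto; intros eps He.
destruct (proj1 (is_derive01_eps _ _ _ Hx) Hf (eps / 2)) as [d1 [D1 K1]]; [lra|].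
destruct (proj1 (is_derive01_eps _ _ _ Hx) Hg (eps / 2)) as [d2 [D2 K2]]; [lra|].
exists (Rmin d1 d2); split; [now apply Rmin_glb_lt|]; intros y Hy Hd.
specialize (K1 y Hy (Rlt_le_trans _ _ _ Hd (Rmin_l _ _))).
specialize (K2 y Hy (Rlt_le_trans _ _ _ Hd (Rmin_r _ _))).
replace (f y - g y - (f x - g x) - RtoC (y - x) * (l - m))%C with
  ((f y - f x - RtoC (y - x) * l) + - (g y - g x - RtoC (y - x) * m))%C by ring.
eapply Rle_trans; [apply Cmod_triangle|]; rewrite Cmod_opp; lra.
Qed.

(** A differentiable extension of [f] is the integral of a continuous extension [h] of its
    derivative; the two agree on [0,1] because their difference has derivative zero there. *)
Lemma primitive01 (f h : R -> C) :
  (forall x, I01 x -> is_derive01 f x (h x)) -> (forall x, ccont h x) ->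
  exists g, (forall x, cdiff g x (h x)) /\ forall x, I01 x -> f x = g x.
Proof.
intros Hf Hh; exists (fun x => (f 0 + CInt h 0 x)%C); split.
- intros x; eapply cdiff_eq.
  + apply cdiff_plus; [apply cdiff_const | now apply cdiff_CInt].
  + ring.
- intros x Hx.
  pose (d := fun y => (f y - (f 0 + CInt h 0 y))%C).
  assert (E : d x = d 0).
  { apply is_derive01_zero; auto; intros y Hy.
    replace (RtoC 0) with (h y - h y)%C by ring.
    apply is_derive01_minus; auto.
    apply is_derive01_of_cdiff with (fun x => (f 0 + CInt h 0 x)%C); auto.
    eapply cdiff_eq;
      [apply cdiff_plus; [apply cdiff_const | now apply cdiff_CInt]|ring]. }
  unfold d in E; rewrite (RInt_point (V := C_R_CompleteNormedModule)) in E.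
  change (@zero C_R_CompleteNormedModule) with (RtoC 0) in E.
  replace (f x) with (f x - (f 0 + CInt h 0 x) + (f 0 + CInt h 0 x))%C by ring.
  rewrite E; ring.
Qed.

Lemma Derive01_n_comm k f : Derive01_n k (Derive01 f) = Derive01_n (S k) f.
Proof. induction k as [|k IH]; simpl; [reflexivity | now rewrite IH]. Qed.

(** Peels off the innermost derivative, whereas [Derive01_n] recurses on the outermost one; this is
    the recursion pattern of [flat]. *)
Lemma Ck01_S k f :
  Ck01 (S k) f <->
  (forall x, I01 x -> is_derive01 f x (Derive01 f x)) /\ Ck01 k (Derive01 f).
Proof.
split.
- intros [H1 H2]; split; [|split].
  + intros x Hx; destruct (H1 O x ltac:(lia) Hx) as [l Hl].
    simpl in Hl; now rewrite (is_derive01_unique f x l).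
  + intros i x Hi Hx; rewrite Derive01_n_comm; apply H1; auto; lia.
  + now rewrite Derive01_n_comm.
- intros [H1 [H2 H3]]; split.
  + intros [|i] x Hi Hx; [exists (Derive01 f x); now apply H1|].
    rewrite <- Derive01_n_comm; apply H2; auto; lia.
  + now rewrite <- Derive01_n_comm.
Qed.

(* [flat v k f]: [f] is of class [C^k] on the whole line and its derivatives of
   order less than [min v k] vanish at [0]. *)
Fixpoint flat (v k : nat) (f : R -> C) : Prop :=
  match k with
  | O => forall x, ccont f x
  | S k' => ((0 < v)%nat -> f 0 = RtoC 0) /\
      exists f', (forall x, cdiff f x (f' x)) /\ flat (pred v) k' f'
  end.

Lemma flat_cont v k f : flat v k f -> forall x, ccont f x.
Proof.
destruct k; [auto|]; intros [_ [f' [H _]]] x; eapply cdiff_cont; apply H.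
Qed.

(** The extension is built from the top: the continuous derivative of order [k] is extended by
    [clamp], and each lower one is recovered by [primitive01]. *)
Lemma Ck01_flat v k f : Ck01 k f ->
  (forall i, (i < v)%nat -> (i < k)%nat -> Derive01_n i f 0 = RtoC 0) ->
  exists g, flat v k g /\ forall x, I01 x -> f x = g x.
Proof.
revert v f; induction k as [|k IH]; intros v f Hf Hv.
- exists (fun x => f (clamp x)); split.
  + intros x; apply continuous_clamp; apply Hf.
  + intros x Hx; now rewrite clamp_id.
- apply Ck01_S in Hf; destruct Hf as [H1 H2].
  destruct (IH (pred v) (Derive01 f) H2) as [g' [Fg' Eg']].
  { intros i Hi Hk; rewrite Derive01_n_comm; apply Hv; lia. }
  destruct (primitive01 f g') as [g [Dg Eg]].
  + intros x Hx; rewrite <- Eg'; auto.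
  + now apply flat_cont with (pred v) k.
  + exists g; split; [split|]; auto.
    * intros Hv0; rewrite <- Eg by (unfold I01; lra); apply (Hv O); lia.
    * now exists g'.
Qed.

Lemma flat_Ck01 v k f g : flat v k g -> (forall x, I01 x -> f x = g x) ->
  Ck01 k f /\
  (forall i, (i < v)%nat -> (i < k)%nat -> Derive01_n i f 0 = RtoC 0).
Proof.
revert v f g; induction k as [|k IH]; intros v f g Hg E.
- split; [split|].
  + intros i x Hi; lia.
  + now apply continuous_on_ccont with g.
  + intros i _ Hi; lia.
- destruct Hg as [H0 [g' [Dg Hg']]].
  assert (E' : forall x, I01 x -> Derive01 f x = g' x)
    by (intros x Hx; now apply Derive01_of_cdiff with g).
  destruct (IH _ _ _ Hg' E') as [K1 K2]; split.
  + apply Ck01_S; split; auto.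
    intros x Hx; rewrite E' by auto; now apply is_derive01_of_cdiff with g.
  + intros [|i] Hi Hk.
    * simpl; rewrite E by (unfold I01; lra); apply H0; lia.
    * rewrite <- Derive01_n_comm; apply K2; lia.
Qed.

Lemma flat_S v k f : flat v (S k) f -> flat v k f.
Proof.
revert v f; induction k as [|k IH]; intros v f H.
- exact (flat_cont _ _ _ H).
- destruct H as [H0 [f' [D H]]]; split; auto; exists f'; auto.
Qed.

Lemma flat_le v k l f : (l <= k)%nat -> flat v k f -> flat v l f.
Proof. induction 1; auto; intros H'; apply IHle; now apply flat_S. Qed.

Lemma flat_weaken v w k f : (w <= v)%nat -> flat v k f -> flat w k f.
Proof.
revert v w f; induction k as [|k IH]; intros v w f Hw; [auto|].
intros [H0 [f' [D H]]]; split; [intros; apply H0; lia|].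
exists f'; split; auto; apply IH with (pred v); auto; lia.
Qed.

Lemma flat_ext v k f g : (forall x, f x = g x) -> flat v k f -> flat v k g.
Proof.
intros E; destruct k.
- intros H x; apply (continuous_ext f); auto.
- intros [H0 [f' [D H]]]; split; [rewrite <- E; auto|].
  exists f'; split; auto; intros x; apply (cdiff_ext_loc f); auto.
  now apply filter_forall.
Qed.

Lemma flat_plus v k f g :
  flat v k f -> flat v k g -> flat v k (fun x => (f x + g x)%C).
Proof.
revert v f g; induction k as [|k IH]; intros v f g Hf Hg.
- intros x; now apply ccont_plus.
- destruct Hf as [F0 [f' [Df Hf]]], Hg as [G0 [g' [Dg Hg]]]; split.
  + intros Hv; rewrite F0, G0 by auto; ring.
  + exists (fun x => (f' x + g' x)%C); split; auto.
    intros x; now apply cdiff_plus.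
Qed.

(** The order of vanishing is carried by the first factor alone; in the Leibniz rule both terms then
    vanish at least to order [pred v]. *)
Lemma flat_mult v k f g :
  flat v k f -> flat 0 k g -> flat v k (fun x => (f x * g x)%C).
Proof.
revert v f g; induction k as [|k IH]; intros v f g Hf Hg.
- intros x; now apply ccont_mult.
- pose proof (flat_S _ _ _ Hf) as Hf1; pose proof (flat_S _ _ _ Hg) as Hg1.
  destruct Hf as [F0 [f' [Df Hf]]], Hg as [G0 [g' [Dg Hg]]]; split.
  + intros Hv; rewrite F0 by auto; ring.
  + exists (fun x => (f' x * g x + f x * g' x)%C); split.
    * intros x; now apply cdiff_mult.
    * apply flat_plus; [now apply IH|].
      apply IH; auto; apply flat_weaken with v; auto; lia.
Qed.

Lemma flat_const c k : flat 0 k (fun _ => c).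
Proof.
revert c; induction k as [|k IH]; intros c; [intros x; apply ccont_const|].
split; [lia|]; exists (fun _ => RtoC 0); split; [intros; apply cdiff_const|apply IH].
Qed.

Lemma flat_zero v k : flat v k (fun _ => RtoC 0).
Proof.
revert v; induction k as [|k IH]; intros v; [intros x; apply ccont_const|].
split; auto; exists (fun _ => RtoC 0); split; [intros; apply cdiff_const|apply IH].
Qed.

Lemma flat_scal v k c f : flat v k f -> flat v k (fun x => (c * f x)%C).
Proof.
intros H; apply flat_ext with (fun x => (f x * c)%C); [intros; ring|].
apply flat_mult; auto; apply flat_const.
Qed.

Lemma flat_pow v n k : (v <= n)%nat -> flat v k (fun x => RtoC (x ^ n)).
Proof.
revert v n; induction k as [|k IH]; intros v n Hn.
- intros x; apply ccont_RtoC; apply (ex_derive_continuous (V := R_NormedModule)).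
  auto_derive; auto.
- split.
  + intros Hv; rewrite pow_i; auto; lia.
  + exists (fun x => (RtoC (INR n) * RtoC (x ^ pred n))%C); split.
    * intros x; eapply cdiff_eq; [apply cdiff_RtoC; auto_derive; auto|].
      rewrite <- RtoC_mult; f_equal; ring.
    * apply flat_scal, IH; lia.
Qed.

(** * Elements of [tilde H] *)

(** Integrates a Taylor expansion at 0 once: the mean value theorem is applied to the remainder of
    [f], whose derivative is the remainder of [f']. *)
Lemma taylor_step n (f f' : R -> R) l :
  f 0 = 0 -> (forall x, is_derive f x (f' x)) ->
  (forall eps, 0 < eps -> exists del, 0 < del /\ forall x, Rabs x < del ->
     Rabs (f' x - l * x ^ n) <= eps * Rabs x ^ n) ->
  forall eps, 0 < eps -> exists del, 0 < del /\ forall x, Rabs x < del ->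
     Rabs (f x - l / INR (S n) * x ^ S n) <= eps * Rabs x ^ S n.
Proof.
intros F0 D H eps He.
destruct (H eps He) as [d [Hd K]]; exists d; split; auto; intros x Hx.
destruct (MVT_gen (fun y => f y - l / INR (S n) * y ^ S n) 0 x
  (fun y => f' y - l * y ^ n)) as [c [Hc E]].
- intros y _.
  refine (eq_ind _ (fun m => is_derive _ y m)
   (is_derive_minus f (fun y => l / INR (S n) * y ^ S n) y _
     (l / INR (S n) * (INR (S n) * y ^ n)) (D y) _) _ _).
  + auto_derive; auto; change (match n with O => 1 | S _ => INR n + 1 end) with (INR (S n)); change (Init.Nat.pred (S n)) with n; ring.
  + match goal with |- @eq _ ?a ?b => change (@eq R a b) end.
    unfold minus, plus, opp; cbn -[INR pow].
    field; apply not_0_INR; lia.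
- intros y _; apply continuity_pt_filterlim.
  apply (continuous_minus (V := R_NormedModule) f (fun y => l / INR (S n) * y ^ S n)).
  + apply (ex_derive_continuous (V := R_NormedModule)); exists (f' y); apply D.
  + apply (ex_derive_continuous (V := R_NormedModule)); auto_derive; auto.
- cbv beta in E; rewrite F0, pow_i, Rmult_0_r, Rminus_0_r, !Rminus_0_r in E by lia.
  rewrite E, Rabs_mult; simpl.
  assert (C : Rabs c <= Rabs x).
  { revert Hc; unfold Rmin, Rmax, Rabs; repeat destruct Rle_dec;
      repeat destruct Rcase_abs; lra. }
  assert (L : Rabs (f' c - l * c ^ n) <= eps * Rabs x ^ n).
  { eapply Rle_trans; [apply K; lra|].
    apply Rmult_le_compat_l; [lra|]; apply pow_incr; split; [apply Rabs_pos|auto]. }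
  apply Rmult_le_compat_r with (r := Rabs x) in L; [lra|apply Rabs_pos].
Qed.

(** With [r1] = u', ..., [r4] = u'''', three uses of [taylor_step] give u' ~ u''''(0) x^3 / 6 and
    u'' ~ u''''(0) x^2 / 2, and 1/2 - 1/6 = 1/3. *)
Lemma continuous_Dop2_zero (r1 r2 r3 r4 : R -> R) :
  r1 0 = 0 -> r2 0 = 0 -> r3 0 = 0 ->
  (forall x, is_derive r1 x (r2 x)) -> (forall x, is_derive r2 x (r3 x)) ->
  (forall x, is_derive r3 x (r4 x)) -> continuous r4 0 ->
  forall a : R -> R, a 0 = r4 0 / 3 ->
  (forall x, x <> 0 -> a x = r2 x / x ^ 2 - r1 x / x ^ 3) -> continuous a 0.
Proof.
intros Z1 Z2 Z3 D1 D2 D3 C4 a A0 A.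
assert (K4 : forall eps, 0 < eps -> exists del, 0 < del /\ forall x, Rabs x < del ->
     Rabs (r4 x - r4 0 * x ^ 0) <= eps * Rabs x ^ 0).
{ intros eps He.
  destruct (C4 (fun y => Rabs (y - r4 0) < eps)) as [d Hd].
  - exists (mkposreal eps He); intros y Hy; exact Hy.
  - exists d; split; [apply cond_pos|]; intros x Hx; simpl.
    rewrite !Rmult_1_r; left; apply Hd.
    change (Rabs (x - 0) < d); now rewrite Rminus_0_r. }
pose proof (taylor_step _ _ _ _ Z3 D3 K4) as K3.
pose proof (taylor_step _ _ _ _ Z2 D2 K3) as K2.
pose proof (taylor_step _ _ _ _ Z1 D1 K2) as K1.
intros P [e He].
destruct (K1 (e / 3)) as [d1 [P1 L1]]; [generalize (cond_pos e); lra|].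
destruct (K2 (e / 3)) as [d2 [P2 L2]]; [generalize (cond_pos e); lra|].
assert (Hd : 0 < Rmin d1 d2) by now apply Rmin_glb_lt.
exists (mkposreal _ Hd); intros x Hx; apply He.
change (Rabs (x - 0) < Rmin d1 d2) in Hx; rewrite Rminus_0_r in Hx.
change (Rabs (a x - a 0) < e).
destruct (Req_dec x 0) as [->|Hn].
{ rewrite Rminus_diag_eq, Rabs_R0; auto; apply cond_pos. }
specialize (L1 x (Rlt_le_trans _ _ _ Hx (Rmin_l _ _))).
specialize (L2 x (Rlt_le_trans _ _ _ Hx (Rmin_r _ _))).
rewrite A0, A by auto.
replace (r4 0 / INR 1 / INR 2 / INR 3) with (r4 0 / 6) in L1 by (simpl; field).
replace (r4 0 / INR 1 / INR 2) with (r4 0 / 2) in L2 by (simpl; field).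
replace (r2 x / x ^ 2 - r1 x / x ^ 3 - r4 0 / 3) with
  ((r2 x - r4 0 / 2 * x ^ 2) / x ^ 2 + - ((r1 x - r4 0 / 6 * x ^ 3) / x ^ 3))
  by (field; auto).
assert (X : 0 < Rabs x) by now apply Rabs_pos_lt.
assert (Q : forall n y, Rabs y <= e / 3 * Rabs x ^ n -> Rabs (y / x ^ n) <= e / 3).
{ intros n y Hy; unfold Rdiv; rewrite Rabs_mult, Rabs_inv, <- RPow_abs.
  apply Rmult_le_reg_r with (Rabs x ^ n); [now apply pow_lt|].
  rewrite Rmult_assoc, Rinv_l, Rmult_1_r; auto; apply pow_nonzero; lra. }
eapply Rle_lt_trans; [apply Rabs_triang|]; rewrite Rabs_Ropp.
apply Q in L1; apply Q in L2; generalize (cond_pos e); lra.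
Qed.

(* [D^2 u = u'' / x^2 - u' / x^3] extends continuously by [u''''(0) / 3]. *)
Definition Dop2_ext (g1 g2 g4 : R -> C) (x : R) : C :=
  if Req_EM_T x 0 then (RtoC (/ 3) * g4 0)%C
  else (RtoC (/ x ^ 2) * g2 x + RtoC (- / x ^ 3) * g1 x)%C.

Lemma cdiff_Dop2_ext (g1 g2 g3 g4 : R -> C) x : x <> 0 ->
  (forall x, cdiff g1 x (g2 x)) -> (forall x, cdiff g2 x (g3 x)) ->
  exists l, cdiff (Dop2_ext g1 g2 g4) x l.
Proof.
intros Hx D1 D2; eexists.
apply cdiff_ext_loc with
  (fun x => (RtoC (/ x ^ 2) * g2 x + RtoC (- / x ^ 3) * g1 x)%C).
- assert (H : 0 < Rabs x) by now apply Rabs_pos_lt.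
  exists (mkposreal _ H); intros y Hy; unfold Dop2_ext.
  destruct Req_EM_T as [->|]; auto; exfalso.
  change (Rabs (0 - x) < Rabs x) in Hy.
  rewrite Rminus_0_l, Rabs_Ropp in Hy; lra.
- apply cdiff_plus; apply cdiff_mult; auto; apply cdiff_RtoC;
    (auto_derive; [repeat apply Rmult_integral_contrapositive_currified; auto|
      reflexivity]).
Qed.

Lemma ccont_Dop2_ext (g1 g2 g3 g4 : R -> C) :
  g1 0 = RtoC 0 -> g2 0 = RtoC 0 -> g3 0 = RtoC 0 ->
  (forall x, cdiff g1 x (g2 x)) -> (forall x, cdiff g2 x (g3 x)) ->
  (forall x, cdiff g3 x (g4 x)) -> (forall x, ccont g4 x) ->
  forall x, ccont (Dop2_ext g1 g2 g4) x.
Proof.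
intros Z1 Z2 Z3 D1 D2 D3 C4 x.
destruct (Req_dec x 0) as [->|Hx].
- apply ccont_pair.
  + apply (continuous_Dop2_zero (fun y => fst (g1 y)) (fun y => fst (g2 y))
      (fun y => fst (g3 y)) (fun y => fst (g4 y))); try (intros; now apply cdiff_fst);
      try (now rewrite ?Z1, ?Z2, ?Z3).
    * now apply ccont_fst.
    * unfold Dop2_ext; destruct Req_EM_T; [simpl; field|lra].
    * intros y Hy; unfold Dop2_ext; destruct Req_EM_T; [lra|simpl; field; auto].
  + apply (continuous_Dop2_zero (fun y => snd (g1 y)) (fun y => snd (g2 y))
      (fun y => snd (g3 y)) (fun y => snd (g4 y))); try (intros; now apply cdiff_snd);
      try (now rewrite ?Z1, ?Z2, ?Z3).
    * now apply ccont_snd.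
    * unfold Dop2_ext; destruct Req_EM_T; [simpl; field|lra].
    * intros y Hy; unfold Dop2_ext; destruct Req_EM_T; [lra|simpl; field; auto].
- destruct (cdiff_Dop2_ext g1 g2 g3 g4 x Hx D1 D2) as [l Hl].
  now apply cdiff_cont with l.
Qed.

(* On [(0,1]]: [u_1 = g], [D u_1 = p], [D^2 u_1 = a], [u_2 = h], [u_2' = b], with
   [a], [h], [b] continuous on the whole line. *)
Record profile (u : cfun2) (g p a h b : R -> C) : Prop := {
  pf_g : forall x, I01 x -> fst u x = g x;
  pf_dg : forall x, 0 < x -> cdiff g x (RtoC x * p x)%C;
  pf_dp : forall x, 0 < x -> cdiff p x (RtoC x * a x)%C;
  pf_a : forall x, ccont a x;
  pf_h : forall x, I01 x -> snd u x = h x;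
  pf_dh : forall x, cdiff h x (b x);
  pf_h0 : h 0 = RtoC 0;
  pf_b : forall x, ccont b x
}.

(** The two implications record the extra regularity of the core. Since [a 0] is g''''(0) / 3, the
    fifth order of vanishing gives [a 0 = 0], which removes the boundary term at 0 in the energy
    estimate. *)
Lemma flat_profile u g h : flat 4 4 g -> flat 1 1 h ->
  (forall x, I01 x -> fst u x = g x) -> (forall x, I01 x -> snd u x = h x) ->
  exists p a b, profile u g p a h b /\
    (flat 5 5 g -> a 0 = RtoC 0 /\ forall x, 0 < x -> exists l, cdiff a x l) /\
    (flat 1 2 h -> forall x, exists l, cdiff b x l).
Proof.
intros Fg Fh Eg Eh.
destruct Fg as [G0 [g1 [D0 [G1 [g2 [D1 [G2 [g3 [D2 [G3 [g4 [D3 C4]]]]]]]]]]]].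
destruct Fh as [H0 [b [Dh Cb]]].
simpl in *.
exists (fun x => (RtoC (/ x) * g1 x)%C), (Dop2_ext g1 g2 g4), b.
split; [split|split]; auto; try (apply H0; lia).
- intros x Hx; eapply cdiff_eq; [apply D0|].
  rewrite Cmult_assoc, <- RtoC_mult, Rinv_r by lra; ring.
- intros x Hx; eapply cdiff_eq.
  + apply cdiff_mult; [apply cdiff_RtoC; auto_derive; [lra|reflexivity]|apply D1].
  + unfold Dop2_ext; destruct Req_EM_T; [lra|].
    apply C_eq; simpl; field; lra.
- apply ccont_Dop2_ext with g3; auto.
- intros F5; split.
  + unfold Dop2_ext; destruct Req_EM_T; [|lra].
    destruct F5 as [_ [k1 [E0 [_ [k2 [E1 [_ [k3 [E2 [_ [k4 [E3 [Z _]]]]]]]]]]]]].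
    (* [flat] hides its derivatives behind existentials, so the chain coming from [F5] is identified
       with [g1], ..., [g4] by uniqueness of derivatives before its vanishing at fourth order can be
       used. *)
    assert (U : forall (f f' k k' : R -> C), (forall x, f x = k x) ->
      (forall x, cdiff f x (f' x)) -> (forall x, cdiff k x (k' x)) ->
      forall x, f' x = k' x).
    { intros f f' k k' E Df Dk x.
      assert (Dk' : cdiff k x (f' x)).
      { apply cdiff_ext_loc with f; auto; now apply filter_forall. }
      specialize (Dk x); apply C_eq.
      - rewrite <- (is_derive_unique _ _ _ (cdiff_fst _ _ _ Dk)).
        now rewrite <- (is_derive_unique _ _ _ (cdiff_fst _ _ _ Dk')).
      - rewrite <- (is_derive_unique _ _ _ (cdiff_snd _ _ _ Dk)).
        now rewrite <- (is_derive_unique _ _ _ (cdiff_snd _ _ _ Dk')). }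
    pose proof (U _ _ _ _ (fun x => eq_refl) D0 E0) as U1.
    pose proof (U _ _ _ _ U1 D1 E1) as U2.
    pose proof (U _ _ _ _ U2 D2 E2) as U3.
    pose proof (U _ _ _ _ U3 D3 E3) as U4.
    rewrite U4, Z by (simpl; lia); ring.
  + intros x Hx; apply (cdiff_Dop2_ext g1 g2 g3 g4); auto; lra.
- intros [_ [b' [Db [_ [b1 [D _]]]]]] x; exists (b1 x).
  assert (E : forall y, b y = b' y).
  { intros y; specialize (Dh y); specialize (Db y); apply C_eq.
    - rewrite <- (is_derive_unique _ _ _ (cdiff_fst _ _ _ Dh)).
      now rewrite <- (is_derive_unique _ _ _ (cdiff_fst _ _ _ Db)).
    - rewrite <- (is_derive_unique _ _ _ (cdiff_snd _ _ _ Dh)).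
      now rewrite <- (is_derive_unique _ _ _ (cdiff_snd _ _ _ Db)). }
  apply cdiff_ext_loc with b'; auto; now apply filter_forall.
Qed.

Lemma tildeH_flat u : tildeH u <-> exists g h, flat 4 4 g /\ flat 1 1 h /\
  (forall x, I01 x -> fst u x = g x) /\ (forall x, I01 x -> snd u x = h x).
Proof.
split.
- intros [H1 [H2 [H3 H4]]].
  destruct (Ck01_flat 4 4 (fst u) H1) as [g [Fg Eg]]; [intros; apply H3; lia|].
  destruct (Ck01_flat 1 1 (snd u) H2) as [h [Fh Eh]].
  { intros i Hi _; replace i with O by lia; exact H4. }
  now exists g, h.
- intros [g [h [Fg [Fh [Eg Eh]]]]].
  destruct (flat_Ck01 _ _ _ _ Fg Eg) as [K1 K2].
  destruct (flat_Ck01 _ _ _ _ Fh Eh) as [K3 K4].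
  split; [|split; [|split]]; auto.
  + intros k Hk; apply K2; lia.
  + apply (K4 O); lia.
Qed.

(** The extension may depend on [k], so that a single smooth extension to the line is never
    constructed. *)
Lemma dom_flat u : dom_tildeL0 u <-> forall k, exists g h,
  flat 5 k g /\ flat 1 k h /\
  (forall x, I01 x -> fst u x = g x) /\ (forall x, I01 x -> snd u x = h x).
Proof.
split.
- intros [H1 [H2 [H3 H4]]] k.
  destruct (Ck01_flat 5 k (fst u) (H1 k)) as [g [Fg Eg]]; [intros; apply H3; lia|].
  destruct (Ck01_flat 1 k (snd u) (H2 k)) as [h [Fh Eh]].
  { intros i Hi _; replace i with O by lia; exact H4. }
  now exists g, h.
- intros H; split; [|split; [|split]].
  + intros k; destruct (H k) as [g [h [Fg [Fh [Eg Eh]]]]].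
    apply (flat_Ck01 _ _ _ _ Fg Eg).
  + intros k; destruct (H k) as [g [h [Fg [Fh [Eg Eh]]]]].
    apply (flat_Ck01 _ _ _ _ Fh Eh).
  + intros k Hk; destruct (H 5%nat) as [g [h [Fg [Fh [Eg Eh]]]]].
    apply (flat_Ck01 _ _ _ _ Fg Eg); lia.
  + destruct (H 5%nat) as [g [h [Fg [Fh [Eg Eh]]]]].
    apply (proj2 (flat_Ck01 _ _ _ _ Fh Eh) O); lia.
Qed.

Lemma dom_tildeH u : dom_tildeL0 u -> tildeH u.
Proof.
intros H; apply tildeH_flat.
destruct (proj1 (dom_flat u) H 5%nat) as [g [h [Fg [Fh E]]]].
exists g, h; split; [|split]; auto.
- apply flat_le with 5%nat; [lia|]; apply flat_weaken with 5%nat; auto.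
- apply flat_le with 5%nat; auto; lia.
Qed.

Lemma tildeH_profile u : tildeH u -> exists g p a h b, profile u g p a h b.
Proof.
intros H; apply tildeH_flat in H; destruct H as [g [h [Fg [Fh [Eg Eh]]]]].
destruct (flat_profile u g h Fg Fh Eg Eh) as [p [a [b [P _]]]].
now exists g, p, a, h, b.
Qed.

Lemma dom_profile u : dom_tildeL0 u -> exists g p a h b a' b',
  profile u g p a h b /\ a 0 = RtoC 0 /\
  (forall x, 0 < x -> cdiff a x (a' x)) /\ (forall x, cdiff b x (b' x)).
Proof.
intros H; destruct (proj1 (dom_flat u) H 5%nat) as [g [h [Fg [Fh [Eg Eh]]]]].
assert (F4 : flat 4 4 g)
  by (apply flat_le with 5%nat; [lia|]; apply flat_weaken with 5%nat; auto).
assert (F1 : flat 1 1 h) by (apply flat_le with 5%nat; auto; lia).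
destruct (flat_profile u g h F4 F1 Eg Eh) as [p [a [b [P [Ka Kb]]]]].
destruct (Ka Fg) as [A0 A].
assert (F2 : flat 1 2 h) by (apply flat_le with 5%nat; auto; lia).
specialize (Kb F2).
(* The total operator [Derive] turns pointwise existence of derivatives into the functions [a'] and
   [b'] without choice. *)
exists g, p, a, h, b,
  (fun x => (Derive (fun y => fst (a y)) x, Derive (fun y => snd (a y)) x)),
  (fun x => (Derive (fun y => fst (b y)) x, Derive (fun y => snd (b y)) x)).
split; [|split; [|split]]; auto.
- intros x Hx; destruct (A x Hx) as [l Hl].
  apply cdiff_eq with l; auto; symmetry; apply C_eq; apply is_derive_unique;
    [now apply cdiff_fst|now apply cdiff_snd].
- intros x; destruct (Kb x) as [l Hl].
  apply cdiff_eq with l; auto; symmetry; apply C_eq; apply is_derive_unique;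
    [now apply cdiff_fst|now apply cdiff_snd].
Qed.

Notation rcont f := (forall x : R, continuous (T := R_UniformSpace) (U := R_UniformSpace) f x).

(** * L^2 estimates *)

Lemma ex_RInt_rcont (f : R -> R) a b : rcont f -> ex_RInt f a b.
Proof.
intros H; apply (ex_RInt_continuous (V := R_CompleteNormedModule)).
intros z _; apply H.
Qed.

Lemma rcont_plus (f g : R -> R) : rcont f -> rcont g -> rcont (fun x => f x + g x).
Proof. intros Hf Hg x; exact (continuous_plus (V := R_NormedModule) f g x (Hf x) (Hg x)). Qed.

Lemma rcont_mult (f g : R -> R) : rcont f -> rcont g -> rcont (fun x => f x * g x).
Proof. intros Hf Hg x; exact (continuous_mult (K := R_AbsRing) f g x (Hf x) (Hg x)). Qed.

Lemma rcont_const c : rcont (fun _ => c).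
Proof. intros x; apply continuous_const. Qed.

Lemma rcont_Cmod2 (f : R -> C) : (forall x, ccont f x) -> rcont (fun x => Cmod (f x) ^ 2).
Proof. intros H x; now apply continuous_Cmod2. Qed.

Lemma rcont_fst (f : R -> C) : (forall x, ccont f x) -> rcont (fun x => fst (f x)).
Proof. intros H x; now apply ccont_fst. Qed.

Lemma rcont_snd (f : R -> C) : (forall x, ccont f x) -> rcont (fun x => snd (f x)).
Proof. intros H x; now apply ccont_snd. Qed.

Lemma RInt01_plus (f g : R -> R) : rcont f -> rcont g ->
  RInt (fun x => f x + g x) 0 1 = RInt f 0 1 + RInt g 0 1.
Proof.
intros Hf Hg; apply (RInt_plus (V := R_CompleteNormedModule) f g);
  now apply ex_RInt_rcont.
Qed.

Lemma RInt01_scal c (f : R -> R) : rcont f ->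
  RInt (fun x => c * f x) 0 1 = c * RInt f 0 1.
Proof.
intros Hf; apply (RInt_scal (V := R_CompleteNormedModule) f); now apply ex_RInt_rcont.
Qed.

Lemma RInt01_le (f g : R -> R) : rcont f -> rcont g ->
  (forall x, 0 < x < 1 -> f x <= g x) -> RInt f 0 1 <= RInt g 0 1.
Proof.
intros Hf Hg H; apply RInt_le; auto; try now apply ex_RInt_rcont.
exact Rle_0_1.
Qed.

Lemma RInt01_ext (f g : R -> R) : (forall x, 0 < x < 1 -> f x = g x) ->
  RInt f 0 1 = RInt g 0 1.
Proof.
intros H; apply (RInt_ext (V := R_CompleteNormedModule)).
intros x; rewrite Rmin_left, Rmax_right by lra; auto.
Qed.

Lemma RInt01_ge_0 (f : R -> R) : rcont f ->
  (forall x, 0 < x < 1 -> 0 <= f x) -> 0 <= RInt f 0 1.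
Proof.
intros Hf H; apply RInt_ge_0; auto; [exact Rle_0_1|now apply ex_RInt_rcont].
Qed.

Lemma RInt01_const (c : R) : RInt (fun _ => c) 0 1 = c.
Proof.
rewrite (RInt_const (V := R_CompleteNormedModule)).
unfold scal; simpl; unfold mult; simpl; ring.
Qed.

(** Differentiability is asked only inside, because D^2 u_1 is known to be differentiable only for x
    > 0. The mean value theorem compares [F] with the integral of [f]. *)
Lemma RInt01_derive (F f : R -> R) : rcont F -> rcont f ->
  (forall x, 0 < x < 1 -> is_derive F x (f x)) -> RInt f 0 1 = F 1 - F 0.
Proof.
intros HF Hf D.
pose (G := fun x => RInt f 0 x).
assert (DG : forall x, is_derive G x (f x)).
{ intros x; apply (is_derive_RInt (V := R_NormedModule)) with 0; [|apply Hf].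
  apply filter_forall; intros y; apply (RInt_correct (V := R_CompleteNormedModule)).
  now apply ex_RInt_rcont. }
destruct (MVT_gen (fun x => G x - F x) 0 1 (fun _ => 0)) as [c [_ E]].
- rewrite Rmin_left, Rmax_right by lra; intros x Hx.
  replace 0 with (f x - f x) by ring.
  exact (is_derive_minus G F x _ _ (DG x) (D x Hx)).
- intros x _; apply continuity_pt_filterlim.
  apply (continuous_minus (V := R_NormedModule) G F); [|apply HF].
  apply (ex_derive_continuous (V := R_NormedModule)); exists (f x); apply DG.
- unfold G in E; rewrite (RInt_point (V := R_CompleteNormedModule)) in E.
  change (@zero R_CompleteNormedModule) with 0 in E; lra.
Qed.

Definition N2 (f : R -> C) : R := RInt (fun x => Cmod (f x) ^ 2) 0 1.

Lemma N2_ext f g : (forall x, 0 < x < 1 -> f x = g x) -> N2 f = N2 g.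
Proof. intros H; apply RInt01_ext; intros x Hx; now rewrite H. Qed.

Lemma N2_ge_0 f : (forall x, ccont f x) -> 0 <= N2 f.
Proof.
intros H; apply RInt01_ge_0.
- now apply rcont_Cmod2.
- intros; apply pow2_ge_0.
Qed.

(** Cauchy-Schwarz against the constant 1, in the form that a variance is nonnegative: the integral
    of (|f| - m)^2, with [m] the mean of |f|, equals [N2 f - m ^ 2]. *)
Lemma RInt01_Cmod_sq (f : R -> C) : (forall x, ccont f x) ->
  rcont (fun x => Cmod (f x)) /\ (RInt (fun x => Cmod (f x)) 0 1) ^ 2 <= N2 f.
Proof.
intros Hf.
assert (C : rcont (fun x => Cmod (f x))).
{ intros x; apply (continuous_ext (fun y => sqrt (fst (f y) ^ 2 + snd (f y) ^ 2)));
    [reflexivity|].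
  apply (continuous_comp (fun y => fst (f y) ^ 2 + snd (f y) ^ 2) sqrt).
  - apply (continuous_ext (fun y => Cmod (f y) ^ 2)); [|now apply continuous_Cmod2].
    intros y; rewrite Cmod2_eq; simpl; ring.
  - apply continuous_sqrt. }
split; auto.
pose (m := RInt (fun x => Cmod (f x)) 0 1).
assert (E : RInt (fun x => Cmod (f x) ^ 2 + ((- 2 * m) * Cmod (f x) + m ^ 2)) 0 1
   = N2 f - m ^ 2).
{ rewrite RInt01_plus, RInt01_plus, RInt01_scal, RInt01_const; auto.
  - unfold N2; fold m; match goal with |- @eq _ ?a ?b => change (@eq R a b) end; ring.
  - apply rcont_mult; auto; apply rcont_const.
  - apply rcont_const.
  - now apply rcont_Cmod2.
  - apply rcont_plus; [|apply rcont_const].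
    apply rcont_mult; auto; apply rcont_const. }
cut (0 <= N2 f - m ^ 2); [fold m; lra|].
rewrite <- E; apply RInt01_ge_0.
- apply rcont_plus; [now apply rcont_Cmod2|].
  apply rcont_plus; [|apply rcont_const].
  apply rcont_mult; auto; apply rcont_const.
- intros x _; generalize (pow2_ge_0 (Cmod (f x) - m)); lra.
Qed.

(** The integral of |g| over [0,x] is enlarged to [0,1] before Cauchy-Schwarz, which makes the bound
    uniform in [x]. It serves both for [Kop] and for u_2 as a primitive of u_2'. *)
Lemma CInt_bound (f g : R -> C) : (forall x, ccont f x) -> (forall x, ccont g x) ->
  (forall x, I01 x -> Cmod (f x) <= Cmod (g x)) ->
  forall x, I01 x -> Cmod (CInt f 0 x) ^ 2 <= N2 g.
Proof.
intros Hf Hg L x Hx.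
destruct (RInt01_Cmod_sq g Hg) as [Cg B].
eapply Rle_trans; [|exact B].
apply pow_incr; split; [apply Cmod_ge_0|].
apply Rle_trans with (RInt (fun t => Cmod (g t)) 0 x).
- rewrite Cmod_norm.
  apply (norm_RInt_le (V := C_R_NormedModule) f (fun t => Cmod (g t)) 0 x).
  + apply Hx.
  + intros t Ht; rewrite <- Cmod_norm; apply L; unfold I01 in *; lra.
  + now apply is_CInt_cont.
  + apply (RInt_correct (V := R_CompleteNormedModule)); now apply ex_RInt_rcont.
- rewrite <- (RInt_Chasles (V := R_CompleteNormedModule) _ 0 x 1)
    by now apply ex_RInt_rcont.
  rewrite <- (Rplus_0_r (RInt _ 0 x)) at 1.
  apply Rplus_le_compat_l, RInt_ge_0; [apply Hx|now apply ex_RInt_rcont|].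
  intros; apply Cmod_ge_0.
Qed.

Lemma N2_le_const f M : (forall x, ccont f x) ->
  (forall x, I01 x -> Cmod (f x) ^ 2 <= M) -> N2 f <= M.
Proof.
intros Hf H; rewrite <- (RInt01_const M); apply RInt01_le.
- now apply rcont_Cmod2.
- apply rcont_const.
- intros x Hx; apply H; unfold I01; lra.
Qed.

Lemma ccont_id_mult h x : ccont h x -> ccont (fun s => (RtoC s * h s)%C) x.
Proof. intros H; apply ccont_mult; auto; apply ccont_RtoC, continuous_id. Qed.

Lemma Kop_cdiff h : (forall x, ccont h x) ->
  forall x, cdiff (Kop h) x (RtoC x * h x)%C.
Proof.
intros H x; apply (cdiff_CInt (fun s => (RtoC s * h s)%C)).
intros y; now apply ccont_id_mult.
Qed.

Lemma Kop_cont h : (forall x, ccont h x) -> forall x, ccont (Kop h) x.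
Proof. intros H x; eapply cdiff_cont; now apply Kop_cdiff. Qed.

Lemma Kop_0 h : Kop h 0 = RtoC 0.
Proof. exact (RInt_point (V := C_R_CompleteNormedModule) 0 _). Qed.

Lemma Kop_ext f h : (forall x, I01 x -> f x = h x) ->
  forall x, I01 x -> Kop f x = Kop h x.
Proof.
intros E x Hx; apply (RInt_ext (V := C_R_CompleteNormedModule)).
unfold I01 in Hx; intros y; rewrite Rmin_left, Rmax_right by lra; intros Hy.
rewrite E; auto; unfold I01; lra.
Qed.

Lemma Kop_bound h : (forall x, ccont h x) ->
  forall x, I01 x -> Cmod (Kop h x) ^ 2 <= N2 h.
Proof.
intros H x Hx; apply (CInt_bound (fun s => (RtoC s * h s)%C) h); auto.
- intros y; now apply ccont_id_mult.
- intros y Hy; rewrite Cmod_mult, Cmod_R, Rabs_pos_eq by apply Hy.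
  unfold I01 in Hy; generalize (Cmod_ge_0 (h y)); nra.
Qed.

Lemma cdiff_unique_zero (f g f' : R -> C) :
  (forall x, cdiff f x (f' x)) -> (forall x, cdiff g x (f' x)) -> f 0 = g 0 ->
  forall x, I01 x -> f x = g x.
Proof.
intros Df Dg E x Hx.
pose (d := fun y => (f y - g y)%C).
assert (Z : d x = d 0).
{ apply is_derive01_zero; auto; intros y Hy.
  replace (RtoC 0) with (f' y - f' y)%C by ring.
  apply is_derive01_minus; auto.
  - now apply is_derive01_of_cdiff with f.
  - now apply is_derive01_of_cdiff with g. }
unfold d in Z; rewrite E in Z.
replace (f x) with (f x - g x + g x)%C by ring; rewrite Z; ring.
Qed.

Lemma primitive_bound (h b : R -> C) : (forall x, cdiff h x (b x)) -> h 0 = RtoC 0 ->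
  (forall x, ccont b x) -> forall x, I01 x -> Cmod (h x) ^ 2 <= N2 b.
Proof.
intros D H0 Cb x Hx.
rewrite (cdiff_unique_zero h (fun y => CInt b 0 y) b); auto.
- apply CInt_bound; auto; intros; lra.
- intros y; now apply cdiff_CInt.
- rewrite H0; symmetry; exact (RInt_point (V := C_R_CompleteNormedModule) 0 _).
Qed.

(** Hypothesis and conclusion both live on (0,1], so the lemma can be applied twice to reach
    [Dop (Dop f)]. *)
Lemma Dop_eq f g p : (forall x, 0 < x <= 1 -> f x = g x) ->
  (forall x, 0 < x -> cdiff g x (RtoC x * p x)%C) ->
  forall x, 0 < x <= 1 -> Dop f x = p x.
Proof.
intros E D x Hx; unfold Dop.
rewrite (Derive01_of_cdiff_pos f g x (RtoC x * p x)); auto; [|apply D; lra].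
rewrite Cmult_assoc, Cinv_l; [ring|].
intros H; apply (f_equal fst) in H; simpl in H; lra.
Qed.

Lemma profile_Dop u g p a h b : profile u g p a h b ->
  forall x, 0 < x <= 1 -> Dop (fst u) x = p x.
Proof.
intros P; apply Dop_eq with g; [|apply P].
intros x Hx; apply P; unfold I01; lra.
Qed.

Lemma profile_Dop2 u g p a h b : profile u g p a h b ->
  forall x, 0 < x <= 1 -> Dop (Dop (fst u)) x = a x.
Proof.
intros P; apply Dop_eq with p; [|apply P]; now apply profile_Dop with g a h b.
Qed.

Lemma profile_Derive01 u g p a h b : profile u g p a h b ->
  forall x, 0 < x <= 1 -> Derive01 (fst u) x = (RtoC x * p x)%C.
Proof.
intros P x Hx; apply Derive01_of_cdiff_pos with g; auto.
- intros y Hy; apply P; unfold I01; lra.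
- apply P; lra.
Qed.

Lemma profile_Derive01_snd u g p a h b : profile u g p a h b ->
  forall x, I01 x -> Derive01 (snd u) x = b x.
Proof. intros P x Hx; apply Derive01_of_cdiff with h; auto; apply P. Qed.

Lemma inner_profile u g p a h b v g' p' a' h' b' :
  profile u g p a h b -> profile v g' p' a' h' b' ->
  tildeH_inner u v =
  (CInt (fun x => a x * Cconj (a' x)) 0 1 + CInt (fun x => b x * Cconj (b' x)) 0 1)%C.
Proof.
intros P Q; unfold tildeH_inner; f_equal;
  apply (RInt_ext (V := C_R_CompleteNormedModule));
  intros x; rewrite Rmin_left, Rmax_right by lra; intros Hx.
- rewrite (profile_Dop2 _ _ _ _ _ _ P), (profile_Dop2 _ _ _ _ _ _ Q) by lra; auto.
- rewrite (profile_Derive01_snd _ _ _ _ _ _ P), (profile_Derive01_snd _ _ _ _ _ _ Q)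
    by (unfold I01; lra); auto.
Qed.

Lemma Re_CInt (f : R -> C) : (forall x, ccont f x) ->
  Re (CInt f 0 1) = RInt (fun x => Re (f x)) 0 1.
Proof.
intros H; symmetry; apply (is_RInt_unique (V := R_CompleteNormedModule)).
apply (is_RInt_fct_extend_fst (U := R_NormedModule) (V := R_NormedModule) f).
now apply is_CInt_cont.
Qed.

Lemma Re_inner_profile u g p a h b v g' p' a' h' b' :
  profile u g p a h b -> profile v g' p' a' h' b' ->
  Re (tildeH_inner u v) =
  RInt (fun x => Re (a x * Cconj (a' x)) + Re (b x * Cconj (b' x))) 0 1.
Proof.
intros P Q; rewrite (inner_profile _ _ _ _ _ _ _ _ _ _ _ _ P Q).
assert (C1 : forall x, ccont (fun x => a x * Cconj (a' x))%C x).
{ intros x; apply ccont_mult; [exact (pf_a _ _ _ _ _ _ P x)|].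
  apply ccont_conj; exact (pf_a _ _ _ _ _ _ Q x). }
assert (C2 : forall x, ccont (fun x => b x * Cconj (b' x))%C x).
{ intros x; apply ccont_mult; [exact (pf_b _ _ _ _ _ _ P x)|].
  apply ccont_conj; exact (pf_b _ _ _ _ _ _ Q x). }
rewrite RInt01_plus.
- now rewrite <- !Re_CInt.
- intros x; exact (ccont_fst _ x (C1 x)).
- intros x; exact (ccont_fst _ x (C2 x)).
Qed.

Lemma norm2_profile u g p a h b : profile u g p a h b ->
  Re (tildeH_inner u u) = N2 a + N2 b.
Proof.
intros P; rewrite (Re_inner_profile _ _ _ _ _ _ _ _ _ _ _ _ P P).
unfold N2; rewrite <- RInt01_plus.
- apply RInt01_ext; intros x _; rewrite !Cmod2_eq; simpl; ring.
- apply rcont_Cmod2, P.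
- apply rcont_Cmod2, P.
Qed.

(** The condition that [induced] puts on a continuous extension: no claim is made at 0, where [Dop]
    is junk. *)
Definition agree (w v : cfun2) : Prop :=
  forall rho, 0 < rho <= 1 -> fst w rho = fst v rho /\ snd w rho = snd v rho.

Lemma cdiff_id x : cdiff RtoC x (RtoC 1).
Proof. apply (cdiff_RtoC (fun y => y)); apply (is_derive_id (K := R_AbsRing)). Qed.

Ltac cring := apply C_eq; simpl; ring.

Lemma profile_h_cont u g p a h b : profile u g p a h b -> forall x, ccont h x.
Proof. intros P x; exact (cdiff_cont _ _ _ (pf_dh _ _ _ _ _ _ P x)). Qed.

(* In the unknowns [(D^2 u_1, u_2')] the operator is local: the contributions of
   [rho^2 u_2] and [-3 K u_2] to [D^2] of the first row add up to [u_2'']. *)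
Lemma tildeL0_profile u g p a h b a' b' w g2 p2 c k d :
  profile u g p a h b -> (forall x, 0 < x -> cdiff a x (a' x)) ->
  (forall x, cdiff b x (b' x)) -> profile w g2 p2 c k d -> agree w (tildeL0 u) ->
  forall x, 0 < x <= 1 ->
    c x = (- (RtoC x * a' x) - RtoC 2 * a x + b' x)%C /\
    d x = (a' x - RtoC x * b' x - RtoC 2 * b x)%C /\
    k x = (a x - RtoC x * b x - h x)%C.
Proof.
intros P Da Db Q E.
pose proof (pf_dg _ _ _ _ _ _ P) as Dg; pose proof (pf_dp _ _ _ _ _ _ P) as Dp.
pose proof (pf_dh _ _ _ _ _ _ P) as Dh; pose proof (pf_h _ _ _ _ _ _ P) as Eh.
assert (Ch : forall y, ccont h y) by now apply profile_h_cont with u g p a b.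
assert (S : forall x, 0 < x <= 1 -> snd w x = (a x + (- (RtoC x * b x) + - h x))%C).
{ intros x Hx; rewrite (proj2 (E x Hx)); simpl.
  rewrite (profile_Dop2 _ _ _ _ _ _ P) by auto.
  rewrite (profile_Derive01_snd _ _ _ _ _ _ P) by (unfold I01; lra).
  rewrite (pf_h _ _ _ _ _ _ P) by (unfold I01; lra); ring. }
intros x Hx; split; [|split].
- rewrite <- (profile_Dop2 _ _ _ _ _ _ Q x Hx).
  apply (Dop_eq (Dop (fst w))
    (fun y => (RtoC (- y ^ 2) * a y + (RtoC (-1) * h y + RtoC y * b y))%C)
    (fun y => (- (RtoC y * a' y) - RtoC 2 * a y + b' y)%C)); auto.
  (* In the first application of [D], the term -2p from the factor rho^2 of p cancels 2p from 2 u_1,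
     and 2h from rho^2 u_2 combines with -3h from the [K] term to -h. *)
  + apply (Dop_eq (fst w) (fun y => (RtoC (- y ^ 2) * p y +
      (RtoC 2 * g y + (RtoC (y ^ 2) * h y + RtoC (-3) * Kop h y)))%C)
      (fun y => (RtoC (- y ^ 2) * a y + (RtoC (-1) * h y + RtoC y * b y))%C)); auto.
    * intros y Hy; rewrite (proj1 (E y Hy)); simpl.
      rewrite (profile_Derive01 _ _ _ _ _ _ P) by auto.
      rewrite (pf_g _ _ _ _ _ _ P), (pf_h _ _ _ _ _ _ P) by (unfold I01; lra).
      rewrite (Kop_ext (snd u) h) by (auto; unfold I01; lra).
      cring.
    * intros y Hy; eapply cdiff_eq.
      -- apply cdiff_plus; [apply cdiff_mult; [apply cdiff_RtoC; auto_derive; auto|now apply Dp]|].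
         apply cdiff_plus; [apply cdiff_scal; now apply Dg|].
         apply cdiff_plus; [apply cdiff_mult; [apply cdiff_RtoC; auto_derive; auto|apply Dh]|].
         apply cdiff_scal; now apply Kop_cdiff.
      -- cring.
  (* In the second application of [D], the -b from -h cancels the b produced by the factor y in y b,
     and only b' remains of u_2. *)
  + intros y Hy; eapply cdiff_eq.
    * apply cdiff_plus; [apply cdiff_mult; [apply cdiff_RtoC; auto_derive; auto|now apply Da]|].
      apply cdiff_plus; [apply cdiff_scal, Dh|apply cdiff_mult; [apply cdiff_id|apply Db]].
    * cring.
- rewrite <- (profile_Derive01_snd _ _ _ _ _ _ Q) by (unfold I01; lra).
  apply Derive01_of_cdiff_pos with
    (fun y => (a y + (RtoC (- y) * b y + RtoC (-1) * h y))%C); auto.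
  + intros y Hy; rewrite S by auto; cring.
  + eapply cdiff_eq.
    * apply cdiff_plus; [apply Da; lra|].
      apply cdiff_plus; [apply cdiff_mult; [apply cdiff_RtoC; auto_derive; auto|apply Db]|].
      apply cdiff_scal, Dh.
    * cring.
- rewrite <- (pf_h _ _ _ _ _ _ Q) by (unfold I01; lra); rewrite S by auto; ring.
Qed.

(** * The energy identity and the weak norm *)

Lemma is_derive_eq (f : R -> R) x (l l' : R) : is_derive f x l -> l = l' -> is_derive f x l'.
Proof. now intros H <-. Qed.

(** In components, the function is -(y/2) (|a|^2 + |b|^2) + Re (a conj(b)). With W(y) = a + b and
    W(-y) = b - a, it is half the difference between the values of (1 - x) |W|^2 / 2 at y and at
    -y. *)
Lemma energy_derive (a1 a2 b1 b2 : R -> R) (x l1 l2 m1 m2 : R) :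
  is_derive a1 x l1 -> is_derive a2 x l2 -> is_derive b1 x m1 -> is_derive b2 x m2 ->
  is_derive (fun y => - (y / 2) * (a1 y * a1 y + a2 y * a2 y +
     (b1 y * b1 y + b2 y * b2 y)) + (a1 y * b1 y + a2 y * b2 y)) x
   (- (1 / 2) * (a1 x * a1 x + a2 x * a2 x + (b1 x * b1 x + b2 x * b2 x))
    - x * (a1 x * l1 + a2 x * l2 + b1 x * m1 + b2 x * m2)
    + (l1 * b1 x + a1 x * m1 + (l2 * b2 x + a2 x * m2))).
Proof.
intros A1 A2 B1 B2; auto_derive.
- repeat split; eexists; eassumption.
- change (fun x => a1 x) with a1; change (fun x => a2 x) with a2.
  change (fun x => b1 x) with b1; change (fun x => b2 x) with b2.
  rewrite (is_derive_unique _ _ _ A1), (is_derive_unique _ _ _ A2),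
      (is_derive_unique _ _ _ B1), (is_derive_unique _ _ _ B2); field.
Qed.

(** After adding 3/2 of the squared norm, the integrand is an exact derivative [F']. The value [F 1]
    is -|a(1) - b(1)|^2 / 2, and [F 0] vanishes because [a 0 = 0]. *)
Lemma dissipative u w : dom_tildeL0 u -> tildeH w -> agree w (tildeL0 u) ->
  Re (tildeH_inner w u) <= - (3 / 2) * Re (tildeH_inner u u).
Proof.
intros Du Hw E.
destruct (dom_profile u Du) as [g [p [a [h [b [a' [b' [P [A0 [Da Db]]]]]]]]]].
destruct (tildeH_profile w Hw) as [g2 [p2 [c [k [d Q]]]]].
pose proof (tildeL0_profile _ _ _ _ _ _ _ _ _ _ _ _ _ _ P Da Db Q E) as K.
rewrite (Re_inner_profile _ _ _ _ _ _ _ _ _ _ _ _ Q P).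
rewrite (norm2_profile _ _ _ _ _ _ P); unfold N2.
pose proof (pf_a _ _ _ _ _ _ P) as Ca; pose proof (pf_b _ _ _ _ _ _ P) as Cb.
pose proof (pf_a _ _ _ _ _ _ Q) as Cc; pose proof (pf_b _ _ _ _ _ _ Q) as Cd.
assert (C1 : rcont (fun x => Re (c x * Cconj (a x)) + Re (d x * Cconj (b x)))).
{ apply rcont_plus; apply rcont_fst; intros x; apply ccont_mult; auto;
    now apply ccont_conj. }
assert (C2 : rcont (fun x => 3 / 2 * (Cmod (a x) ^ 2 + Cmod (b x) ^ 2))).
{ apply rcont_mult; [apply rcont_const|].
  apply rcont_plus; now apply rcont_Cmod2. }
rewrite <- RInt01_plus by now apply rcont_Cmod2.
cut (RInt (fun x => (Re (c x * Cconj (a x)) + Re (d x * Cconj (b x))) +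
     3 / 2 * (Cmod (a x) ^ 2 + Cmod (b x) ^ 2)) 0 1 <= 0).
{ rewrite RInt01_plus, RInt01_scal; auto; [lra|].
  apply rcont_plus; now apply rcont_Cmod2. }
pose (F := fun x => - (x / 2) * (fst (a x) * fst (a x) + snd (a x) * snd (a x) +
   (fst (b x) * fst (b x) + snd (b x) * snd (b x))) +
   (fst (a x) * fst (b x) + snd (a x) * snd (b x))).
assert (CF : rcont F).
{ assert (rcont (fun x => fst (a x)) /\ rcont (fun x => snd (a x)) /\
    rcont (fun x => fst (b x)) /\ rcont (fun x => snd (b x))) as [? [? [? ?]]].
  { repeat split; try (now apply rcont_fst); now apply rcont_snd. }
  apply rcont_plus; [apply rcont_mult|].
  - intros x; apply (ex_derive_continuous (V := R_NormedModule)).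
    auto_derive; auto.
  - apply rcont_plus; apply rcont_plus; now apply rcont_mult.
  - apply rcont_plus; now apply rcont_mult. }
rewrite (RInt01_derive F); auto.
- unfold F; rewrite A0; simpl.
  generalize (pow2_ge_0 (fst (a 1) - fst (b 1))) (pow2_ge_0 (snd (a 1) - snd (b 1))).
  simpl; lra.
- now apply rcont_plus.
- intros x Hx.
  destruct (K x ltac:(lra)) as [Kc [Kd _]]; rewrite Kc, Kd, !Cmod2_eq; simpl.
  pose proof (cdiff_fst _ _ _ (Da x ltac:(lra))) as A1.
  pose proof (cdiff_snd _ _ _ (Da x ltac:(lra))) as A2.
  pose proof (cdiff_fst _ _ _ (Db x)) as B1.
  pose proof (cdiff_snd _ _ _ (Db x)) as B2.
  eapply is_derive_eq; [exact (energy_derive _ _ _ _ _ _ _ _ _ A1 A2 B1 B2)|].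
  simpl; field.
Qed.

Lemma profile_add u g p a h b v g' p' a' h' b' :
  profile u g p a h b -> profile v g' p' a' h' b' ->
  profile (add2 u v) (fun x => g x + g' x)%C (fun x => p x + p' x)%C
    (fun x => a x + a' x)%C (fun x => h x + h' x)%C (fun x => b x + b' x)%C.
Proof.
intros P Q; split.
- intros x Hx; simpl; now rewrite (pf_g _ _ _ _ _ _ P), (pf_g _ _ _ _ _ _ Q).
- intros x Hx; eapply cdiff_eq; [apply cdiff_plus;
    [exact (pf_dg _ _ _ _ _ _ P x Hx)|exact (pf_dg _ _ _ _ _ _ Q x Hx)]|ring].
- intros x Hx; eapply cdiff_eq; [apply cdiff_plus;
    [exact (pf_dp _ _ _ _ _ _ P x Hx)|exact (pf_dp _ _ _ _ _ _ Q x Hx)]|ring].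
- intros x; apply ccont_plus; [exact (pf_a _ _ _ _ _ _ P x)|exact (pf_a _ _ _ _ _ _ Q x)].
- intros x Hx; simpl; now rewrite (pf_h _ _ _ _ _ _ P), (pf_h _ _ _ _ _ _ Q).
- intros x; apply cdiff_plus; [exact (pf_dh _ _ _ _ _ _ P x)|exact (pf_dh _ _ _ _ _ _ Q x)].
- rewrite (pf_h0 _ _ _ _ _ _ P), (pf_h0 _ _ _ _ _ _ Q); ring.
- intros x; apply ccont_plus; [exact (pf_b _ _ _ _ _ _ P x)|exact (pf_b _ _ _ _ _ _ Q x)].
Qed.

Lemma profile_scal s u g p a h b : profile u g p a h b ->
  profile (scal2 s u) (fun x => s * g x)%C (fun x => s * p x)%C
    (fun x => s * a x)%C (fun x => s * h x)%C (fun x => s * b x)%C.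
Proof.
intros P; split.
- intros x Hx; simpl; now rewrite (pf_g _ _ _ _ _ _ P).
- intros x Hx; eapply cdiff_eq;
    [apply cdiff_scal; exact (pf_dg _ _ _ _ _ _ P x Hx)|ring].
- intros x Hx; eapply cdiff_eq;
    [apply cdiff_scal; exact (pf_dp _ _ _ _ _ _ P x Hx)|ring].
- intros x; apply ccont_mult; [apply ccont_const|exact (pf_a _ _ _ _ _ _ P x)].
- intros x Hx; simpl; now rewrite (pf_h _ _ _ _ _ _ P).
- intros x; apply cdiff_scal; exact (pf_dh _ _ _ _ _ _ P x).
- rewrite (pf_h0 _ _ _ _ _ _ P); ring.
- intros x; apply ccont_mult; [apply ccont_const|exact (pf_b _ _ _ _ _ _ P x)].
Qed.

Definition sq2 (u : cfun2) : R := Re (tildeH_inner u u).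
(* The square of a norm weaker than that of [H]: it controls [L' u], and the second
   row of [(lam - L_0) u = f] gives it a factor [1 / |lam|^2]. *)
Definition m2 (u : cfun2) : R := N2 (snd u).

Lemma m2_profile u g p a h b : profile u g p a h b -> m2 u = N2 h.
Proof. intros P; apply N2_ext; intros x Hx; apply (pf_h _ _ _ _ _ _ P); unfold I01; lra. Qed.

Lemma m2_ge_0 u : tildeH u -> 0 <= m2 u.
Proof.
intros Hu; destruct (tildeH_profile u Hu) as [g [p [a [h [b P]]]]].
rewrite (m2_profile _ _ _ _ _ _ P); apply N2_ge_0.
now apply profile_h_cont with u g p a b.
Qed.

Lemma profile_m2_le u g p a h b : profile u g p a h b -> N2 h <= N2 b.
Proof.
intros P; apply N2_le_const; [now apply profile_h_cont with u g p a b|].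
apply primitive_bound; [exact (pf_dh _ _ _ _ _ _ P)|exact (pf_h0 _ _ _ _ _ _ P)|
  exact (pf_b _ _ _ _ _ _ P)].
Qed.

(** A Poincare inequality: u_2 vanishes at 0, so its values are bounded by the L^2 norm of u_2'. *)
Lemma m2_le_sq2 u : tildeH u -> m2 u <= sq2 u.
Proof.
intros Hu; destruct (tildeH_profile u Hu) as [g [p [a [h [b P]]]]].
rewrite (m2_profile _ _ _ _ _ _ P); unfold sq2; rewrite (norm2_profile _ _ _ _ _ _ P).
generalize (profile_m2_le _ _ _ _ _ _ P) (N2_ge_0 a (pf_a _ _ _ _ _ _ P)); lra.
Qed.

Lemma Cmod2_plus z w : Cmod (z + w) ^ 2 <= 2 * Cmod z ^ 2 + 2 * Cmod w ^ 2.
Proof.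
rewrite !Cmod2_eq; simpl.
generalize (pow2_ge_0 (fst z - fst w)) (pow2_ge_0 (snd z - snd w)); simpl; lra.
Qed.

Lemma N2_plus (f g : R -> C) : (forall x, ccont f x) -> (forall x, ccont g x) ->
  N2 (fun x => f x + g x)%C <= 2 * N2 f + 2 * N2 g.
Proof.
intros Hf Hg; unfold N2.
assert (rcont (fun x => Cmod (f x) ^ 2) /\ rcont (fun x => Cmod (g x) ^ 2)) as [? ?].
{ split; now apply rcont_Cmod2. }
rewrite <- !RInt01_scal, <- RInt01_plus; auto;
  try (apply rcont_mult; auto; apply rcont_const).
apply RInt01_le.
- apply rcont_Cmod2; intros; now apply ccont_plus.
- apply rcont_plus; apply rcont_mult; auto; apply rcont_const.
- intros; apply Cmod2_plus.
Qed.

Lemma N2_scal c (f : R -> C) : (forall x, ccont f x) ->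
  N2 (fun x => c * f x)%C = Cmod c ^ 2 * N2 f.
Proof.
intros Hf; unfold N2; rewrite <- RInt01_scal by now apply rcont_Cmod2.
apply RInt01_ext; intros x _; rewrite Cmod_mult; ring.
Qed.

Definition sub2 (u v : cfun2) : cfun2 := add2 u (scal2 (RtoC (-1)) v).

Lemma m2_add u v : tildeH u -> tildeH v -> m2 (add2 u v) <= 2 * m2 u + 2 * m2 v.
Proof.
intros Hu Hv.
destruct (tildeH_profile u Hu) as [g [p [a [h [b P]]]]].
destruct (tildeH_profile v Hv) as [g' [p' [a' [h' [b' Q]]]]].
rewrite (m2_profile _ _ _ _ _ _ P), (m2_profile _ _ _ _ _ _ Q).
rewrite (m2_profile _ _ _ _ _ _ (profile_add _ _ _ _ _ _ _ _ _ _ _ _ P Q)).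
apply N2_plus; [now apply profile_h_cont with u g p a b|
  now apply profile_h_cont with v g' p' a' b'].
Qed.

(** The second row writes lam u_2 as a sum of four terms, and two layers of [N2_plus] cost a factor
    4 on each. The term f_2 is bounded through f_2' because f_2(0) = 0. The constants 8 and 16 leave
    slack. *)
Lemma m2_resolvent lam u w : dom_tildeL0 u -> tildeH w -> agree w (tildeL0 u) ->
  Cmod lam ^ 2 * m2 u <= 8 * sq2 (sub2 (scal2 lam u) w) + 16 * sq2 u.
Proof.
intros Du Hw E.
destruct (dom_profile u Du) as [g [p [a [h [b [a' [b' [P [A0 [Da Db]]]]]]]]]].
destruct (tildeH_profile w Hw) as [g2 [p2 [c [k [d Q]]]]].
pose proof (tildeL0_profile _ _ _ _ _ _ _ _ _ _ _ _ _ _ P Da Db Q E) as K.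
pose proof (profile_add _ _ _ _ _ _ _ _ _ _ _ _ (profile_scal lam _ _ _ _ _ _ P)
   (profile_scal (RtoC (-1)) _ _ _ _ _ _ Q)) as S.
fold (sub2 (scal2 lam u) w) in S.
pose proof (norm2_profile _ _ _ _ _ _ S) as NS.
pose proof (norm2_profile _ _ _ _ _ _ P) as NP.
pose proof (profile_m2_le _ _ _ _ _ _ S) as MS.
pose proof (profile_m2_le _ _ _ _ _ _ P) as MP.
pose proof (N2_ge_0 _ (pf_a _ _ _ _ _ _ S)) as ZS.
pose proof (N2_ge_0 _ (pf_a _ _ _ _ _ _ P)) as ZP.
rewrite (m2_profile _ _ _ _ _ _ P); unfold sq2; rewrite NS, NP.
assert (Ch : forall x, ccont h x) by now apply profile_h_cont with u g p a b.
assert (Ck : forall x, ccont k x) by now apply profile_h_cont with w g2 p2 c d.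
pose proof (pf_a _ _ _ _ _ _ P) as Ca; pose proof (pf_b _ _ _ _ _ _ P) as Cb.
set (f := fun x => (lam * h x + RtoC (-1) * k x)%C) in *.
assert (Cf : forall x, ccont f x).
{ intros x; apply ccont_plus; apply ccont_mult; auto; apply ccont_const. }
set (xb := fun x => (RtoC (- x) * b x)%C).
assert (Cxb : forall x, ccont xb x).
{ intros x; apply ccont_mult; auto; apply ccont_RtoC.
  apply (continuous_opp (V := R_NormedModule)), continuous_id. }
assert (Cmh : forall x, ccont (fun x => RtoC (-1) * h x)%C x).
{ intros x; apply ccont_mult; auto; apply ccont_const. }
rewrite <- N2_scal by auto.
rewrite (N2_ext (fun x => lam * h x)%C
  (fun x => (f x + a x) + (xb x + RtoC (-1) * h x))%C).
2:{ intros x Hx; destruct (K x ltac:(lra)) as [_ [_ Kk]].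
    unfold f, xb; rewrite Kk; cring. }
assert (X1 := N2_plus f a Cf Ca).
assert (X2 := N2_plus xb (fun x => RtoC (-1) * h x)%C Cxb Cmh).
assert (X3 := N2_plus (fun x => f x + a x)%C (fun x => xb x + RtoC (-1) * h x)%C (fun x => ccont_plus _ _ x (Cf x) (Ca x))
  (fun x => ccont_plus _ _ x (Cxb x) (Cmh x))).
pose proof (N2_scal (RtoC (-1)) h Ch) as X5.
rewrite Cmod_R, Rabs_left in X5 by lra.
assert (X4 : N2 xb <= N2 b).
{ apply RInt01_le; try now apply rcont_Cmod2.
  intros x Hx; unfold xb; rewrite Cmod_mult, Cmod_R, Rabs_Ropp, Rabs_pos_eq by lra.
  rewrite Rpow_mult_distr; apply Rle_trans with (1 * Cmod (b x) ^ 2); [|lra].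
  apply Rmult_le_compat_r; [apply pow2_ge_0|simpl; nra]. }
cbv beta in *; fold f in MS, ZS.
replace ((- (-1)) ^ 2) with 1 in X5 by ring.
generalize (N2_ge_0 f Cf) (N2_ge_0 b Cb); lra.
Qed.

(* [V1 = D V] and [V2 = D^2 V], where [V] is the potential. *)
Definition V1 (x : R) : R := - 288 * ((3 * x ^ 2 - 35) / (5 + 3 * x ^ 2) ^ 3).
Definition V2 (x : R) : R := - 576 * ((330 - 18 * x ^ 2) / (5 + 3 * x ^ 2) ^ 4).

(** * The potential, and the perturbation estimated by the weak norm *)

Lemma five_pos x : 0 < 5 + 3 * x ^ 2.
Proof. generalize (pow2_ge_0 x); lra. Qed.

Lemma potential_derive x : is_derive potential x (x * V1 x).
Proof.
generalize (five_pos x); intros H; unfold potential, V1; auto_derive.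
- simpl in *; apply Rgt_not_eq; nra.
- field; simpl in *; nra.
Qed.

Lemma V1_derive x : is_derive V1 x (x * V2 x).
Proof.
generalize (five_pos x); intros H; unfold V1, V2; auto_derive.
- apply (pow_nonzero (5 + 3 * x ^ 2) 3); lra.
- field; simpl in *; nra.
Qed.

Lemma V2_ex_derive x : ex_derive V2 x.
Proof.
generalize (five_pos x); intros H; unfold V2; auto_derive.
apply (pow_nonzero (5 + 3 * x ^ 2) 4); lra.
Qed.

Lemma div_pow_bound r q n M : 1 <= q -> Rabs r <= M -> Rabs (r / q ^ n) <= M.
Proof.
intros Hq Hr; unfold Rdiv; rewrite Rabs_mult.
assert (L : 1 <= q ^ n) by now apply pow_R1_Rle.
rewrite (Rabs_pos_eq (/ q ^ n)) by (left; apply Rinv_0_lt_compat; lra).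
assert (I : / q ^ n <= 1) by (rewrite <- Rinv_1; apply Rinv_le_contravar; lra).
generalize (Rabs_pos r); intros; apply Rle_trans with (Rabs r * 1); [|lra].
apply Rmult_le_compat_l; auto.
Qed.

(** The denominators are at least 1 and the numerators at most 5, 35 and 330, so the largest bound
    is 576 * 330 = 190080. *)
Lemma potential_bounds x : I01 x ->
  Rabs (potential x) <= 200000 /\ Rabs (V1 x) <= 200000 /\ Rabs (V2 x) <= 200000.
Proof.
intros [H0 H1].
assert (S : 0 <= x ^ 2 <= 1) by (simpl; nra).
unfold potential, V1, V2; rewrite !Rabs_mult.
rewrite (Rabs_left (-144)), (Rabs_left (-288)), (Rabs_left (-576)) by lra.
pose proof (div_pow_bound (5 - x ^ 2) (5 + 3 * x ^ 2) 2 5 ltac:(lra)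
  ltac:(apply Rabs_le; lra)).
pose proof (div_pow_bound (3 * x ^ 2 - 35) (5 + 3 * x ^ 2) 3 35 ltac:(lra)
  ltac:(apply Rabs_le; lra)).
pose proof (div_pow_bound (330 - 18 * x ^ 2) (5 + 3 * x ^ 2) 4 330 ltac:(lra)
  ltac:(apply Rabs_le; lra)).
lra.
Qed.

Lemma N2_scal_fun_le (r : R -> R) (f : R -> C) M : rcont r -> (forall x, ccont f x) ->
  (forall x, I01 x -> Rabs (r x) <= M) ->
  N2 (fun x => RtoC (r x) * f x)%C <= M ^ 2 * N2 f.
Proof.
intros Hr Hf H; unfold N2; rewrite <- RInt01_scal by now apply rcont_Cmod2.
apply RInt01_le.
- apply rcont_Cmod2; intros x; apply ccont_mult; auto; now apply ccont_RtoC.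
- apply rcont_mult; [apply rcont_const|now apply rcont_Cmod2].
- intros x Hx; rewrite Cmod_mult, Cmod_R, Rpow_mult_distr.
  apply Rmult_le_compat_r; [apply pow2_ge_0|].
  apply pow_incr; split; [apply Rabs_pos|]; apply H; unfold I01; lra.
Qed.

(** [D] is a derivation and inverts [K], so D^2 (V K^2 h) = V2 K^2 h + 2 V1 K h + V h. With every
    coefficient function below M = 200000, two uses of [N2_plus] give 2 M^2 + 4 (2 M)^2 + 4 M^2 = 22
    M^2. *)
Lemma tildeL'_bound u w : tildeH u -> tildeH w -> agree w (tildeL' u) ->
  sq2 w <= 22 * 200000 ^ 2 * m2 u.
Proof.
intros Hu Hw E.
destruct (tildeH_profile u Hu) as [g [p [a [h [b P]]]]].
destruct (tildeH_profile w Hw) as [g2 [p2 [c [k [d Q]]]]].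
unfold sq2; rewrite (norm2_profile _ _ _ _ _ _ Q), (m2_profile _ _ _ _ _ _ P).
assert (Ch : forall x, ccont h x) by now apply profile_h_cont with u g p a b.
assert (CK : forall x, ccont (Kop h) x) by now apply Kop_cont.
assert (CKK : forall x, ccont (Kop (Kop h)) x) by now apply Kop_cont.
assert (D0 : N2 d = 0).
{ rewrite (N2_ext d (fun _ => RtoC 0)).
  - unfold N2; rewrite Cmod_0; simpl; rewrite Rmult_0_l; apply RInt01_const.
  - intros x Hx.
    rewrite <- (profile_Derive01_snd _ _ _ _ _ _ Q) by (unfold I01; lra).
    apply Derive01_of_cdiff_pos with (fun _ => RtoC 0); [lra| |apply cdiff_const].
    intros y Hy; apply (proj2 (E y Hy)). }
assert (CC : forall x, 0 < x <= 1 -> c x =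
  (RtoC (- V2 x) * Kop (Kop h) x +
     (RtoC (- 2 * V1 x) * Kop h x + RtoC (- potential x) * h x))%C).
{ intros x Hx; rewrite <- (profile_Dop2 _ _ _ _ _ _ Q x Hx).
  assert (DV : forall y, cdiff (fun t => RtoC (- potential t)) y (RtoC (- (y * V1 y)))).
  { intros y; apply cdiff_RtoC.
    exact (is_derive_opp potential y _ (potential_derive y)). }
  assert (DV1 : forall y, cdiff (fun t => RtoC (- V1 t)) y (RtoC (- (y * V2 y)))).
  { intros y; apply cdiff_RtoC; exact (is_derive_opp V1 y _ (V1_derive y)). }
  apply (Dop_eq (Dop (fst w)) (fun y => (RtoC (- V1 y) * Kop (Kop h) y +
      RtoC (- potential y) * Kop h y)%C)
    (fun y => (RtoC (- V2 y) * Kop (Kop h) y +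
     (RtoC (- 2 * V1 y) * Kop h y + RtoC (- potential y) * h y))%C)); auto.
  - apply (Dop_eq (fst w) (fun y => (RtoC (- potential y) * Kop (Kop h) y)%C)
      (fun y => (RtoC (- V1 y) * Kop (Kop h) y + RtoC (- potential y) * Kop h y)%C)); auto.
    + intros y Hy; rewrite (proj1 (E y Hy)); simpl.
      rewrite (Kop_ext (Kop (snd u)) (Kop h)); [cring| |unfold I01; lra].
      apply Kop_ext; exact (pf_h _ _ _ _ _ _ P).
    + intros y _; eapply cdiff_eq;
        [apply cdiff_mult; [apply DV|now apply Kop_cdiff]|cring].
  - intros y _; eapply cdiff_eq.
    + apply cdiff_plus; apply cdiff_mult;
        [apply DV1|now apply Kop_cdiff|apply DV|now apply Kop_cdiff].
    + cring. }
rewrite (N2_ext c _ (fun x Hx => CC x ltac:(lra))), D0.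
assert (R0 : rcont (fun x => - potential x)).
{ intros x; apply (continuous_opp (V := R_NormedModule)).
  apply (ex_derive_continuous (V := R_NormedModule)).
  exists (x * V1 x); apply potential_derive. }
assert (R1 : rcont (fun x => - 2 * V1 x)).
{ apply rcont_mult; [apply rcont_const|]; intros x.
  apply (ex_derive_continuous (V := R_NormedModule)).
  exists (x * V2 x); apply V1_derive. }
assert (R2 : rcont (fun x => - V2 x)).
{ intros x; apply (continuous_opp (V := R_NormedModule)).
  apply (ex_derive_continuous (V := R_NormedModule)); apply V2_ex_derive. }
assert (Y : forall (r : R -> R) f, rcont r -> (forall x, ccont f x) ->
  forall x, ccont (fun x => RtoC (r x) * f x)%C x).
{ intros r f Hr Hf x; apply ccont_mult; auto; now apply ccont_RtoC. }
pose proof (Y _ _ R0 Ch) as Y0; pose proof (Y _ _ R1 CK) as Y1.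
pose proof (Y _ _ R2 CKK) as Y2.
assert (Z1 := N2_plus (fun x => RtoC (- V2 x) * Kop (Kop h) x)%C
  (fun x => RtoC (- 2 * V1 x) * Kop h x + RtoC (- potential x) * h x)%C Y2 (fun x => ccont_plus _ _ x (Y1 x) (Y0 x))).
assert (Z2 := N2_plus (fun x => RtoC (- 2 * V1 x) * Kop h x)%C
  (fun x => RtoC (- potential x) * h x)%C Y1 Y0).
assert (W0 : N2 (fun x => RtoC (- potential x) * h x)%C <= 200000 ^ 2 * N2 h).
{ apply N2_scal_fun_le; auto; intros; rewrite Rabs_Ropp; now apply potential_bounds. }
assert (W1 : N2 (fun x => RtoC (- 2 * V1 x) * Kop h x)%C <= (2 * 200000) ^ 2 * N2 (Kop h)).
{ apply N2_scal_fun_le; auto; intros x Hx.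
  rewrite Rabs_mult, (Rabs_left (- 2)) by lra.
  generalize (proj1 (proj2 (potential_bounds x Hx))); lra. }
assert (W2 : N2 (fun x => RtoC (- V2 x) * Kop (Kop h) x)%C <= 200000 ^ 2 * N2 (Kop (Kop h))).
{ apply N2_scal_fun_le; auto; intros; rewrite Rabs_Ropp; now apply potential_bounds. }
assert (K1 : N2 (Kop h) <= N2 h) by (apply N2_le_const; auto; now apply Kop_bound).
assert (K2 : N2 (Kop (Kop h)) <= N2 (Kop h)) by (apply N2_le_const; auto; now apply Kop_bound).
replace ((2 * 200000) ^ 2) with 160000000000 in W1 by ring.
replace (200000 ^ 2) with 40000000000 in * by ring.
lra.
Qed.

(** * Density of polynomials *)

Inductive poly : (R -> C) -> Prop :=
| poly_mono n : poly (fun t => RtoC (t ^ n))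
| poly_add p q : poly p -> poly q -> poly (fun t => p t + q t)%C
| poly_scal c p : poly p -> poly (fun t => c * p t)%C
| poly_ext p q : (forall t, p t = q t) -> poly p -> poly q.

Lemma poly_mul_t p : poly p -> poly (fun t => RtoC t * p t)%C.
Proof.
induction 1 as [n|p q _ IHp _ IHq|c p _ IH|p q E _ IH].
- apply poly_ext with (fun t => RtoC (t ^ S n)); [|apply poly_mono].
  intros t; rewrite <- RtoC_mult; reflexivity.
- apply poly_ext with (fun t => RtoC t * p t + RtoC t * q t)%C; [intros; ring|].
  now apply poly_add.
- apply poly_ext with (fun t => c * (RtoC t * p t))%C; [intros; ring|].
  now apply poly_scal.
- apply poly_ext with (fun t => RtoC t * p t)%C; auto; intros; now rewrite E.
Qed.

(* The Bernstein polynomial [sum_k binom(n,k) t^k (1-t)^(n-k) g k], computed by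
   conditioning on the first of [n] Bernoulli trials. *)
Fixpoint bern (n : nat) (g : nat -> C) (t : R) : C :=
  match n with
  | O => g O
  | S m => (RtoC (1 - t) * bern m g t + RtoC t * bern m (fun k => g (S k)) t)%C
  end.

Fixpoint bernR (n : nat) (g : nat -> R) (t : R) : R :=
  match n with
  | O => g O
  | S m => (1 - t) * bernR m g t + t * bernR m (fun k => g (S k)) t
  end.

Lemma poly_bern n g : poly (bern n g).
Proof.
revert g; induction n as [|n IH]; intros g; simpl.
- apply poly_ext with (fun t => g O * RtoC (t ^ 0))%C; [intros; simpl; ring|].
  apply poly_scal, poly_mono.
- apply poly_ext with (fun t => (bern n g t + RtoC (-1) * (RtoC t * bern n g t)) +
    RtoC t * bern n (fun k => g (S k)) t)%C.
  { intros t; apply C_eq; simpl; ring. }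
  apply poly_add; [|now apply poly_mul_t].
  apply poly_add; auto; now apply poly_scal, poly_mul_t.
Qed.

(** For t in [0,1] the Bernstein polynomial is a convex combination of the [g k]. *)
Lemma bern_dist n g c t : I01 t ->
  Cmod (bern n g t - c) <= bernR n (fun k => Cmod (g k - c)) t.
Proof.
intros [H0 H1]; revert g; induction n as [|n IH]; intros g; simpl; [lra|].
replace (RtoC (1 - t) * bern n g t + RtoC t * bern n (fun k => g (S k)) t - c)%C
  with (RtoC (1 - t) * (bern n g t - c) +
     RtoC t * (bern n (fun k => g (S k)) t - c))%C by (apply C_eq; simpl; ring).
eapply Rle_trans; [apply Cmod_triangle|].
rewrite !Cmod_mult, !Cmod_R, !Rabs_pos_eq by lra.
apply Rplus_le_compat; apply Rmult_le_compat_l; try lra; apply IH.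
Qed.

Lemma bernR_le n g h t : I01 t -> (forall k, (k <= n)%nat -> g k <= h k) ->
  bernR n g t <= bernR n h t.
Proof.
intros [H0 H1]; revert g h; induction n as [|n IH]; intros g h L; simpl.
- apply L; lia.
- apply Rplus_le_compat; apply Rmult_le_compat_l; try lra; apply IH;
    intros k Hk; apply L; lia.
Qed.

(** Mean and variance of the binomial law: k has mean n t and variance n t (1 - t). The centre [c]
    is left free because conditioning on a success replaces it by [c - 1]. *)
Lemma bernR_affine_sq n A B c t :
  bernR n (fun k => A + B * (INR k - c) ^ 2) t =
  A + B * ((INR n * t - c) ^ 2 + INR n * t * (1 - t)).
Proof.
revert c; induction n as [|n IH]; intros c; [simpl; ring|].
change (bernR (S n) (fun k => A + B * (INR k - c) ^ 2) t) with
 ((1 - t) * bernR n (fun k => A + B * (INR k - c) ^ 2) t +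
  t * bernR n (fun k => A + B * (INR (S k) - c) ^ 2) t).
assert (E : bernR n (fun k => A + B * (INR (S k) - c) ^ 2) t =
  bernR n (fun k => A + B * (INR k - (c - 1)) ^ 2) t).
{ clear IH; set (g := fun k => A + B * (INR (S k) - c) ^ 2).
  set (h := fun k => A + B * (INR k - (c - 1)) ^ 2).
  assert (G : forall k, g k = h k) by (intros k; unfold g, h; rewrite S_INR; ring).
  clearbody g h; revert g h G; induction n as [|n IHn]; intros g h G; simpl; auto.
  rewrite (IHn g h), (IHn (fun k => g (S k)) (fun k => h (S k))); auto. }
rewrite E, !IH, S_INR; ring.
Qed.

Lemma Cmod_le_components z e : Rabs (fst z) <= e -> Rabs (snd z) <= e ->
  Cmod z <= 2 * e.
Proof.
intros H1 H2; replace z with (RtoC (fst z) + Ci * RtoC (snd z))%C by cring.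
eapply Rle_trans; [apply Cmod_triangle|].
rewrite Cmod_mult, !Cmod_R, Cmod_Ci; lra.
Qed.

Lemma uniform_continuity01 (f : R -> C) e : (forall x, ccont f x) -> 0 < e ->
  exists d, 0 < d /\ forall x y, I01 x -> I01 y -> Rabs (y - x) < d ->
    Cmod (f y - f x) <= e.
Proof.
intros Hf He.
assert (He2 : 0 < e / 2) by lra.
destruct (unifcont_1d (V := C_UniformSpace) f 0 1 (fun x _ => Hf x) (mkposreal _ He2))
  as [d Hd].
exists d; split; [apply cond_pos|]; intros x y Hx Hy Hxy.
destruct (Rle_dec (Cmod (f y - f x)) e) as [|Hn]; auto; exfalso.
apply (Hd x y Hx Hy Hxy); intros [B1 B2]; apply Hn.
replace e with (2 * (e / 2)) by field.
apply Cmod_le_components; left; [exact B1|exact B2].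
Qed.

Lemma bounded01 (f : R -> C) : (forall x, ccont f x) ->
  exists M, 0 <= M /\ forall x, I01 x -> Cmod (f x) <= M.
Proof.
intros Hf; destruct (RInt01_Cmod_sq f Hf) as [Hc _].
destruct (continuity_ab_maj (fun x => Cmod (f x)) 0 1 Rle_0_1) as [m [Hm _]].
- intros c _; apply continuity_pt_filterlim, Hc.
- exists (Cmod (f m)); split; [apply Cmod_ge_0|exact Hm].
Qed.

(** Chebyshev's argument: the oscillation of [f] between t and k/n is at most e/2 when they are
    closer than [d], and at most 2M ((k/n - t) / d)^2 otherwise. The variance bounds the mean of the
    second term by 2M / (d^2 n), below e/2 for the chosen [n]. *)
Lemma weierstrass01 (f : R -> C) e : (forall x, ccont f x) -> 0 < e ->
  exists q, poly q /\ forall t, I01 t -> Cmod (f t - q t) <= e.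
Proof.
intros Hf He.
destruct (uniform_continuity01 f (e / 2) Hf ltac:(lra)) as [d [Hd U]].
destruct (bounded01 f Hf) as [M [M0 HM]].
destruct (INR_unbounded (4 * M / (d ^ 2 * e))) as [n Hn].
assert (D2 : 0 < d ^ 2) by now apply pow_lt.
assert (Hn0 : 0 < INR n).
{ eapply Rle_lt_trans; [|exact Hn].
  apply Rmult_le_pos; [lra|left; apply Rinv_0_lt_compat; nra]. }
exists (bern n (fun k => f (INR k / INR n))); split; [apply poly_bern|].
intros t Ht.
set (G := fun k => f (INR k / INR n)).
replace (f t - bern n G t)%C with (- (bern n G t - f t))%C by ring.
rewrite Cmod_opp; eapply Rle_trans; [now apply bern_dist|].
eapply Rle_trans.
- apply (bernR_le n _ (fun k => e / 2 + (2 * M / (d ^ 2 * INR n ^ 2)) *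
     (INR k - INR n * t) ^ 2)); auto.
  intros k Hk; unfold G.
  assert (Ik : I01 (INR k / INR n)).
  { apply le_INR in Hk; generalize (pos_INR k); intros K0; split.
    - apply Rmult_le_pos; auto; left; now apply Rinv_0_lt_compat.
    - apply Rmult_le_reg_r with (INR n); auto; unfold Rdiv.
      rewrite Rmult_assoc, Rinv_l; lra. }
  replace (2 * M / (d ^ 2 * INR n ^ 2) * (INR k - INR n * t) ^ 2) with
    (2 * M * ((INR k / INR n - t) / d) ^ 2) by (field; lra).
  destruct (Rlt_dec (Rabs (INR k / INR n - t)) d) as [L|L].
  + specialize (U t _ Ht Ik L).
    generalize (Rmult_le_pos _ _ M0 (pow2_ge_0 ((INR k / INR n - t) / d))); lra.
  + assert (1 <= ((INR k / INR n - t) / d) ^ 2).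
    { rewrite <- (pow1 2), <- (pow2_abs ((INR k / INR n - t) / d)).
      apply pow_incr; split; [lra|]; unfold Rdiv at 1.
      rewrite Rabs_mult, Rabs_inv, (Rabs_pos_eq d) by lra.
      apply Rmult_le_reg_r with d; auto; rewrite Rmult_assoc, Rinv_l; lra. }
    unfold Cminus; eapply Rle_trans; [apply Cmod_triangle|]; rewrite Cmod_opp.
    generalize (HM _ Ik) (HM _ Ht); nra.
- rewrite bernR_affine_sq.
  replace (2 * M / (d ^ 2 * INR n ^ 2) * ((INR n * t - INR n * t) ^ 2 +
     INR n * t * (1 - t))) with (2 * M / (d ^ 2 * INR n) * (t * (1 - t)))
    by (field; lra).
  assert (B : 2 * M / (d ^ 2 * INR n) <= e / 2).
  { apply Rmult_lt_compat_r with (r := d ^ 2 * e) in Hn; [|nra].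
    unfold Rdiv in Hn; rewrite Rmult_assoc, Rinv_l in Hn by nra.
    apply Rmult_le_reg_r with (d ^ 2 * INR n); [nra|].
    unfold Rdiv at 1; rewrite Rmult_assoc, Rinv_l by nra; lra. }
  assert (0 <= 2 * M / (d ^ 2 * INR n)).
  { apply Rmult_le_pos; [lra|left; apply Rinv_0_lt_compat; nra]. }
  destruct Ht; assert (0 <= t * (1 - t) <= 1) by nra.
  nra.
Qed.

(** * Monomial pairs, and the action of [L_0] and [L'] on them *)

Definition zfun : cfun := fun _ => RtoC 0.
Definition mono (c : R) (n : nat) : cfun := fun x => (RtoC c * RtoC (x ^ n))%C.

(* [(D^2 u_1, u_2')] is [(rho^n, 0)] for odd [n] and [(0, rho^n)] for even [n]:
   these are the pairs for which the function [W] of the header is [x^n]. *)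
Definition epair (n : nat) : cfun2 :=
  if Nat.even n then (zfun, mono (/ INR (n + 1)) (n + 1))
  else (mono (/ (INR (n + 2) * INR (n + 4))) (n + 4), zfun).

Lemma cdiff_mono c n x : cdiff (mono c n) x (mono (c * INR n) (pred n) x).
Proof.
unfold mono; eapply cdiff_eq; [apply cdiff_scal, cdiff_RtoC; auto_derive; [auto|reflexivity]|].
rewrite !RtoC_mult; ring.
Qed.

Lemma flat_mono v n c k : (v <= n)%nat -> flat v k (mono c n).
Proof. intros H; now apply flat_scal, flat_pow. Qed.

Lemma INR_S_neq n m : INR (n + S m) <> 0.
Proof. apply not_0_INR; lia. Qed.

Lemma profile_mono_fst n : profile (mono (/ (INR (n + 2) * INR (n + 4))) (n + 4), zfun)
  (mono (/ (INR (n + 2) * INR (n + 4))) (n + 4)) (mono (/ INR (n + 2)) (n + 2))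
  (mono 1 n) zfun zfun.
Proof.
split; try (intros; reflexivity); intros x.
- intros _; eapply cdiff_eq; [apply cdiff_mono|]; unfold mono.
  replace (Init.Nat.pred (n + 4)) with (S (n + 2)) by lia.
  rewrite <- !RtoC_mult; f_equal; simpl pow; field; split; apply INR_S_neq.
- intros _; eapply cdiff_eq; [apply cdiff_mono|]; unfold mono.
  replace (Init.Nat.pred (n + 2)) with (S n) by lia.
  rewrite <- !RtoC_mult; f_equal; simpl pow; field; apply INR_S_neq.
- apply (flat_mono 0 n 1 0); lia.
- apply cdiff_const.
- apply ccont_const.
Qed.

Lemma profile_mono_snd n : profile (zfun, mono (/ INR (n + 1)) (n + 1))
  zfun zfun zfun (mono (/ INR (n + 1)) (n + 1)) (mono 1 n).
Proof.
split; try (intros; reflexivity); try intros x.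
- intros _; eapply cdiff_eq; [apply cdiff_const|unfold zfun; ring].
- intros _; eapply cdiff_eq; [apply cdiff_const|unfold zfun; ring].
- apply ccont_const.
- eapply cdiff_eq; [apply cdiff_mono|]; unfold mono.
  replace (Init.Nat.pred (n + 1)) with n by lia.
  rewrite <- !RtoC_mult; f_equal; field; apply INR_S_neq.
- unfold mono; rewrite pow_i by lia; ring.
- apply (flat_mono 0 n 1 0); lia.
Qed.

Lemma epair_dom n : dom_tildeL0 (epair n).
Proof.
apply dom_flat; intros k; unfold epair; destruct (Nat.even n) eqn:En.
- exists zfun, (mono (/ INR (n + 1)) (n + 1)); split; [apply flat_zero|].
  split; auto; apply flat_mono; lia.
- exists (mono (/ (INR (n + 2) * INR (n + 4))) (n + 4)), zfun; split.
  + apply flat_mono; destruct n; [discriminate|lia].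
  + split; auto; apply flat_zero.
Qed.

Lemma Kop_zfun x : I01 x -> Kop zfun x = RtoC 0.
Proof.
intros Hx; apply (cdiff_unique_zero (Kop zfun) zfun zfun); auto; [|
  |apply Kop_0].
- intros y; eapply cdiff_eq; [apply Kop_cdiff; intros; apply ccont_const|].
  unfold zfun; ring.
- intros y; apply cdiff_const.
Qed.

Lemma Kop_mono c n x : I01 x ->
  Kop (mono c n) x = mono (c / INR (n + 2)) (n + 2) x.
Proof.
intros Hx.
apply (cdiff_unique_zero _ _ (fun x => RtoC x * mono c n x)%C); auto.
- apply Kop_cdiff; apply (flat_mono 0 n c 0); lia.
- intros y; eapply cdiff_eq; [apply cdiff_mono|]; unfold mono.
  replace (Init.Nat.pred (n + 2)) with (S n) by lia.
  rewrite <- !RtoC_mult; f_equal; simpl pow; field; apply INR_S_neq.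
- rewrite Kop_0; unfold mono; rewrite pow_i by lia; ring.
Qed.

(** For W = x^n, (1 - x) W' - 2 W = n x^(n-1) - (n + 2) x^n. At n = 0 the first coefficient is zero,
    so the value [pred 0 = 0] does no harm. *)
Definition L0_epair (n : nat) : cfun2 :=
  add2 (scal2 (RtoC (INR n)) (epair (pred n))) (scal2 (RtoC (- (INR n + 2))) (epair n)).

Lemma L0_epair_agree n : agree (L0_epair n) (tildeL0 (epair n)).
Proof.
intros x Hx; assert (Ix : I01 x) by (unfold I01; lra).
unfold L0_epair, epair; destruct (Nat.even n) eqn:En.
- pose proof (profile_mono_snd n) as P.
  pose proof (profile_Derive01 _ _ _ _ _ _ P x Hx) as D1.
  pose proof (profile_Dop2 _ _ _ _ _ _ P x Hx) as D2.
  pose proof (profile_Derive01_snd _ _ _ _ _ _ P x Ix) as D3.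
  unfold tildeL0; cbn [fst snd] in *; rewrite D1, D2, D3, Kop_mono by auto.
  assert (X1 : x ^ (n + 1) = x * x ^ n) by (rewrite Nat.add_1_r; reflexivity).
  assert (X3 : x ^ (n + 1 + 2) = x * (x * (x * x ^ n))).
  { replace (n + 1 + 2)%nat with (S (S (S n))) by lia; reflexivity. }
  destruct n as [|n].
  + cbn [Nat.even Nat.pred]; unfold mono, zfun; simpl; split; apply C_eq; simpl; field.
  + rewrite Nat.even_succ, <- Nat.negb_even in En; apply Bool.negb_true_iff in En.
    cbn [Nat.pred]; rewrite En.
    unfold mono, zfun; cbn [fst snd add2 scal2]; rewrite X1, X3.
    replace (n + 4)%nat with (S (S (S (S n)))) by lia.
    replace (INR (S n + 1 + 2)) with (INR n + 4)
      by (rewrite !plus_INR, !S_INR; simpl; ring).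
    replace (INR (S n + 1)) with (INR n + 2)
      by (rewrite !plus_INR, !S_INR; simpl; ring).
    replace (INR (n + 2)) with (INR n + 2)
      by (rewrite !plus_INR; simpl; ring).
    rewrite !S_INR; generalize (pos_INR n); intros Hn.
    split; apply C_eq; simpl; field; lra.
- destruct n as [|n]; [discriminate|].
  rewrite Nat.even_succ, <- Nat.negb_even in En; apply Bool.negb_false_iff in En.
  cbn [Nat.pred]; rewrite En.
  pose proof (profile_mono_fst (S n)) as P.
  pose proof (profile_Derive01 _ _ _ _ _ _ P x Hx) as D1.
  pose proof (profile_Dop2 _ _ _ _ _ _ P x Hx) as D2.
  pose proof (profile_Derive01_snd _ _ _ _ _ _ P x Ix) as D3.
  unfold tildeL0; cbn [fst snd] in *; rewrite D1, D2, D3, Kop_zfun by auto.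
  unfold mono, zfun; cbn [fst snd add2 scal2].
  replace (S n + 4)%nat with (S (S (S (S (S n))))) by lia.
  replace (S n + 2)%nat with (S (S (S n))) by lia.
  replace (n + 1)%nat with (S n) by lia.
  rewrite !S_INR; generalize (pos_INR n); intros Hn.
  split; apply C_eq; simpl; field; lra.
Qed.

(** The derivative is -6x times the square of the function itself, so order k + 1 follows from order
    k by products. *)
Lemma flat_inv_five k : flat 0 k (fun x => RtoC (/ (5 + 3 * x ^ 2))).
Proof.
induction k as [|k IH].
- intros x; apply ccont_RtoC; apply (ex_derive_continuous (V := R_NormedModule)).
  generalize (five_pos x); intros; auto_derive; simpl in *; lra.
- split; [lia|].
  exists (fun x => (RtoC (/ (5 + 3 * x ^ 2)) * RtoC (/ (5 + 3 * x ^ 2))) * mono (-6) 1 x)%C.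
  split.
  + intros x; generalize (five_pos x); intros H.
    eapply cdiff_eq; [apply cdiff_RtoC; auto_derive; [simpl in *; lra|reflexivity]|].
    unfold mono; rewrite <- !RtoC_mult; f_equal; simpl in *; field; lra.
  + apply flat_mult; [now apply flat_mult|apply flat_mono; lia].
Qed.

Lemma flat_potential k : flat 0 k (fun x => RtoC (- potential x)).
Proof.
apply flat_ext with (fun x => (RtoC (/ (5 + 3 * x ^ 2)) * RtoC (/ (5 + 3 * x ^ 2))) *
   (RtoC 720 + mono (-144) 2 x))%C.
- intros x; generalize (five_pos x); intros H.
  unfold mono, potential; rewrite <- !RtoC_mult, <- RtoC_plus, <- RtoC_mult; f_equal.
  field; simpl in *; lra.
- apply flat_mult; [apply flat_mult; apply flat_inv_five|].
  apply flat_plus; [apply flat_const|apply flat_mono; lia].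
Qed.

(** For even [n], u_2 has degree n + 1 and each [K] raises the degree by two. The image is thus a
    smooth function times x^(n+5), which vanishes to the order that [tildeH] requires. For odd [n]
    it is zero. *)
Lemma L'_epair n : exists w, tildeH w /\ agree w (tildeL' (epair n)).
Proof.
unfold epair; destruct (Nat.even n).
- pose (c := / INR (n + 1) / INR (n + 1 + 2) / INR (n + 1 + 2 + 2)).
  exists (fun x => mono c (n + 1 + 2 + 2) x * RtoC (- potential x), zfun)%C; split.
  + apply tildeH_flat.
    exists (fun x => mono c (n + 1 + 2 + 2) x * RtoC (- potential x))%C, zfun.
    split; [|split; [apply flat_zero|now split]].
    apply flat_mult; [apply flat_mono; lia|apply flat_potential].
  + intros x Hx; assert (Ix : I01 x) by (unfold I01; lra); split; auto.
    cbn [fst snd tildeL'].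
    rewrite (Kop_ext _ _ (fun y Hy => Kop_mono _ _ y Hy)) by auto.
    rewrite Kop_mono by auto; fold c; cring.
- exists (zfun, zfun); split.
  + apply tildeH_flat; exists zfun, zfun.
    split; [apply flat_zero|split; [apply flat_zero|now split]].
  + intros x Hx; assert (Ix : I01 x) by (unfold I01; lra); split; auto.
    cbn [fst snd tildeL'].
    rewrite (Kop_ext _ zfun (fun y Hy => Kop_zfun y Hy)) by auto.
    rewrite Kop_zfun by auto; cring.
Qed.

Lemma dom_add u v : dom_tildeL0 u -> dom_tildeL0 v -> dom_tildeL0 (add2 u v).
Proof.
intros Hu Hv; apply dom_flat; intros k.
destruct (proj1 (dom_flat u) Hu k) as [g [h [Fg [Fh [Eg Eh]]]]].
destruct (proj1 (dom_flat v) Hv k) as [g' [h' [Fg' [Fh' [Eg' Eh']]]]].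
exists (fun x => g x + g' x)%C, (fun x => h x + h' x)%C.
split; [now apply flat_plus|split; [now apply flat_plus|]].
split; intros x Hx; simpl; [now rewrite Eg, Eg'|now rewrite Eh, Eh'].
Qed.

Lemma dom_scal c u : dom_tildeL0 u -> dom_tildeL0 (scal2 c u).
Proof.
intros Hu; apply dom_flat; intros k.
destruct (proj1 (dom_flat u) Hu k) as [g [h [Fg [Fh [Eg Eh]]]]].
exists (fun x => c * g x)%C, (fun x => c * h x)%C.
split; [now apply flat_scal|split; [now apply flat_scal|]].
split; intros x Hx; simpl; [now rewrite Eg|now rewrite Eh].
Qed.

Lemma tildeH_add u v : tildeH u -> tildeH v -> tildeH (add2 u v).
Proof.
intros Hu Hv; apply tildeH_flat.
destruct (proj1 (tildeH_flat u) Hu) as [g [h [Fg [Fh [Eg Eh]]]]].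
destruct (proj1 (tildeH_flat v) Hv) as [g' [h' [Fg' [Fh' [Eg' Eh']]]]].
exists (fun x => g x + g' x)%C, (fun x => h x + h' x)%C.
split; [now apply flat_plus|split; [now apply flat_plus|]].
split; intros x Hx; simpl; [now rewrite Eg, Eg'|now rewrite Eh, Eh'].
Qed.

Lemma tildeH_scal c u : tildeH u -> tildeH (scal2 c u).
Proof.
intros Hu; apply tildeH_flat.
destruct (proj1 (tildeH_flat u) Hu) as [g [h [Fg [Fh [Eg Eh]]]]].
exists (fun x => c * g x)%C, (fun x => c * h x)%C.
split; [now apply flat_scal|split; [now apply flat_scal|]].
split; intros x Hx; simpl; [now rewrite Eg|now rewrite Eh].
Qed.

(** * The span of the monomial pairs and its density *)

Inductive espan : cfun2 -> Prop :=
| espan_epair n : espan (epair n)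
| espan_add u v : espan u -> espan v -> espan (add2 u v)
| espan_scal c u : espan u -> espan (scal2 c u).

Lemma espan_dom u : espan u -> dom_tildeL0 u.
Proof.
induction 1; [apply epair_dom|now apply dom_add|now apply dom_scal].
Qed.

Lemma profile_ext u g p a h b a' b' : profile u g p a h b ->
  (forall x, a x = a' x) -> (forall x, b x = b' x) -> profile u g p a' h b'.
Proof.
intros [P1 P2 P3 P4 P5 P6 P7 P8] Ea Eb; split; auto.
- intros x Hx; rewrite <- Ea; auto.
- intros x; apply (continuous_ext a); auto.
- intros x; rewrite <- Eb; auto.
- intros x; apply (continuous_ext b); auto.
Qed.

(** The norm sees only the pair (D^2 u_1, u_2'), so density reduces to producing even polynomials in
    the second slot here, and odd ones in the first slot in [espan_odd]. *)
Lemma espan_even q : poly q -> exists v g p h, espan v /\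
  profile v g p zfun h (fun x => q (x ^ 2)%R).
Proof.
induction 1 as [n|p q _ IHp _ IHq|c p _ IH|p q E _ IH].
- exists (epair (2 * n)); unfold epair at 2; rewrite Nat.even_even.
  exists zfun, zfun, (mono (/ INR (2 * n + 1)) (2 * n + 1)); split; [apply espan_epair|].
  apply profile_ext with (2 := fun x => eq_refl) (1 := profile_mono_snd (2 * n)).
  intros x; unfold mono; rewrite <- pow_mult; ring.
- destruct IHp as [v [g [p1 [h [Sv P]]]]], IHq as [v' [g' [p1' [h' [Sv' P']]]]].
  exists (add2 v v'); do 3 eexists; split; [now apply espan_add|].
  eapply profile_ext; [exact (profile_add _ _ _ _ _ _ _ _ _ _ _ _ P P')| |reflexivity].
  intros x; unfold zfun; ring.
- destruct IH as [v [g [p1 [h [Sv P]]]]].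
  exists (scal2 c v); do 3 eexists; split; [now apply espan_scal|].
  eapply profile_ext; [exact (profile_scal c _ _ _ _ _ _ P)| |reflexivity].
  intros x; unfold zfun; ring.
- destruct IH as [v [g [p1 [h [Sv P]]]]].
  exists v, g, p1, h; split; auto.
  eapply profile_ext; [exact P|reflexivity|]; intros x; apply E.
Qed.

Lemma espan_odd q : poly q -> exists v g p h, espan v /\
  profile v g p (fun x => RtoC x * q (x ^ 2)%R)%C h zfun.
Proof.
induction 1 as [n|p q _ IHp _ IHq|c p _ IH|p q E _ IH].
- exists (epair (2 * n + 1)); unfold epair at 2; rewrite Nat.even_odd.
  do 3 eexists; split; [apply espan_epair|].
  eapply profile_ext; [exact (profile_mono_fst (2 * n + 1))| |reflexivity].
  intros x; unfold mono; rewrite <- pow_mult, Nat.add_1_r.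
  rewrite <- !RtoC_mult; f_equal; simpl; ring.
- destruct IHp as [v [g [p1 [h [Sv P]]]]], IHq as [v' [g' [p1' [h' [Sv' P']]]]].
  exists (add2 v v'); do 3 eexists; split; [now apply espan_add|].
  eapply profile_ext; [exact (profile_add _ _ _ _ _ _ _ _ _ _ _ _ P P')| |];
  intros x; unfold zfun; ring.
- destruct IH as [v [g [p1 [h [Sv P]]]]].
  exists (scal2 c v); do 3 eexists; split; [now apply espan_scal|].
  eapply profile_ext; [exact (profile_scal c _ _ _ _ _ _ P)| |];
  intros x; unfold zfun; ring.
- destruct IH as [v [g [p1 [h [Sv P]]]]].
  exists v, g, p1, h; split; auto.
  eapply profile_ext; [exact P| |reflexivity]; intros x; cbv beta; now rewrite E.
Qed.

(** Weierstrass for [b (sqrt t)], with t = x^2; on [0,1] this imposes no parity on [b]. *)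
Lemma approx_even (b : R -> C) d : (forall x, ccont b x) -> 0 < d ->
  exists q, poly q /\ forall x, I01 x -> Cmod (b x - q (x ^ 2)%R) <= d.
Proof.
intros Cb Hd.
destruct (weierstrass01 (fun t => b (sqrt t)) d) as [q [Pq K]]; auto.
- intros t; apply (continuous_comp sqrt b); [apply continuous_sqrt|apply Cb].
- exists q; split; auto; intros x [H0 H1].
  specialize (K (x ^ 2)); rewrite sqrt_pow2 in K by auto; apply K.
  unfold I01; simpl; nra.
Qed.

Lemma poly_cont q : poly q -> forall x, ccont q x.
Proof.
induction 1 as [n|p q _ IHp _ IHq|c p _ IH|p q E _ IH]; intros x.
- apply ccont_RtoC; apply (ex_derive_continuous (V := R_NormedModule)).
  auto_derive; auto.
- now apply ccont_plus.
- apply ccont_mult; [apply ccont_const|auto].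
- apply (continuous_ext p); auto.
Qed.

(** d / (x + d) is the defect 1 - x / (x + d) of the cutoff used for odd approximation; the integral
    of its square tends to 0 with [d]. *)
Lemma RInt_cutoff M d : 0 < d ->
  ex_RInt (fun x => M * (d / (x + d)) ^ 2) 0 1 /\
  RInt (fun x => M * (d / (x + d)) ^ 2) 0 1 = M * (d / (1 + d)).
Proof.
intros Hd.
assert (H : is_RInt (V := R_NormedModule) (fun x => M * (d / (x + d)) ^ 2) 0 1
  (minus (- M * d ^ 2 / (1 + d)) (- M * d ^ 2 / (0 + d)))).
{ apply (is_RInt_derive (V := R_CompleteNormedModule) (fun x => - M * d ^ 2 / (x + d))).
  - rewrite Rmin_left, Rmax_right by lra; intros x Hx.
    auto_derive; [lra|]; field; lra.
  - rewrite Rmin_left, Rmax_right by lra; intros x Hx.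
    apply (ex_derive_continuous (V := R_NormedModule)); auto_derive; lra. }
split; [eexists; exact H|].
rewrite (is_RInt_unique (V := R_CompleteNormedModule) _ _ _ _ H).
unfold minus, plus, opp; simpl; field; lra.
Qed.

(* [a] is first multiplied by [x / (|x| + d)], close to [1] in L^2: the quotient of
   the product by [x] is continuous, hence a uniform limit of even polynomials. *)
Lemma approx_odd (a : R -> C) eps : (forall x, ccont a x) -> 0 < eps ->
  exists q, poly q /\ N2 (fun x => a x + RtoC (-1) * (RtoC x * q (x ^ 2)%R))%C <= eps.
Proof.
intros Ca He.
destruct (bounded01 a Ca) as [M [M0 HM]].
(* Chosen so that [M ^ 2 * d <= eps / 4]. The cutoff error and the polynomial error are then at most
   eps/4 each, and [N2_plus] doubles their sum. *)
pose (d := eps / (4 * (M ^ 2 + 1))).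
assert (M2 : 0 <= M ^ 2) by apply pow2_ge_0.
assert (Hd : 0 < d) by (apply Rdiv_lt_0_compat; lra).
pose (h := fun x => (RtoC (/ (Rabs x + d)) * a x)%C).
assert (Cr : rcont (fun x => / (Rabs x + d))).
{ intros x; apply (continuous_comp (fun x => Rabs x + d) Rinv).
  - apply (continuous_plus (V := R_NormedModule) Rabs (fun _ => d));
      [apply continuous_Rabs|apply continuous_const].
  - apply continuous_Rinv; generalize (Rabs_pos x); lra. }
assert (Ch : forall x, ccont h x).
{ intros x; apply ccont_mult; auto; now apply ccont_RtoC. }
pose (s := Rmin 1 (eps / 4)).
assert (Hs : 0 < s /\ s <= 1 /\ s <= eps / 4).
{ unfold s; split; [apply Rmin_glb_lt; lra|]; split; [apply Rmin_l|apply Rmin_r]. }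
destruct (approx_even h s Ch) as [q [Pq Kq]]; [lra|].
exists q; split; auto.
assert (Cq : forall x, ccont (fun x : R => RtoC (-1) * (RtoC x * q (x ^ 2)%R))%C x).
{ intros x; apply ccont_mult; [apply ccont_const|]; apply ccont_id_mult.
  apply (continuous_comp (fun x => x ^ 2) q); [|now apply poly_cont].
  apply (ex_derive_continuous (V := R_NormedModule)); auto_derive; auto. }
assert (Cxh : forall x, ccont (fun x => RtoC x * h x)%C x)
  by (intros; now apply ccont_id_mult).
assert (Cmxh : forall x, ccont (fun x => RtoC (-1) * (RtoC x * h x))%C x)
  by (intros; apply ccont_mult; auto; apply ccont_const).
rewrite (N2_ext _ (fun x => (a x + RtoC (-1) * (RtoC x * h x)) +
   (RtoC x * h x + RtoC (-1) * (RtoC x * q (x ^ 2)%R)))%C)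
  by (intros; ring).
eapply Rle_trans; [apply N2_plus; intros; now apply ccont_plus|].
assert (A1 : N2 (fun x => a x + RtoC (-1) * (RtoC x * h x))%C <= M ^ 2 * (d / (1 + d))).
{ destruct (RInt_cutoff (M ^ 2) d Hd) as [X Y]; rewrite <- Y.
  apply RInt_le; [exact Rle_0_1| |exact X|].
  - apply ex_RInt_rcont, rcont_Cmod2; intros; now apply ccont_plus.
  - intros x Hx; unfold h.
    replace (a x + RtoC (-1) * (RtoC x * (RtoC (/ (Rabs x + d)) * a x)))%C
      with (RtoC (d / (x + d)) * a x)%C.
    + rewrite Cmod_mult, Rpow_mult_distr, Cmod_R, pow2_abs, Rmult_comm.
      apply Rmult_le_compat_r; [apply pow2_ge_0|].
      apply pow_incr; split; [apply Cmod_ge_0|apply HM; unfold I01; lra].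
    + rewrite Rabs_pos_eq by lra; apply C_eq; simpl; field; lra. }
assert (A2 : N2 (fun x => RtoC x * h x + RtoC (-1) * (RtoC x * q (x ^ 2)%R))%C <= s ^ 2).
{ apply N2_le_const; [intros; now apply ccont_plus|].
  intros x Hx; apply pow_incr; split; [apply Cmod_ge_0|].
  replace (RtoC x * h x + RtoC (-1) * (RtoC x * q (x ^ 2)%R))%C
    with (RtoC x * (h x - q (x ^ 2)%R))%C by (apply C_eq; simpl; ring).
  specialize (Kq x Hx); rewrite Cmod_mult, Cmod_R, Rabs_pos_eq by apply Hx.
  unfold I01 in Hx; generalize (Cmod_ge_0 (h x - q (x ^ 2)%R)); nra. }
assert (A3 : M ^ 2 * (d / (1 + d)) <= eps / 4).
{ apply Rle_trans with (M ^ 2 * d).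
  - apply Rmult_le_compat_l; auto.
    apply Rmult_le_reg_r with (1 + d); [lra|].
    unfold Rdiv; rewrite Rmult_assoc, Rinv_l; nra.
  - unfold d; apply Rmult_le_reg_r with (4 * (M ^ 2 + 1)); [lra|].
    unfold Rdiv; rewrite Rmult_assoc, (Rmult_assoc eps), Rinv_l by lra; nra. }
assert (A4 : s ^ 2 <= eps / 4) by (simpl; nra).
lra.
Qed.

Lemma espan_dense u eps : tildeH u -> 0 < eps ->
  exists v, espan v /\ sq2 (sub2 u v) < eps.
Proof.
intros Hu He.
destruct (tildeH_profile u Hu) as [g [p [a [h [b P]]]]].
pose proof (pf_a _ _ _ _ _ _ P) as Ca; pose proof (pf_b _ _ _ _ _ _ P) as Cb.
destruct (approx_odd a (eps / 4) Ca) as [q1 [Q1 K1]]; [lra|].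
pose (s := Rmin 1 (eps / 4)).
assert (Hs : 0 < s /\ s <= 1 /\ s <= eps / 4).
{ unfold s; split; [apply Rmin_glb_lt; lra|]; split; [apply Rmin_l|apply Rmin_r]. }
destruct (approx_even b s Cb) as [q2 [Q2 K2]]; [lra|].
destruct (espan_odd q1 Q1) as [v1 [g1 [p1 [h1 [S1 P1]]]]].
destruct (espan_even q2 Q2) as [v2 [g2 [p2 [h2 [S2 P2]]]]].
exists (add2 v1 v2); split; [now apply espan_add|].
pose proof (profile_add _ _ _ _ _ _ _ _ _ _ _ _ P (profile_scal (RtoC (-1)) _ _ _ _ _ _
  (profile_add _ _ _ _ _ _ _ _ _ _ _ _ P1 P2))) as S.
pose proof (profile_ext _ _ _ _ _ _
  (fun x => a x + RtoC (-1) * (RtoC x * q1 (x ^ 2)%R))%C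
  (fun x => b x + RtoC (-1) * q2 (x ^ 2)%R)%C S
  ltac:(intros; unfold zfun; ring) ltac:(intros; unfold zfun; ring)) as S'.
unfold sq2, sub2; rewrite (norm2_profile _ _ _ _ _ _ S').
assert (K3 : N2 (fun x => b x + RtoC (-1) * q2 (x ^ 2)%R)%C <= s ^ 2).
{ apply N2_le_const; [apply (pf_b _ _ _ _ _ _ S')|].
  intros x Hx; apply pow_incr; split; [apply Cmod_ge_0|].
  replace (b x + RtoC (-1) * q2 (x ^ 2)%R)%C with (b x - q2 (x ^ 2)%R)%C by ring.
  now apply K2. }
assert (A4 : s ^ 2 <= eps / 4) by (simpl; nra).
lra.
Qed.

(** * The operators on the completion *)

Lemma Kop_add h k x : (forall y, ccont h y) -> (forall y, ccont k y) -> I01 x ->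
  Kop (fun y => h y + k y)%C x = (Kop h x + Kop k x)%C.
Proof.
intros Hh Hk Hx.
apply (cdiff_unique_zero (Kop (fun y => h y + k y)%C)
  (fun y => Kop h y + Kop k y)%C (fun y => RtoC y * (h y + k y))%C); auto.
- apply Kop_cdiff; intros y; now apply ccont_plus.
- intros y; eapply cdiff_eq; [apply cdiff_plus; now apply Kop_cdiff|ring].
- rewrite !Kop_0; ring.
Qed.

Lemma Kop_scal c h x : (forall y, ccont h y) -> I01 x ->
  Kop (fun y => c * h y)%C x = (c * Kop h x)%C.
Proof.
intros Hh Hx.
apply (cdiff_unique_zero (Kop (fun y => c * h y)%C)
  (fun y => c * Kop h y)%C (fun y => RtoC y * (c * h y))%C); auto.
- apply Kop_cdiff; intros y; apply ccont_mult; auto; apply ccont_const.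
- intros y; eapply cdiff_eq; [apply cdiff_scal; now apply Kop_cdiff|ring].
- rewrite !Kop_0; ring.
Qed.

Lemma tildeL0_eq u g p a h b x : profile u g p a h b -> 0 < x <= 1 ->
  fst (tildeL0 u) x = (- RtoC x * (RtoC x * p x) + RtoC 2 * g x
      + RtoC (x ^ 2) * h x - RtoC 3 * Kop h x)%C /\
  snd (tildeL0 u) x = (a x - RtoC x * b x - h x)%C.
Proof.
intros P Hx; assert (Ix : I01 x) by (unfold I01; lra).
unfold tildeL0; cbn [fst snd].
rewrite (profile_Derive01 _ _ _ _ _ _ P x Hx), (profile_Dop2 _ _ _ _ _ _ P x Hx).
rewrite (profile_Derive01_snd _ _ _ _ _ _ P x Ix).
rewrite (Kop_ext _ h (pf_h _ _ _ _ _ _ P) x Ix).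
now rewrite (pf_g _ _ _ _ _ _ P x Ix), (pf_h _ _ _ _ _ _ P x Ix).
Qed.

Lemma tildeL'_eq u g p a h b x : profile u g p a h b -> 0 < x <= 1 ->
  fst (tildeL' u) x = (- RtoC (potential x) * Kop (Kop h) x)%C.
Proof.
intros P Hx; assert (Ix : I01 x) by (unfold I01; lra).
unfold tildeL'; cbn [fst snd].
now rewrite (Kop_ext _ _ (Kop_ext _ h (pf_h _ _ _ _ _ _ P)) x Ix).
Qed.

Lemma agree_tildeL0_add u v w z : tildeH u -> tildeH v ->
  agree w (tildeL0 u) -> agree z (tildeL0 v) ->
  agree (add2 w z) (tildeL0 (add2 u v)).
Proof.
intros Hu Hv Ew Ez x Hx; assert (Ix : I01 x) by (unfold I01; lra).
destruct (tildeH_profile u Hu) as [g [p [a [h [b P]]]]].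
destruct (tildeH_profile v Hv) as [g' [p' [a' [h' [b' Q]]]]].
pose proof (profile_add _ _ _ _ _ _ _ _ _ _ _ _ P Q) as S.
destruct (tildeL0_eq _ _ _ _ _ _ x P Hx) as [A1 A2].
destruct (tildeL0_eq _ _ _ _ _ _ x Q Hx) as [B1 B2].
destruct (tildeL0_eq _ _ _ _ _ _ x S Hx) as [C1 C2].
destruct (Ew x Hx) as [D1 D2], (Ez x Hx) as [E1 E2].
rewrite C1, C2, Kop_add; auto; try (eapply profile_h_cont; eassumption).
unfold add2; cbn [fst snd]; rewrite D1, D2, E1, E2, A1, A2, B1, B2; split; ring.
Qed.

Lemma agree_tildeL0_scal c u w : tildeH u ->
  agree w (tildeL0 u) -> agree (scal2 c w) (tildeL0 (scal2 c u)).
Proof.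
intros Hu Ew x Hx; assert (Ix : I01 x) by (unfold I01; lra).
destruct (tildeH_profile u Hu) as [g [p [a [h [b P]]]]].
pose proof (profile_scal c _ _ _ _ _ _ P) as S.
destruct (tildeL0_eq _ _ _ _ _ _ x P Hx) as [A1 A2].
destruct (tildeL0_eq _ _ _ _ _ _ x S Hx) as [C1 C2].
destruct (Ew x Hx) as [D1 D2].
rewrite C1, C2, Kop_scal; auto; try (eapply profile_h_cont; eassumption).
unfold scal2; cbn [fst snd]; rewrite D1, D2, A1, A2; split; ring.
Qed.

Lemma agree_tildeL'_add u v w z : tildeH u -> tildeH v ->
  agree w (tildeL' u) -> agree z (tildeL' v) ->
  agree (add2 w z) (tildeL' (add2 u v)).
Proof.
intros Hu Hv Ew Ez x Hx; assert (Ix : I01 x) by (unfold I01; lra).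
destruct (tildeH_profile u Hu) as [g [p [a [h [b P]]]]].
destruct (tildeH_profile v Hv) as [g' [p' [a' [h' [b' Q]]]]].
pose proof (profile_add _ _ _ _ _ _ _ _ _ _ _ _ P Q) as S.
assert (Ch : forall y, ccont h y) by (eapply profile_h_cont; eassumption).
assert (Ch' : forall y, ccont h' y) by (eapply profile_h_cont; eassumption).
destruct (Ew x Hx) as [D1 D2], (Ez x Hx) as [E1 E2].
split.
- rewrite (tildeL'_eq _ _ _ _ _ _ x S Hx).
  rewrite (Kop_ext _ _ (fun y Hy => Kop_add h h' y Ch Ch' Hy)) by auto.
  rewrite Kop_add; auto; try now apply Kop_cont.
  unfold add2; cbn [fst snd]; rewrite D1, E1.
  rewrite (tildeL'_eq _ _ _ _ _ _ x P Hx), (tildeL'_eq _ _ _ _ _ _ x Q Hx); ring.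
- unfold add2; cbn [fst snd]; rewrite D2, E2; cring.
Qed.

Lemma agree_tildeL'_scal c u w : tildeH u ->
  agree w (tildeL' u) -> agree (scal2 c w) (tildeL' (scal2 c u)).
Proof.
intros Hu Ew x Hx; assert (Ix : I01 x) by (unfold I01; lra).
destruct (tildeH_profile u Hu) as [g [p [a [h [b P]]]]].
pose proof (profile_scal c _ _ _ _ _ _ P) as S.
assert (Ch : forall y, ccont h y) by (eapply profile_h_cont; eassumption).
destruct (Ew x Hx) as [D1 D2].
split.
- rewrite (tildeL'_eq _ _ _ _ _ _ x S Hx).
  rewrite (Kop_ext _ _ (fun y Hy => Kop_scal c h y Ch Hy)) by auto.
  rewrite Kop_scal; auto; try now apply Kop_cont.
  unfold scal2; cbn [fst snd]; rewrite D1.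
  rewrite (tildeL'_eq _ _ _ _ _ _ x P Hx); ring.
- unfold scal2; cbn [fst snd]; rewrite D2; cring.
Qed.

Lemma espan_L' u : espan u -> exists w, tildeH w /\ agree w (tildeL' u).
Proof.
induction 1 as [n|u v Su [w [Hw Ew]] Sv [z [Hz Ez]]|c u Su [w [Hw Ew]]].
- apply L'_epair.
- exists (add2 w z); split; [now apply tildeH_add|].
  apply agree_tildeL'_add; auto; now apply dom_tildeH, espan_dom.
- exists (scal2 c w); split; [now apply tildeH_scal|].
  apply agree_tildeL'_scal; auto; now apply dom_tildeH, espan_dom.
Qed.

(** * Algebra in H and closures of graphs *)

Section Hilbert.
Context {H : CompleteNormedModule C_AbsRing} (ip : H -> H -> C)
  (j : cfun2 -> H) (Hc : is_completion H ip j).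

Let Hip : is_Hilbert H ip := cpl_Hilbert _ _ _ Hc.

Lemma ip_opp x z : ip (opp x) z = (- ip x z)%C.
Proof.
assert (E : opp x = scal (opp (@one C_AbsRing)) x) by (symmetry; exact (scal_opp_one x)).
rewrite E, (ip_scal _ _ Hip).
change (opp (@one C_AbsRing)) with (- RtoC 1)%C; ring.
Qed.

Lemma ip_minus x y z : ip (minus x y) z = (ip x z - ip y z)%C.
Proof.
change (minus x y) with (plus x (opp y)); rewrite (ip_plus _ _ Hip), ip_opp; ring.
Qed.

Lemma ip_zero z : ip zero z = RtoC 0.
Proof.
assert (E : zero = plus z (opp z)) by (symmetry; exact (plus_opp_r z)).
rewrite E, (ip_plus _ _ Hip), ip_opp; ring.
Qed.

Lemma norm_ip x : norm x ^ 2 = Re (ip x x).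
Proof. now rewrite (ip_norm _ _ Hip). Qed.

Lemma norm_sub_eq_0 (x y : H) : norm (minus x y) = 0 -> x = y.
Proof.
intros Z; apply (plus_reg_r (opp y)).
exact (eq_trans (norm_eq_zero _ Z) (eq_sym (plus_opp_r y))).
Qed.

Lemma norm_0 : norm (zero : H) = 0.
Proof. exact norm_zero. Qed.

(** Testing against every [z] turns an identity between vectors into one in C, which [ring] decides;
    the tactic [vec] rests on this. *)
Lemma ip_ext x y : (forall z, ip x z = ip y z) -> x = y.
Proof.
intros E; assert (Z : norm (minus x y) ^ 2 = 0).
{ rewrite norm_ip, ip_minus, E; simpl; ring. }
apply norm_sub_eq_0; generalize (norm_ge_0 (minus x y)); nra.
Qed.

(* The coercion paths of [H] to its group and module structures are only
   convertible; these constants give its operations a unique syntactic form. *)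
Definition vplus (x y : H) : H := plus x y.
Definition vminus (x y : H) : H := minus x y.
Definition vopp (x : H) : H := opp x.
Definition vscal (c : C) (x : H) : H := scal c x.
Definition vzero : H := zero.

Lemma ip_vplus x y z : ip (vplus x y) z = (ip x z + ip y z)%C.
Proof. apply (ip_plus _ _ Hip). Qed.

Lemma ip_vscal c x z : ip (vscal c x) z = (c * ip x z)%C.
Proof. apply (ip_scal _ _ Hip). Qed.

Lemma ip_vminus x y z : ip (vminus x y) z = (ip x z - ip y z)%C.
Proof. apply ip_minus. Qed.

Lemma ip_vopp x z : ip (vopp x) z = (- ip x z)%C.
Proof. apply ip_opp. Qed.

Lemma ip_vzero z : ip vzero z = RtoC 0.
Proof. apply ip_zero. Qed.

Ltac vec := apply ip_ext; intros ?;
  repeat match goal with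
  | |- context [@plus ?G ?a ?b] => change (@plus G a b) with (vplus a b)
  | |- context [@minus ?G ?a ?b] => change (@minus G a b) with (vminus a b)
  | |- context [@opp ?G ?a] => change (@opp G a) with (vopp a)
  | |- context [@scal ?K ?G ?c ?a] => change (@scal K G c a) with (vscal c a)
  | |- context [@zero ?G] => change (@zero G) with vzero
  end;
  repeat first [rewrite ip_vminus | rewrite ip_vplus | rewrite ip_vscal
    | rewrite ip_vopp | rewrite ip_vzero]; ring.

Lemma norm_sub_sym (x y : H) : norm (minus x y) = norm (minus y x).
Proof. rewrite <- (norm_opp (minus x y)); f_equal; vec. Qed.

Lemma norm_scal_le (c : C) (x : H) : norm (vscal c x) <= Cmod c * norm x.
Proof. exact (norm_scal c x). Qed.

Lemma norm_le_dist (x y : H) : norm x <= norm y + norm (minus x y).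
Proof.
assert (E : x = plus y (minus x y)) by vec.
rewrite E at 1; apply (norm_triangle y).
Qed.

Lemma norm_sub_le (x y : H) : norm (minus x y) <= norm x + norm y.
Proof. rewrite <- (norm_opp y); exact (norm_triangle x (opp y)). Qed.

Lemma norm_vplus (x y : H) : norm (vplus x y) <= norm x + norm y.
Proof. exact (norm_triangle x y). Qed.

(* Polarization turns the triangle inequality into Cauchy-Schwarz. *)
Lemma Re_ip_le x y : Re (ip x y) <= norm x * norm y.
Proof.
assert (E : norm (plus x y) ^ 2 = norm x ^ 2 + norm y ^ 2 + 2 * Re (ip x y)).
{ rewrite !norm_ip, (ip_plus _ _ Hip).
  rewrite (ip_conj _ _ Hip (plus x y) x), (ip_conj _ _ Hip (plus x y) y).
  rewrite !(ip_plus _ _ Hip), (ip_conj _ _ Hip x y); unfold Re; simpl; ring. }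
generalize (norm_triangle x y) (norm_ge_0 (plus x y)) (norm_ge_0 x) (norm_ge_0 y).
intros; assert (norm (plus x y) ^ 2 <= (norm x + norm y) ^ 2)
  by (apply pow_incr; auto).
lra.
Qed.

(* [Q d] is a set of [d]-approximants; its filter replaces a Cauchy sequence, whose
   construction would need choice. *)
Lemma complete_family (Q : R -> H -> Prop) :
  (forall d d' x, d <= d' -> Q d x -> Q d' x) ->
  (forall d, 0 < d -> exists x, Q d x) ->
  (forall eps, 0 < eps -> exists d, 0 < d /\ forall x y, Q d x -> Q d y ->
     norm (minus x y) < eps) ->
  exists l, forall eps, 0 < eps -> exists d, 0 < d /\ forall x, Q d x ->
     norm (minus x l) < eps.
Proof.
intros Mono Ne Cau.
pose (F := fun P : H -> Prop => exists d, 0 < d /\ forall x, Q d x -> P x).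
assert (PF : ProperFilter F).
{ split.
  - intros P [d [Hd K]]; destruct (Ne d Hd) as [x Hx]; exists x; auto.
  - split.
    + exists 1; split; auto; lra.
    + intros P1 P2 [d1 [D1 K1]] [d2 [D2 K2]].
      exists (Rmin d1 d2); split; [now apply Rmin_glb_lt|]; intros x Hx; split.
      * apply K1, (Mono (Rmin d1 d2)); auto; apply Rmin_l.
      * apply K2, (Mono (Rmin d1 d2)); auto; apply Rmin_r.
    + intros P1 P2 I [d [Hd K]]; exists d; split; auto. }
assert (CF : cauchy F).
{ intros eps; destruct (Cau eps (cond_pos eps)) as [d [Hd K]].
  destruct (Ne d Hd) as [x Hx]; exists x, d; split; auto; intros y Hy.
  apply (norm_compat1 (V := H)); now apply K. }
exists (lim F); intros eps He.
assert (He' : 0 < eps / norm_factor (V := H)).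
{ apply Rdiv_lt_0_compat; auto; apply norm_factor_gt_0. }
destruct (complete_cauchy F PF CF (mkposreal _ He')) as [d [Hd K]].
exists d; split; auto; intros x Hx.
pose proof (norm_compat2 (V := H) _ _ _ (K x Hx)) as N; simpl in N.
eapply Rlt_le_trans; [exact N|right; field].
apply Rgt_not_eq, norm_factor_gt_0.
Qed.

(** The two middle hypotheses are one-sided Lipschitz bounds, in the direction in which each side of
    the inequality is transported from a nearby point of the graph. *)
Lemma closure_le (A : operator H) (F G : H -> H -> R) (M : R) : 0 <= M ->
  (forall x y x' y', F x y <= F x' y' + M * (norm (minus x x') + norm (minus y y'))) ->
  (forall x y x' y', G x' y' <= G x y + M * (norm (minus x x') + norm (minus y y'))) ->
  (forall x y, A x y -> F x y <= G x y) ->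
  forall x y, op_closure A x y -> F x y <= G x y.
Proof.
intros HM HF HG HA x y Hxy; apply le_epsilon; intros eps He.
destruct (Hxy (eps / (4 * (M + 1)))) as [x' [y' [Ha [Hx Hy]]]].
{ apply Rdiv_lt_0_compat; lra. }
assert (D : M * (norm (minus x x') + norm (minus y y')) <= eps / 2).
{ apply Rle_trans with (M * (eps / (2 * (M + 1)))).
  - apply Rmult_le_compat_l; auto.
    replace (eps / (2 * (M + 1))) with
      (eps / (4 * (M + 1)) + eps / (4 * (M + 1))) by (field; lra); lra.
  - apply Rmult_le_reg_r with (2 * (M + 1)); [lra|].
    replace (M * (eps / (2 * (M + 1))) * (2 * (M + 1))) with (M * eps)
      by (field; lra).
    nra. }
generalize (HF x y x' y') (HG x y x' y') (HA x' y' Ha); lra.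
Qed.

Lemma closure_plus (A : operator H) :
  (forall x y x' y', A x y -> A x' y' -> A (plus x x') (plus y y')) ->
  forall x y x' y', op_closure A x y -> op_closure A x' y' ->
  op_closure A (plus x x') (plus y y').
Proof.
intros HA x y x' y' C1 C2 eps He.
destruct (C1 (eps / 2)) as [x1 [y1 [A1 [B1 D1]]]]; [lra|].
destruct (C2 (eps / 2)) as [x2 [y2 [A2 [B2 D2]]]]; [lra|].
exists (plus x1 x2), (plus y1 y2); split; [now apply HA|]; split.
- replace (minus (plus x x') (plus x1 x2)) with (vplus (minus x x1) (minus x' x2)) by vec.
  eapply Rle_lt_trans; [apply norm_vplus|lra].
- replace (minus (plus y y') (plus y1 y2)) with (vplus (minus y y1) (minus y' y2)) by vec.
  eapply Rle_lt_trans; [apply norm_vplus|lra].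
Qed.

Lemma closure_scal (A : operator H) (c : C) :
  (forall x y, A x y -> A (scal c x) (scal c y)) ->
  forall x y, op_closure A x y -> op_closure A (scal c x) (scal c y).
Proof.
intros HA x y C1 eps He.
assert (M := Cmod_ge_0 c).
destruct (C1 (eps / (Cmod c + 1))) as [x1 [y1 [A1 [B1 D1]]]].
{ apply Rdiv_lt_0_compat; lra. }
assert (S : forall z : H, norm z < eps / (Cmod c + 1) -> norm (vscal c z) < eps).
{ intros z Hz; eapply Rle_lt_trans; [apply norm_scal_le|].
  apply Rmult_lt_compat_r with (r := Cmod c + 1) in Hz; [|lra].
  unfold Rdiv in Hz; rewrite Rmult_assoc, Rinv_l in Hz by lra.
  generalize (norm_ge_0 z); nra. }
exists (scal c x1), (scal c y1); split; [now apply HA|]; split.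
- apply S in B1; replace (vscal c (minus x x1)) with (vminus (vscal c x) (vscal c x1)) in B1
    by vec; exact B1.
- apply S in D1; replace (vscal c (minus y y1)) with (vminus (vscal c y) (vscal c y1)) in D1
    by vec; exact D1.
Qed.

Lemma closure_incl (A : operator H) x y : A x y -> op_closure A x y.
Proof.
intros HA eps He; exists x, y; split; auto.
replace (minus x x) with (zero : H) by vec.
replace (minus y y) with (zero : H) by vec.
now rewrite norm_0.
Qed.

Lemma closure_closed (A : operator H) x y :
  (forall eps, 0 < eps -> exists x' y', op_closure A x' y' /\
     norm (minus x x') < eps /\ norm (minus y y') < eps) -> op_closure A x y.
Proof.
intros C eps He.
destruct (C (eps / 2)) as [x1 [y1 [A1 [B1 D1]]]]; [lra|].
destruct (A1 (eps / 2)) as [x2 [y2 [A2 [B2 D2]]]]; [lra|].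
exists x2, y2; split; auto; split.
- replace (minus x x2) with (vplus (minus x x1) (minus x1 x2)) by vec.
  eapply Rle_lt_trans; [apply norm_vplus|lra].
- replace (minus y y2) with (vplus (minus y y1) (minus y1 y2)) by vec.
  eapply Rle_lt_trans; [apply norm_vplus|lra].
Qed.

Lemma norm_j u : tildeH u -> norm (j u) ^ 2 = sq2 u.
Proof. intros Hu; now rewrite norm_ip, (cpl_inner _ _ _ Hc). Qed.

Lemma j_sub u v : tildeH u -> tildeH v -> j (sub2 u v) = minus (j u) (j v).
Proof.
intros Hu Hv; unfold sub2.
rewrite (cpl_add _ _ _ Hc), (cpl_scal _ _ _ Hc); auto; [vec|].
now apply tildeH_scal.
Qed.

Lemma tildeH_sub u v : tildeH u -> tildeH v -> tildeH (sub2 u v).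
Proof. intros Hu Hv; apply tildeH_add; auto; now apply tildeH_scal. Qed.

(** * The perturbation as a bounded operator on H *)

Definition core0 : operator H := induced j dom_tildeL0 tildeL0.
Definition coreV : operator H := induced j tildeH tildeL'.

Lemma core0_plus x y x' y' : core0 x y -> core0 x' y' -> core0 (plus x x') (plus y y').
Proof.
intros [u [w [Du [Hw [E [-> ->]]]]]] [u' [w' [Du' [Hw' [E' [-> ->]]]]]].
exists (add2 u u'), (add2 w w').
split; [now apply dom_add|split; [now apply tildeH_add|split]].
- apply (agree_tildeL0_add u u' w w'); auto; now apply dom_tildeH.
- rewrite !(cpl_add _ _ _ Hc); auto; now apply dom_tildeH.
Qed.

Lemma core0_scal c x y : core0 x y -> core0 (scal c x) (scal c y).
Proof.
intros [u [w [Du [Hw [E [-> ->]]]]]].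
exists (scal2 c u), (scal2 c w).
split; [now apply dom_scal|split; [now apply tildeH_scal|split]].
- apply (agree_tildeL0_scal c u w); auto; now apply dom_tildeH.
- rewrite !(cpl_scal _ _ _ Hc); auto; now apply dom_tildeH.
Qed.

Lemma coreV_plus x y x' y' : coreV x y -> coreV x' y' -> coreV (plus x x') (plus y y').
Proof.
intros [u [w [Du [Hw [E [-> ->]]]]]] [u' [w' [Du' [Hw' [E' [-> ->]]]]]].
exists (add2 u u'), (add2 w w').
split; [now apply tildeH_add|split; [now apply tildeH_add|split]].
- exact (agree_tildeL'_add u u' w w' Du Du' E E').
- rewrite !(cpl_add _ _ _ Hc); auto.
Qed.

Lemma coreV_scal c x y : coreV x y -> coreV (scal c x) (scal c y).
Proof.
intros [u [w [Du [Hw [E [-> ->]]]]]].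
exists (scal2 c u), (scal2 c w).
split; [now apply tildeH_scal|split; [now apply tildeH_scal|split]].
- exact (agree_tildeL'_scal c u w Du E).
- rewrite !(cpl_scal _ _ _ Hc); auto.
Qed.

(* A crude bound of the operator norm of [L']: [KV^2 >= 22 * 200000^2]. *)
Definition KV : R := 1000000.

Lemma le_of_sq a b : 0 <= b -> a ^ 2 <= b ^ 2 -> a <= b.
Proof. intros Hb Hab; destruct (Rle_dec a b); auto; nra. Qed.

Lemma coreV_bound x y : coreV x y -> norm y <= KV * norm x.
Proof.
intros [u [w [Du [Hw [E [-> ->]]]]]].
pose proof (tildeL'_bound u w Du Hw E) as B.
pose proof (m2_le_sq2 u Du) as B'; pose proof (m2_ge_0 u Du) as B0.
rewrite <- norm_j in B, B' by auto.
apply le_of_sq; [unfold KV; generalize (norm_ge_0 (j u)); lra|].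
unfold KV; rewrite Rpow_mult_distr.
replace (22 * 200000 ^ 2) with 880000000000 in B by ring.
replace (1000000 ^ 2) with 1000000000000 by ring; lra.
Qed.

Definition graphV : operator H := op_closure coreV.

Lemma graphV_bound x y : graphV x y -> norm y <= KV * norm x.
Proof.
apply (closure_le coreV (fun _ y => norm y) (fun x _ => KV * norm x) KV).
- unfold KV; lra.
- intros x0 y0 x' y'; generalize (norm_le_dist y0 y').
  generalize (norm_ge_0 (minus x0 x')) (norm_ge_0 (minus y0 y')); unfold KV; lra.
- intros x0 y0 x' y'; generalize (norm_le_dist x' x0); rewrite (norm_sub_sym x' x0).
  generalize (norm_ge_0 (minus x0 x')) (norm_ge_0 (minus y0 y')); unfold KV; lra.
- apply coreV_bound.
Qed.

Lemma graphV_plus x y x' y' :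
  graphV x y -> graphV x' y' -> graphV (plus x x') (plus y y').
Proof. apply closure_plus, coreV_plus. Qed.

Lemma graphV_scal c x y : graphV x y -> graphV (scal c x) (scal c y).
Proof. apply closure_scal, coreV_scal. Qed.

Lemma graphV_minus x y x' y' :
  graphV x y -> graphV x' y' -> graphV (minus x x') (minus y y').
Proof.
intros G G'; replace (minus x x') with (plus x (scal (RtoC (-1)) x')) by vec.
replace (minus y y') with (plus y (scal (RtoC (-1)) y')) by vec.
apply graphV_plus; auto; now apply graphV_scal.
Qed.

Lemma espan_dense_H (x : H) eps : 0 < eps ->
  exists v, espan v /\ norm (minus x (j v)) < eps.
Proof.
intros He.
destruct (cpl_dense _ _ _ Hc x (eps / 2)) as [u [Hu Hxu]]; [lra|].
destruct (espan_dense u ((eps / 2) ^ 2) Hu) as [v [Sv Hv]].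
{ apply pow_lt; lra. }
exists v; split; auto.
assert (Tv : tildeH v) by now apply dom_tildeH, espan_dom.
rewrite <- norm_j, j_sub in Hv by (auto; now apply tildeH_sub).
assert (norm (minus (j u) (j v)) < eps / 2).
{ generalize (norm_ge_0 (minus (j u) (j v))); intros; nra. }
replace (minus x (j v)) with (vplus (minus x (j u)) (minus (j u) (j v))) by vec.
eapply Rle_lt_trans; [apply norm_vplus|lra].
Qed.

(** The values of the restriction at points near [x] form a Cauchy family by boundedness. Points of
    [espan] supply such values everywhere, since [tildeL'] maps them into [tildeH]. *)
Lemma graphV_total x : exists y, graphV x y.
Proof.
destruct (complete_family
  (fun d y => exists p, coreV p y /\ norm (minus x p) < d)) as [l Hl].
- intros d d' y Hd [p [Hp Hx]]; exists p; split; auto; lra.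
- intros d Hd; destruct (espan_dense_H x d Hd) as [v [Sv Hv]].
  destruct (espan_L' v Sv) as [w [Hw E]].
  exists (j w), (j v); split; auto; exists v, w.
  split; [now apply dom_tildeH, espan_dom|]; auto.
- intros eps He; exists (eps / (4 * KV)); split.
  { unfold KV; lra. }
  intros y y' [p [Hp Hx]] [p' [Hp' Hx']].
  assert (G : graphV (minus p p') (minus y y')).
  { apply graphV_minus; now apply closure_incl. }
  apply graphV_bound in G.
  assert (norm (minus p p') <= norm (minus x p) + norm (minus x p')).
  { replace (minus p p') with (minus (minus x p') (minus x p)) by vec.
    eapply Rle_trans; [apply norm_sub_le|lra]. }
  unfold KV in *; lra.
- exists l; intros eps He; destruct (Hl eps He) as [d [Hd K]].
  destruct (espan_dense_H x (Rmin d eps)) as [v [Sv Hv]]; [now apply Rmin_glb_lt|].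
  destruct (espan_L' v Sv) as [w [Hw E]].
  assert (Cv : coreV (j v) (j w)).
  { exists v, w; split; [now apply dom_tildeH, espan_dom|]; auto. }
  exists (j v), (j w); split; [exact Cv|]; split.
  + eapply Rlt_le_trans; [exact Hv|apply Rmin_r].
  + rewrite norm_sub_sym; apply K; exists (j v); split; auto.
    eapply Rlt_le_trans; [exact Hv|apply Rmin_l].
Qed.

Lemma graphV_unique x y y' : graphV x y -> graphV x y' -> y = y'.
Proof.
intros G G'; pose proof (graphV_bound _ _ (graphV_minus _ _ _ _ G G')) as B.
replace (minus x x) with (zero : H) in B by vec; rewrite norm_0, Rmult_0_r in B.
apply norm_sub_eq_0; generalize (norm_ge_0 (minus y y')); lra.
Qed.

(** Existence and uniqueness of the limit value give meaning to the [iota] in the definition of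
    [L']; its linearity and bound are then read off the closed graph. *)
Lemma L'_graph x : graphV x (L' j x).
Proof.
apply (iota_correct (V := H) (graphV x)).
destruct (graphV_total x) as [y Hy]; exists y; split; auto.
intros y' Hy'; now apply graphV_unique with x.
Qed.

Lemma L'_plus x y : L' j (plus x y) = plus (L' j x) (L' j y).
Proof.
apply graphV_unique with (plus x y); [apply L'_graph|].
apply graphV_plus; apply L'_graph.
Qed.

Lemma L'_scal c x : L' j (scal c x) = scal c (L' j x).
Proof.
apply graphV_unique with (scal c x); [apply L'_graph|].
apply graphV_scal; apply L'_graph.
Qed.

Lemma L'_minus x y : L' j (minus x y) = minus (L' j x) (L' j y).
Proof.
apply graphV_unique with (minus x y); [apply L'_graph|].
apply graphV_minus; apply L'_graph.
Qed.

Lemma L'_bound x : norm (L' j x) <= KV * norm x.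
Proof. apply graphV_bound, L'_graph. Qed.

(** For [u] in [tildeH], [L' j (j u)] may be only a limit of images of pairs. A nearby [u'] whose
    image is a pair carries the weak bound, and [m2 u'] is close to [m2 u] because the weak norm is
    dominated by that of H. *)
Lemma L'_m2 u s : tildeH u -> 0 <= s -> m2 u <= s ^ 2 -> norm (L' j (j u)) <= 2 * KV * s.
Proof.
intros Hu Hs Hm; apply le_epsilon; intros eps He.
(* The final bound is 2 KV (s + d) + d, which this choice makes equal to 2 KV s + eps. *)
pose (d := eps / (2 * KV + 1)).
assert (Hd : 0 < d) by (unfold d, KV; apply Rdiv_lt_0_compat; lra).
destruct (L'_graph (j u) d Hd) as [x' [y' [[u' [w' [Hu' [Hw' [E [-> ->]]]]]] [Dx Dy]]]].
pose proof (tildeL'_bound u' w' Hu' Hw' E) as B.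
assert (B' : m2 u' <= 2 * s ^ 2 + 2 * d ^ 2).
{ assert (Hs' : tildeH (sub2 u' u)) by now apply tildeH_sub.
  pose proof (m2_add u (sub2 u' u) Hu Hs') as A.
  pose proof (m2_le_sq2 _ Hs') as A'.
  rewrite <- norm_j, j_sub, norm_sub_sym in A' by auto.
  assert (norm (minus (j u) (j u')) ^ 2 <= d ^ 2).
  { apply pow_incr; split; [apply norm_ge_0|lra]. }
  replace (m2 u') with (m2 (add2 u (sub2 u' u))); [lra|].
  apply N2_ext; intros x _; simpl; ring. }
rewrite <- norm_j in B by auto.
assert (B2 : norm (j w') <= 2 * KV * (s + d)).
{ apply le_of_sq; [unfold KV; lra|].
  replace (22 * 200000 ^ 2) with 880000000000 in B by ring.
  unfold KV; replace ((2 * 1000000 * (s + d)) ^ 2) with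
    (4000000000000 * (s ^ 2 + d ^ 2 + 2 * s * d)) by ring.
  assert (0 <= s * d) by nra.
  generalize (pow2_ge_0 s) (pow2_ge_0 d); lra. }
pose proof (norm_le_dist (L' j (j u)) (j w')) as N.
assert (d * (2 * KV + 1) = eps) by (unfold d, KV; field).
unfold KV in *; lra.
Qed.

(** * Estimates for lam - L_0, from the core to its closure *)

Lemma core0_L' lam x y : core0 x y ->
  Cmod lam * norm (L' j x) <= 8 * KV * (norm (minus (scal lam x) y) + norm x).
Proof.
intros [u [w [Du [Hw [E [-> ->]]]]]].
assert (Hu : tildeH u) by now apply dom_tildeH.
assert (Hl : tildeH (scal2 lam u)) by now apply tildeH_scal.
pose proof (m2_resolvent lam u w Du Hw E) as M.
rewrite <- !norm_j, j_sub, (cpl_scal _ _ _ Hc) in M by (auto; now apply tildeH_sub).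
set (Z := norm (minus (scal lam (j u)) (j w))) in *.
change (Cmod lam ^ 2 * m2 u <= 8 * Z ^ 2 + 16 * norm (j u) ^ 2) in M.
assert (Z0 : 0 <= Z) by apply norm_ge_0.
assert (X0 := norm_ge_0 (j u)).
destruct (Req_dec (Cmod lam) 0) as [L0|L0].
{ rewrite L0, Rmult_0_l; unfold KV; lra. }
assert (Lp : 0 < Cmod lam) by (generalize (Cmod_ge_0 lam); lra).
(* The square of 4 (Z + |u|) dominates 8 Z^2 + 16 |u|^2, so |lam|^2 m2(u) <= (|lam| s)^2; the factor
   2 KV of [L'_m2] then yields 8 KV. *)
pose (s := 4 * (Z + norm (j u)) / Cmod lam).
assert (S0 : 0 <= s).
{ apply Rmult_le_pos; [lra|left; now apply Rinv_0_lt_compat]. }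
assert (LS : Cmod lam * s = 4 * (Z + norm (j u))) by (unfold s; field; auto).
assert (B : norm (L' j (j u)) <= 2 * KV * s).
{ apply L'_m2; auto.
  apply Rmult_le_reg_l with (Cmod lam ^ 2); [now apply pow_lt|].
  rewrite <- Rpow_mult_distr, LS.
  eapply Rle_trans; [exact M|].
  assert (0 <= Z * norm (j u)) by nra; generalize (pow2_ge_0 Z); nra. }
apply Rmult_le_compat_l with (r := Cmod lam) in B; [|lra].
replace (Cmod lam * (2 * KV * s)) with (2 * KV * (Cmod lam * s)) in B by ring.
rewrite LS in B; lra.
Qed.

(** Dissipativity gives Re ((lam - L_0) x | x) >= (Re lam + 3/2) |x|^2. Cauchy-Schwarz bounds the
    left side, and one factor |x| is divided out. *)
Lemma core0_dissipative (lam : C) x y : 0 <= Re lam + 3 / 2 -> core0 x y ->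
  (Re lam + 3 / 2) * norm x <= norm (minus (scal lam x) y).
Proof.
intros Hl [u [w [Du [Hw [E [-> ->]]]]]].
assert (Hu : tildeH u) by now apply dom_tildeH.
pose proof (dissipative u w Du Hw E) as D.
rewrite <- (cpl_inner _ _ _ Hc) in D by auto.
change (Re (tildeH_inner u u)) with (sq2 u) in D; rewrite <- norm_j in D by auto.
pose proof (Re_ip_le (minus (scal lam (j u)) (j w)) (j u)) as S.
rewrite ip_minus, (ip_scal _ _ Hip), (ip_norm _ _ Hip) in S.
replace (Re (lam * RtoC (norm (j u) ^ 2) - ip (j w) (j u))) with
  (Re lam * norm (j u) ^ 2 - Re (ip (j w) (j u))) in S by (unfold Re; simpl; ring).
destruct (Req_dec (norm (j u)) 0) as [Z|Z].
- rewrite Z, Rmult_0_r; apply norm_ge_0.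
- assert (0 < norm (j u)) by (generalize (norm_ge_0 (j u)); lra).
  apply Rmult_le_reg_r with (norm (j u)); auto; simpl in *; lra.
Qed.

Lemma norm_res_dist (lam : C) (x y x' y' : H) :
  norm (minus (scal lam x) y) <= norm (minus (scal lam x') y') +
     (Cmod lam + 1) * (norm (minus x x') + norm (minus y y')).
Proof.
replace (minus (scal lam x) y) with
  (vplus (minus (scal lam x') y') (minus (scal lam (minus x x')) (minus y y'))) by vec.
eapply Rle_trans; [apply norm_vplus|apply Rplus_le_compat_l].
eapply Rle_trans; [exact (norm_sub_le (vscal lam (minus x x')) (minus y y'))|].
pose proof (norm_scal_le lam (minus x x')).
generalize (Cmod_ge_0 lam) (norm_ge_0 (minus x x')) (norm_ge_0 (minus y y')); nra.
Qed.

Lemma L0_dissipative (lam : C) x y : 0 <= Re lam + 3 / 2 -> L0 j x y ->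
  (Re lam + 3 / 2) * norm x <= norm (minus (scal lam x) y).
Proof.
intros Hl.
apply (closure_le core0 (fun x _ => (Re lam + 3 / 2) * norm x)
  (fun x y => norm (minus (scal lam x) y)) (Re lam + 3 / 2 + (Cmod lam + 1))).
- generalize (Cmod_ge_0 lam); lra.
- intros x0 y0 x' y'; pose proof (norm_le_dist x0 x') as N.
  generalize (Cmod_ge_0 lam) (norm_ge_0 (minus x0 x')) (norm_ge_0 (minus y0 y')); nra.
- intros x0 y0 x' y'; pose proof (norm_res_dist lam x' y' x0 y0) as N.
  rewrite (norm_sub_sym x' x0), (norm_sub_sym y' y0) in N.
  generalize (norm_ge_0 (minus x0 x')) (norm_ge_0 (minus y0 y')); nra.
- intros; now apply core0_dissipative.
Qed.

(** Both sides are continuous for the norm of H because [L'] is bounded, so the inequality passes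
    from the core to its closure. *)
Lemma L0_L' lam x y : L0 j x y ->
  Cmod lam * norm (L' j x) <= 8 * KV * (norm (minus (scal lam x) y) + norm x).
Proof.
apply (closure_le core0 (fun x _ => Cmod lam * norm (L' j x))
  (fun x y => 8 * KV * (norm (minus (scal lam x) y) + norm x))
  (8 * KV * (Cmod lam + 2))).
- generalize (Cmod_ge_0 lam); unfold KV; lra.
- intros x0 y0 x' y'; pose proof (norm_le_dist (L' j x0) (L' j x')) as N.
  rewrite <- L'_minus in N; pose proof (L'_bound (minus x0 x')) as B.
  generalize (Cmod_ge_0 lam) (norm_ge_0 (minus x0 x')) (norm_ge_0 (minus y0 y')).
  intros C0 N1 N2'.
  apply Rle_trans with (Cmod lam * norm (L' j x') + Cmod lam * (KV * norm (minus x0 x'))).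
  + rewrite <- Rmult_plus_distr_l; apply Rmult_le_compat_l; auto; lra.
  + apply Rplus_le_compat_l; unfold KV.
    assert (0 <= Cmod lam * norm (minus x0 x')) by nra.
    assert (0 <= Cmod lam * norm (minus y0 y')) by nra.
    lra.
- intros x0 y0 x' y'; pose proof (norm_res_dist lam x' y' x0 y0) as N.
  pose proof (norm_le_dist x' x0) as N'.
  rewrite (norm_sub_sym x' x0) in N, N'; rewrite (norm_sub_sym y' y0) in N.
  generalize (norm_ge_0 (minus x0 x')) (norm_ge_0 (minus y0 y')); unfold KV; lra.
- intros; now apply core0_L'.
Qed.

Lemma L_plus x y x' y' : L j x y -> L j x' y' -> L j (plus x x') (plus y y').
Proof.
intros [y0 [A ->]] [y0' [A' ->]]; exists (plus y0 y0'); split.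
- apply closure_plus; auto; apply core0_plus.
- rewrite L'_plus; vec.
Qed.

Lemma L_scal c x y : L j x y -> L j (scal c x) (scal c y).
Proof.
intros [y0 [A ->]]; exists (scal c y0); split.
- apply closure_scal; auto; apply core0_scal.
- rewrite L'_scal; vec.
Qed.

Lemma L_minus x y x' y' : L j x y -> L j x' y' -> L j (minus x x') (minus y y').
Proof.
intros A A'; replace (minus x x') with (plus x (scal (RtoC (-1)) x')) by vec.
replace (minus y y') with (plus y (scal (RtoC (-1)) y')) by vec.
apply L_plus; auto; now apply L_scal.
Qed.

Lemma L_eq (x y y' : H) : L j x y -> y = y' -> L j x y'.
Proof. now intros A <-. Qed.

Definition range0 (lam : C) (f : H) : Prop :=
  exists x y, core0 x y /\ f = minus (scal lam x) y.

Lemma range0_plus lam f g : range0 lam f -> range0 lam g -> range0 lam (plus f g).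
Proof.
intros [x [y [A ->]]] [x' [y' [A' ->]]]; exists (plus x x'), (plus y y').
split; [now apply core0_plus|vec].
Qed.

Lemma range0_scal lam c f : range0 lam f -> range0 lam (scal c f).
Proof.
intros [x [y [A ->]]]; exists (scal c x), (scal c y); split; [now apply core0_scal|vec].
Qed.

(** A triangular system solved upward in [n]: with e_n the image of [epair n], (lam + n + 2) e_n =
    (lam - L_0) e_n + n e_(n-1), and the coefficient is nonzero because Re lam > -3/2. *)
Lemma range0_epair lam n : - 3 / 2 < Re lam -> range0 lam (j (epair n)).
Proof.
intros Hl.
assert (Te : forall m, tildeH (epair m)) by (intros; apply dom_tildeH, epair_dom).
assert (A : forall m, range0 lam (minus (scal lam (j (epair m))) (j (L0_epair m)))).
{ intros m; exists (j (epair m)), (j (L0_epair m)); split; auto.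
  exists (epair m), (L0_epair m); split; [apply epair_dom|]; split.
  - apply tildeH_add; apply tildeH_scal, Te.
  - split; [apply L0_epair_agree|auto]. }
assert (B : forall m, j (L0_epair m) = plus (scal (RtoC (INR m)) (j (epair (pred m))))
   (scal (RtoC (- (INR m + 2))) (j (epair m)))).
{ intros m; unfold L0_epair; rewrite (cpl_add _ _ _ Hc), !(cpl_scal _ _ _ Hc); auto;
    now apply tildeH_scal. }
assert (N : forall m, (lam + RtoC (INR m + 2))%C <> RtoC 0).
{ intros m Z; apply (f_equal fst) in Z; simpl in Z; unfold Re in Hl.
  generalize (pos_INR m); lra. }
induction n as [|n IH].
- replace (j (epair 0)) with (scal (/ (lam + RtoC (INR 0 + 2)))%C
    (minus (scal lam (j (epair 0))) (j (L0_epair 0)))); [now apply range0_scal|].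
  rewrite B; apply ip_ext; intros z.
  rewrite (ip_scal _ _ Hip), ip_minus, (ip_plus _ _ Hip), !(ip_scal _ _ Hip).
  specialize (N O); rewrite RtoC_opp, RtoC_plus in *.
  change (RtoC (INR 0)) with (RtoC 0) in *; field; intros Z; apply N;
    (etransitivity; [|exact Z]); ring.
- replace (j (epair (S n))) with (scal (/ (lam + RtoC (INR (S n) + 2)))%C
    (plus (minus (scal lam (j (epair (S n)))) (j (L0_epair (S n))))
       (scal (RtoC (INR (S n))) (j (epair n))))).
  { apply range0_scal, range0_plus; auto; now apply range0_scal. }
  rewrite B; apply ip_ext; intros z; cbn [Nat.pred].
  rewrite (ip_scal _ _ Hip), (ip_plus _ _ Hip), ip_minus, (ip_plus _ _ Hip),
    !(ip_scal _ _ Hip).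
  specialize (N (S n)); rewrite RtoC_opp, RtoC_plus in *; field; intros Z; apply N;
    (etransitivity; [|exact Z]); ring.
Qed.

Lemma range0_espan lam v : - 3 / 2 < Re lam -> espan v -> range0 lam (j v).
Proof.
intros Hl; induction 1 as [n|u v Su IHu Sv IHv|c u Su IHu].
- now apply range0_epair.
- rewrite (cpl_add _ _ _ Hc) by now apply dom_tildeH, espan_dom.
  now apply range0_plus.
- rewrite (cpl_scal _ _ _ Hc) by now apply dom_tildeH, espan_dom.
  now apply range0_scal.
Qed.

(** * Inversion of lam - L for large |lam| *)

Section Resolvent.
Context (eps : R) (lam : C) (Heps : 0 < eps) (Hlam : - (3 / 2) + eps <= Re lam)
  (Hbig : 32 * KV * (1 + / eps) <= Cmod lam).

(** The coefficient is 8 KV divided by the threshold 32 KV (1 + 1/eps) for |lam|. *)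
Lemma L'_small (x y : H) : L0 j x y ->
  norm (L' j x) <= eps / (4 * (eps + 1)) * (norm (minus (scal lam x) y) + norm x).
Proof.
intros A; pose proof (L0_L' lam x y A) as B.
set (Z := norm (minus (scal lam x) y) + norm x) in *.
assert (Z0 : 0 <= Z)
  by (unfold Z; generalize (norm_ge_0 (minus (scal lam x) y)) (norm_ge_0 x); lra).
assert (I : 0 < / eps) by now apply Rinv_0_lt_compat.
assert (P : 0 < 32 * KV * (1 + / eps)) by (unfold KV; lra).
apply Rmult_le_reg_l with (32 * KV * (1 + / eps)); auto.
apply Rle_trans with (Cmod lam * norm (L' j x)).
- apply Rmult_le_compat_r; auto; apply norm_ge_0.
- eapply Rle_trans; [exact B|right; field; lra].
Qed.

Lemma small_coeff : 0 < eps / (4 * (eps + 1)) /\ eps / (4 * (eps + 1)) <= 1 / 4 /\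
  eps / (4 * (eps + 1)) <= eps / 4 .
Proof.
split; [apply Rdiv_lt_0_compat; lra|].
split; apply Rmult_le_reg_r with (4 * (eps + 1)); try lra;
  unfold Rdiv at 1; rewrite Rmult_assoc, Rinv_l by lra; nra.
Qed.

(** With v = |L' x| and z the residual norm for [L], dissipativity gives eps |x| <= z + v, and
    smallness gives v <= (z + v) / 4 + eps |x| / 4. Eliminating v leaves eps |x| <= 2 z. *)
Lemma L_lower_bound (x y : H) : L j x y -> norm x <= 2 / eps * norm (minus (scal lam x) y).
Proof.
intros [y0 [A ->]].
pose proof (L'_small x y0 A) as S.
pose proof (L0_dissipative lam x y0 ltac:(lra) A) as D.
destruct small_coeff as [T0 [T1 T2]].
set (t := eps / (4 * (eps + 1))) in *.
pose proof (norm_le_dist (vminus (vscal lam x) y0)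
  (vminus (vscal lam x) (vplus y0 (L' j x)))) as N.
replace (minus (vminus (vscal lam x) y0) (vminus (vscal lam x) (vplus y0 (L' j x))))
  with (L' j x) in N by vec.
set (z := norm (minus (scal lam x) (plus y0 (L' j x)))) in *.
set (z0 := norm (minus (scal lam x) y0)) in *.
set (v := norm (L' j x)) in *.
change (z0 <= z + v) in N.
assert (X0 := norm_ge_0 x); assert (V0 : 0 <= v) by apply norm_ge_0.
assert (Z0 : 0 <= z) by apply norm_ge_0.
assert (E1 : eps * norm x <= z0) by nra.
assert (V1 : v <= 1 / 4 * (z + v) + eps / 4 * norm x).
{ assert (t * z0 <= 1 / 4 * (z + v)).
  { apply Rmult_le_compat; try lra; apply norm_ge_0. }
  assert (t * norm x <= eps / 4 * norm x) by (apply Rmult_le_compat_r; auto).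
  lra. }
apply Rmult_le_reg_l with eps; auto.
replace (eps * (2 / eps * z)) with (2 * z) by (field; lra).
lra.
Qed.

(* [L' R_{L_0}(lam)] has small norm for large [|lam|], and [lam - L_0] is onto the
   dense span of the [epair n]. *)
Lemma L_residual (f : H) : exists x y, L j x y /\
  norm (minus f (minus (scal lam x) y)) <= 3 / 4 * norm f.
Proof.
destruct (Req_dec (norm f) 0) as [Z|Z].
(* Density needs a positive radius, so f = 0 is treated apart; the pair (0, 0) is a zero multiple of
   a pair of the core. *)
- exists zero, zero; split.
  + exists zero; split.
    * apply closure_incl.
      replace (zero : H) with (scal (RtoC 0) (j (epair 0))) at 1 by vec.
      replace (zero : H) with (scal (RtoC 0) (j (L0_epair 0))) by vec.
      apply core0_scal; exists (epair 0), (L0_epair 0); split; [apply epair_dom|]; split.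
      -- apply tildeH_add; apply tildeH_scal, dom_tildeH, epair_dom.
      -- split; [apply L0_epair_agree|auto].
    * replace (L' j zero) with (scal (RtoC 0) (L' j zero)); [vec|].
      rewrite <- L'_scal; f_equal; vec.
  + apply Rle_trans with (norm f); [right; f_equal; vec|lra].
- assert (F : 0 < norm f) by (generalize (norm_ge_0 f); lra).
  (* The residual is f - j v + L' x, of norm at most (1/8 + 9/8 * 1/4) |f| = 13/32 |f|. *)
  destruct (espan_dense_H f (norm f / 8)) as [v [Sv Hv]]; [lra|].
  destruct (range0_espan lam v ltac:(lra) Sv) as [x [y [A E]]].
  assert (A0 : L0 j x y) by now apply closure_incl.
  exists x, (plus y (L' j x)); split; [now exists y|].
  apply Rle_trans with (norm (vplus (minus f (j v)) (L' j x)));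
    [right; f_equal; rewrite E; vec|].
  eapply Rle_trans; [apply norm_vplus|].
  pose proof (L'_small x y A0) as S.
  pose proof (L0_dissipative lam x y ltac:(lra) A0) as D.
  destruct small_coeff as [T0 [T1 T2]].
  assert (T3 : eps / (4 * (eps + 1)) * (1 + / eps) = 1 / 4) by (field; lra).
  rewrite <- E in S, D.
  assert (X : norm x <= / eps * norm (j v)).
  { apply Rmult_le_reg_l with eps; auto.
    rewrite <- Rmult_assoc, Rinv_r, Rmult_1_l by lra.
    generalize (norm_ge_0 x); nra. }
  assert (S' : norm (L' j x) <= 1 / 4 * norm (j v)).
  { eapply Rle_trans; [exact S|]; rewrite <- T3, Rmult_assoc.
    apply Rmult_le_compat_l; lra. }
  pose proof (norm_le_dist (j v) f) as N; rewrite norm_sub_sym in N.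
  lra.
Qed.

(** Partial sums of the Neumann series: the residual is solved for again, and each round multiplies
    its norm by at most 3/4. *)
Lemma L_range_dense (f : H) d : 0 < d -> exists x y, L j x y /\
  norm (minus f (minus (scal lam x) y)) < d.
Proof.
intros Hd.
assert (K : forall n (f : H), exists x y, L j x y /\
  norm (minus f (minus (scal lam x) y)) <= (3 / 4) ^ n * norm f).
{ induction n as [|n IH]; intros f0.
  - destruct (L_residual f0) as [x [y [A B]]]; exists x, y; split; auto.
    generalize (norm_ge_0 f0); simpl; lra.
  - destruct (L_residual f0) as [x [y [A B]]].
    destruct (IH (minus f0 (minus (scal lam x) y))) as [x' [y' [A' B']]].
    exists (plus x x'), (plus y y'); split; [now apply L_plus|].
    apply Rle_trans with (norm (minus (minus f0 (minus (scal lam x) y))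
      (minus (scal lam x') y'))); [right; f_equal; vec|].
    eapply Rle_trans; [exact B'|].
    simpl; rewrite (Rmult_comm (3 / 4)), Rmult_assoc.
    apply Rmult_le_compat_l; auto; apply pow_le; lra. }
assert (F := norm_ge_0 f).
destruct (pow_lt_1_zero (3 / 4) ltac:(rewrite Rabs_pos_eq; lra) (d / (norm f + 1)))
  as [n Hn].
{ apply Rdiv_lt_0_compat; lra. }
specialize (Hn n (Nat.le_refl n)).
rewrite Rabs_pos_eq in Hn by (apply pow_le; lra).
destruct (K n f) as [x [y [A B]]]; exists x, y; split; auto.
eapply Rle_lt_trans; [exact B|].
apply Rmult_lt_compat_r with (r := norm f + 1) in Hn; [|lra].
unfold Rdiv in Hn; rewrite (Rmult_assoc d), Rinv_l in Hn by lra.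
assert (0 <= (3 * / 4) ^ n) by (apply pow_le; lra).
unfold Rdiv; nra.
Qed.

(** The lower bound makes approximate solutions a Cauchy family. Their limit is a solution because
    [L0] is closed and [L'] is continuous. *)
Lemma L_surjective (f : H) : exists x, L j x (minus (scal lam x) f).
Proof.
assert (I : 0 < / eps) by now apply Rinv_0_lt_compat.
destruct (complete_family
  (fun d x => exists y, L j x y /\ norm (minus f (minus (scal lam x) y)) < d))
  as [x Hx].
- intros d d' x Hd [y [A B]]; exists y; split; auto; lra.
- intros d Hd; now apply L_range_dense.
(* Two residuals below t eps / 8 differ by less than t eps / 4, and the lower bound multiplies this
   by 2 / eps, giving t / 2. *)
- intros t Ht; exists (t * eps / 8); split; [nra|].
  intros x x' [y [A B]] [y' [A' B']].
  pose proof (L_lower_bound _ _ (L_minus _ _ _ _ A A')) as K.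
  replace (minus (scal lam (minus x x')) (minus y y')) with
    (minus (minus f (minus (scal lam x') y')) (minus f (minus (scal lam x) y)))
    in K by vec.
  pose proof (norm_sub_le (minus f (minus (scal lam x') y'))
    (minus f (minus (scal lam x) y))) as N.
  assert (P : 0 < 2 / eps) by (apply Rdiv_lt_0_compat; lra).
  apply Rle_lt_trans with (2 / eps * (t * eps / 4)).
  + eapply Rle_trans; [exact K|]; apply Rmult_le_compat_l; lra.
  + replace (2 / eps * (t * eps / 4)) with (t / 2) by (field; lra); lra.
- exists x, (minus (minus (scal lam x) f) (L' j x)); split; [|vec].
  apply closure_closed; intros t Ht.
  assert (C0 := Cmod_ge_0 lam).
  (* Makes (|lam| + KV) t' at most t/2; the residual contributes the other half. *)
  pose (t' := t / (2 * (Cmod lam + KV + 1))).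
  assert (Ht' : 0 < t') by (unfold t', KV; apply Rdiv_lt_0_compat; lra).
  assert (Et : t' * (2 * (Cmod lam + KV + 1)) = t) by (unfold t', KV; field; lra).
  assert (Lt : t' < t) by (unfold KV in *; nra).
  destruct (Hx t' Ht') as [d [Hd K]].
  destruct (L_range_dense f (Rmin d (t / 2))) as [x' [y' [A B]]].
  { apply Rmin_glb_lt; lra. }
  assert (Kx : norm (minus x' x) < t').
  { apply K; exists y'; split; auto; eapply Rlt_le_trans; [exact B|apply Rmin_l]. }
  assert (Br : norm (minus f (minus (scal lam x') y')) < t / 2).
  { eapply Rlt_le_trans; [exact B|apply Rmin_r]. }
  destruct A as [y0 [A ->]].
  exists x', y0; split; [exact A|]; split; [rewrite norm_sub_sym; lra|].
  rewrite norm_sub_sym.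
  replace (minus y0 (minus (minus (scal lam x) f) (L' j x))) with
    (vplus (minus (vscal lam (minus x' x)) (L' j (minus x' x)))
       (minus f (minus (scal lam x') (plus y0 (L' j x'))))) by (rewrite L'_minus; vec).
  eapply Rle_lt_trans; [apply norm_vplus|].
  pose proof (norm_sub_le (vscal lam (minus x' x)) (L' j (minus x' x))) as N1.
  pose proof (norm_scal_le lam (minus x' x)) as N2'.
  pose proof (L'_bound (minus x' x)) as N3.
  assert (N4 := norm_ge_0 (minus x' x)).
  assert (Cmod lam * norm (minus x' x) <= Cmod lam * t')
    by (apply Rmult_le_compat_l; lra).
  unfold KV in *; nra.
Qed.

Lemma L_injective (f x x' : H) :
  L j x (minus (scal lam x) f) -> L j x' (minus (scal lam x') f) -> x = x'.
Proof.
intros A A'; pose proof (L_lower_bound _ _ (L_minus _ _ _ _ A A')) as B.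
assert (Z : norm (minus (scal lam (minus x x'))
  (minus (minus (scal lam x) f) (minus (scal lam x') f))) = 0).
{ rewrite <- norm_0; f_equal; vec. }
apply norm_sub_eq_0, Rle_antisym; [|apply norm_ge_0].
exact (Rle_trans _ _ _ B (Req_le _ _ (eq_trans (f_equal _ Z) (Rmult_0_r _)))).
Qed.

Definition resolvent (f : H) : H := iota (fun x : H => L j x (minus (scal lam x) f)).

Lemma resolvent_spec (f : H) : L j (resolvent f) (minus (scal lam (resolvent f)) f).
Proof.
apply (iota_correct (V := H) (fun x => L j x (minus (scal lam x) f))).
destruct (L_surjective f) as [x Hx]; exists x; split; auto.
intros x'; now apply L_injective.
Qed.

Lemma resolvent_norm (f : H) : norm (resolvent f) <= 2 / eps * norm f.
Proof.
eapply Rle_trans; [exact (L_lower_bound _ _ (resolvent_spec f))|].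
right; do 2 f_equal; vec.
Qed.

Lemma resolvent_correct : is_resolvent (L j) lam resolvent.
Proof.
split; [|split].
- split.
  + intros f g; apply L_injective with (plus f g); [apply resolvent_spec|].
    apply L_eq with (1 := L_plus _ _ _ _ (resolvent_spec f) (resolvent_spec g)); vec.
  + intros c f; apply L_injective with (scal c f); [apply resolvent_spec|].
    apply L_eq with (1 := L_scal c _ _ (resolvent_spec f)); vec.
  + exists (2 / eps); split; [apply Rdiv_lt_0_compat; lra|apply resolvent_norm].
- apply resolvent_spec.
- intros u y A; apply L_injective with (minus (scal lam u) y); [apply resolvent_spec|].
  apply L_eq with (1 := A); vec.
Qed.

Lemma resolvent_op_norm : Rbar_le (op_norm resolvent) (2 / eps).
Proof.
apply (proj2 (Lub_Rbar_correct _)); intros r [x [Hx ->]]; simpl.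
assert (P : 0 < 2 / eps) by (apply Rdiv_lt_0_compat; lra).
eapply Rle_trans; [apply resolvent_norm|].
rewrite <- (Rmult_1_r (2 / eps)) at 2; apply Rmult_le_compat_l; lra.
Qed.

Lemma not_eigenvalue : ~ is_eigenvalue (L j) lam.
Proof.
intros [u [U A]]; apply U; refine (norm_eq_zero u _).
apply Rle_antisym; [|apply norm_ge_0].
eapply Rle_trans; [exact (L_lower_bound _ _ A)|].
apply Rle_trans with (2 / eps * norm (zero : H)); [right; do 2 f_equal; vec|].
rewrite norm_0; lra.
Qed.

End Resolvent.
End Hilbert.

Theorem lemma3p10 :
  forall (H : CompleteNormedModule C_AbsRing) (ip : H -> H -> C)
    (j : cfun2 -> H),
  is_completion H ip j ->
  (forall eps : R, 0 < eps ->
     exists C1 C2 : R, 0 < C1 /\ 0 < C2 /\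
       forall lam : C,
         half_plane (- (3 / 2) + eps) lam -> C1 <= Cmod lam ->
         exists T : H -> H,
           is_resolvent (L j) lam T /\ Rbar_le (op_norm T) C2) /\
  (exists C0 : R, 0 < C0 /\
     forall lam : C, half_plane 0 lam -> C0 <= Rabs (Im lam) ->
       ~ is_eigenvalue (L j) lam).
Proof.
intros H ip j Hc; split.
- intros eps He; assert (I : 0 < / eps) by now apply Rinv_0_lt_compat.
  exists (32 * KV * (1 + / eps)), (2 / eps); split; [unfold KV; lra|].
  split; [apply Rdiv_lt_0_compat; lra|].
  intros lam Hl Hb; exists (resolvent j lam); split.
  + now apply (resolvent_correct ip j Hc eps).
  + now apply (resolvent_op_norm ip j Hc eps).
(* The first part's half plane becomes Re lam >= 0 for eps = 3/2, and |Im lam| <= |lam|. *)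
- exists (32 * KV * (1 + / (3 / 2))); split; [unfold KV; lra|].
  intros lam Hl Hb; apply (not_eigenvalue ip j Hc (3 / 2)); [lra| |].
  + unfold half_plane in Hl; lra.
  + eapply Rle_trans; [exact Hb|]; apply Rle_trans with (2 := Rmax_Cmod lam).
    apply Rmax_r.
Qed.
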